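(* Let $(\mathcal{M},\mathbf{g})$ be a four-dimensional pseudo-Riemannian manifold with a $2$-dimensional Abelian Killing algebra $\mathcal{G}_2=\langle\xi_{(1)},\xi_{(2)}\rangle$, $[\xi_{(1)},\xi_{(2)}]=0$, whose Killing leaves are non-null and orthogonally intransitive, and let $X$ be a vector field and $\Lambda\in\mathbb{R}$ a constant such that $\mathrm{Ric}(\mathbf{g})+\frac12 L_X\mathbf{g}=\Lambda\mathbf{g}$. Assume that (i) the curvature vector field $\mathcal{C}$ satisfies $\mathbf{g}(\mathcal{C},\mathcal{C})=0$; (ii) $\mathcal{G}_2$ has a null vector; (iii) $X\in\Xi=\mathrm{span}\{\xi_{(1)},\xi_{(2)}\}$ and $X$ is a symmetry of $\Xi^\perp$. Let $\mathbf{g}$ be written in adapted coordinates in the normal form (N) described in the context, and assume $\partial f_1^1/\partial t_2=0$, $\partial h_{12}/\partial t_1\neq0$ and $\Lambda=0$. Then, locally, for a suitable choice of adapted coordinates $\{t_1,t_2,z_1,z_2\}$, the Ricci soliton can be written in the form $$\mathbf{g}=\frac{1}{\sqrt{t_1}}\left(dt_1^2+\epsilon_0dt_2^2\right)+2\frac{t_2}{t_1^{3/2}}dt_1dz_1+\left(\psi\,t_1+\frac{4\epsilon_0}{9\sqrt{t_1}}\right)dz_1^2+2t_1\,dz_1dz_2$$ with $$X=a_1\partial_{z_1}+(a_2z_1+a_3)\partial_{z_2},$$ where $a_1,a_2,a_3\in\mathbb{R}$ are arbitrary constants, $\epsilon_0=\pm1$, and $\psi=\psi(t_1,t_2)$ is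 a differentiable function satisfying $$\partial_{t_1}^2\psi+\epsilon_0\,\partial_{t_2}^2\psi+\frac1{t_1}\,\partial_{t_1}\psi=\frac{2a_2}{\sqrt{t_1}}.$$ In particular, the orbit metric $\tilde{\mathbf{g}}=t_1^{-1/2}(dt_1^2+\epsilon_0dt_2^2)$ has Gauss curvature $-t_1^{-3/2}/4$.
   Context: All statements are local and all functions are differentiable (as often as needed). $L_X$ is the Lie derivative. Killing algebra and adapted coordinates. $\mathcal{G}_2$ is a 2-dimensional Abelian Lie algebra of Killing fields of $\mathbf{g}$, spanned by pointwise linearly independent commuting fields $\xi_{(1)},\xi_{(2)}$; $\Xi=\mathrm{span}\{\xi_{(1)},\xi_{(2)}\}$ is the distribution they generate, its integral surfaces are the Killing leaves, and $\Xi^\perp$ is the orthogonal distribution. Adapted coordinates are local coordinates $\{t_1,t_2,z_1,z_2\}$ such that $\mathcal{G}_2$ is generated by $\partial_{z_1},\partial_{z_2}$ (so $\xi_{(i)}=\partial_{z_i}$ for a basis) and the Killing leaves are the surfaces $t_1,t_2=$ const. In adapted coordinates, when the Killing leaves are non-null (i.e. $\det(h_{kl})\ne0$), $$\mathbf{g}=\tilde g_{ij}\,dt_idt_j+h_{kl}\,(dz_k+f_i^kdt_i)(dz_l+f_j^ldt_j),$$ with $\tilde g_{ij},h_{kl},f_i^k$ functions of $(t_1,t_2)$, summation over repeated indices. The orbit metric is $\tilde{\mathbf{g}}=\tilde g_{ij}dt_idt_j$ (a metric on the local orbit space), and its Gauss curvature $K$ is normalised by $\mathrm{Ric}(\tilde{\mathbf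 g})=K\tilde{\mathbf g}$. Curvature vector field: $\mathcal{C}=\mathcal{C}^1\partial_{z_1}+\mathcal{C}^2\partial_{z_2}$ with $\mathcal{C}^k=(\partial_{t_2}f_1^k-\partial_{t_1}f_2^k)/\sqrt{|\det\tilde{\mathbf{g}}|}$; so $\mathbf{g}(\mathcal{C},\mathcal{C})=h_{kl}\mathcal{C}^k\mathcal{C}^l$. Orthogonally intransitive means $\Xi^\perp$ is not integrable, i.e. $\mathcal{C}\neq0$. Condition (ii): $\mathcal{G}_2$ contains a nonzero Killing field that is everywhere null. Condition (iii): $X$ is tangent to the Killing leaves, and $[X,Y]$ is a section of $\Xi^\perp$ for every section $Y$ of $\Xi^\perp$. Normal form (N). Under these assumptions adapted coordinates are chosen such that $\xi_{(2)}=\partial_{z_2}$ is null and $f_2^1=f_2^2=0$, with $$\mathbf{g}=e^{-2P}(dt_1^2+\epsilon_0dt_2^2)+h_{11}(dz_1+f_1^1dt_1)^2+2h_{12}(dz_1+f_1^1dt_1)(dz_2+f_1^2dt_1),$$ where $\epsilon_0=\pm1$, $P,h_{11},h_{12},f_1^1,f_1^2$ are functions of $(t_1,t_2)$, $h_{12}\neq0$ and $(\partial_{t_2}f_1^1)^2+(\partial_{t_2}f_1^2)^2\neq0$.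
   Formalization: For ε₀=−1 the formal theorem also assumes (∂h₁₂/∂t₂)² < (∂h₁₂/∂t₁)²; without it the claim fails (h₁₂ may have null or negative-norm gradient in the orbit metric, whereas the new t₁, a constant multiple of |h₁₂|, has positive-norm gradient). *)

(* Defs.v *)
From HB Require Import structures.
From mathcomp Require Import all_boot all_order all_algebra.
From mathcomp Require Import all_classical all_reals all_analysis.
Set Implicit Arguments.
Unset Strict Implicit.
Unset Printing Implicit Defensive.
Import Order.TTheory GRing.Theory Num.Theory.
Import numFieldNormedType.Exports.
Local Open Scope classical_set_scope.
Local Open Scope ring_scope.

(* Everything is local: a manifold is an open set of R^n, tangent vectors and
   covectors are row vectors of components, and a metric at a point is its
   Gram matrix in the coordinate frame. *)

Section Geometry.
Variables (R : realType) (n : nat).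
Implicit Types (U : set 'rV[R]_n) (G : 'rV[R]_n -> 'M[R]_n).
Implicit Types (X Y : 'rV[R]_n -> 'rV[R]_n) (x v w : 'rV[R]_n).

Definition pd (i : 'I_n) (f : 'rV[R]_n -> R) : 'rV[R]_n -> R :=
  fun x => 'D_(delta_mx 0 i) f x.

(* C^k on an open set. The functions are total, but their values outside U
   are irrelevant. *)
Fixpoint Ck (k : nat) U (f : 'rV[R]_n -> R) : Prop :=
  if k is k'.+1 then
    (forall x, U x -> differentiable f x) /\ (forall i, Ck k' U (pd i f))
  else forall x, U x -> {for x, continuous f}.

Definition smooth_on U (f : 'rV[R]_n -> R) : Prop := forall k, Ck k U f.

Definition smooth_map_on m U (F : 'rV[R]_n -> 'rV[R]_m) : Prop :=
  forall j, smooth_on U (fun x => F x 0 j).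

Definition smooth_metric_on U G : Prop :=
  forall i j, smooth_on U (fun x => G x i j).

(* Any signature is allowed. *)
Definition pseudo_riemannian U G : Prop :=
  smooth_metric_on U G /\
  forall x, U x -> (G x)^T = G x /\ G x \in unitmx.

Definition gdot G x v w : R := (v *m G x *m w^T) 0 0.

Definition christoffel G (k i j : 'I_n) x : R :=
  2^-1 * \sum_l invmx (G x) k l *
    (pd i (fun y => G y j l) x + pd j (fun y => G y i l) x
     - pd l (fun y => G y i j) x).

(* Sign convention: positive on round spheres. *)
Definition ricci G x : 'M[R]_n := \matrix_(i, j) \sum_k
  (pd k (christoffel G k i j) x - pd j (christoffel G k i k) x
   + \sum_l (christoffel G k k l x * christoffel G l i j x
             - christoffel G k j l x * christoffel G l i k x)).

Definition lie_metric X G x : 'M[R]_n := \matrix_(i, j) \sum_k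
  (X x 0 k * pd k (fun y => G y i j) x
   + G x k j * pd i (fun y => X y 0 k) x
   + G x i k * pd j (fun y => X y 0 k) x).

Definition lie_bracket X Y x : 'rV[R]_n :=
  \row_j \sum_k (X x 0 k * pd k (fun y => Y y 0 j) x
                 - Y x 0 k * pd k (fun y => X y 0 j) x).

Definition ricci_soliton U G X (Lambda : R) : Prop :=
  [/\ pseudo_riemannian U G, smooth_map_on U X &
      forall x, U x -> ricci G x + 2^-1 *: lie_metric X G x = Lambda *: G x].

Definition killing U G X : Prop :=
  smooth_map_on U X /\ forall x, U x -> lie_metric X G x = 0.

Section KillingAlgebra.
Variable xi : 'I_2 -> 'rV[R]_n -> 'rV[R]_n.

Definition killing_frame x : 'M[R]_(2, n) := \matrix_a xi a x.

Definition abelian_killing_algebra U G : Prop :=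
  [/\ forall a, killing U G (xi a),
      forall a b x, U x -> lie_bracket (xi a) (xi b) x = 0 &
      forall x, U x -> row_free (killing_frame x)].

Definition in_leaf x v : Prop := (v <= killing_frame x)%MS.

Definition in_leaf_perp G x v : Prop := forall a, gdot G x v (xi a x) = 0.

Definition nonnull_leaves U G : Prop := forall x, U x ->
  \det (\matrix_(a < 2, b < 2) gdot G x (xi a x) (xi b x)) != 0.

Definition has_null_killing U G : Prop :=
  exists2 c : 'rV[R]_2, c != 0 & forall x, U x ->
    gdot G x (c *m killing_frame x) (c *m killing_frame x) = 0.

Definition perp_symmetry U G X : Prop :=
  forall Y, smooth_map_on U Y ->
    (forall x, U x -> in_leaf_perp G x (Y x)) ->
    forall x, U x -> in_leaf_perp G x (lie_bracket X Y x).

End KillingAlgebra.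

(* Phi : V -> W is a diffeomorphism with inverse Psi. *)
Definition coordinate_change (V W : set 'rV[R]_n)
    (Phi Psi : 'rV[R]_n -> 'rV[R]_n) : Prop :=
  [/\ open V /\ open W,
      smooth_map_on V Phi /\ smooth_map_on W Psi,
      (forall x, V x -> W (Phi x)) /\ (forall y, W y -> V (Psi y)) &
      (forall x, V x -> Psi (Phi x) = x) /\ (forall y, W y -> Phi (Psi y) = y)].

Definition pullback (Psi : 'rV[R]_n -> 'rV[R]_n) G y : 'M[R]_n :=
  \matrix_(i, j)
    gdot G (Psi y) ('D_(delta_mx 0 i) Psi y) ('D_(delta_mx 0 j) Psi y).

Definition symprod v w : 'M[R]_n := 2^-1 *: (v^T *m w + w^T *m v).

End Geometry.

Notation "v ⊙ w" := (symprod v w) (at level 40, left associativity) : ring_scope.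

Section AdaptedCoordinates.
Variable R : realType.
(* A point is x = (t1, t2, z1, z2); t and z are the blocks of the
   decomposition 2 + 2. *)
Local Notation E2 := 'rV[R]_2.
Local Notation E4 := 'rV[R]_(2 + 2).

Definition orb (x : E4) : E2 := lsubmx x.
Definition orbit_space (U : set E4) : set E2 := [set orb x | x in U].

Definition t1 (t : E2) : R := t 0 0.
Definition t2 (t : E2) : R := t 0 1.

Definition dt (i : 'I_2) : E4 := delta_mx 0 (lshift 2 i).
Definition dz (k : 'I_2) : E4 := delta_mx 0 (rshift 2 k).

Definition ddz (k : 'I_2) : E4 -> E4 := fun=> delta_mx 0 (rshift 2 k).

Definition mx2 (a b c d : R) : 'M[R]_2 :=
  \matrix_(i, j) if i == 0 then if j == 0 then a else b
                 else if j == 0 then c else d.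

(* The entry (i, k) of f is f_i^k. *)
Definition theta (f : E2 -> 'M[R]_2) (k : 'I_2) (t : E2) : E4 :=
  dz k + \sum_i f t i k *: dt i.

Definition adapted_metric (gt h f : E2 -> 'M[R]_2) (t : E2) : 'M[R]_(2 + 2) :=
  \sum_i \sum_j gt t i j *: (dt i ⊙ dt j)
  + \sum_k \sum_l h t k l *: (theta f k t ⊙ theta f l t).

Definition is_orbit_metric (O : set E2) (G : E2 -> 'M[R]_(2 + 2))
    (gt : E2 -> 'M[R]_2) : Prop :=
  exists h f : E2 -> 'M[R]_2, forall t, O t ->
    [/\ (gt t)^T = gt t, (h t)^T = h t, \det (h t) != 0 &
        G t = adapted_metric gt h f t].

Definition gauss_curvature (O : set E2) (gt : E2 -> 'M[R]_2) (K : E2 -> R) :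
    Prop :=
  forall t, O t -> ricci gt t = K t *: gt t.

Definition curvature_comp (gt f : E2 -> 'M[R]_2) (k : 'I_2) (t : E2) : R :=
  (pd 1 (fun s => f s 0 k) t - pd 0 (fun s => f s 1 k) t)
  / Num.sqrt `|\det (gt t)|.

Definition curvature_field (gt f : E2 -> 'M[R]_2) (x : E4) : E4 :=
  \sum_k curvature_comp gt f k (orb x) *: ddz k x.

Definition conformal_metric (eps0 : R) (P : E2 -> R) (t : E2) : 'M[R]_2 :=
  expR (- 2 * P t) *: mx2 1 0 0 eps0.

Definition null_fibre_metric (h11 h12 : E2 -> R) (t : E2) : 'M[R]_2 :=
  mx2 (h11 t) (h12 t) (h12 t) 0.

Definition shift_form (f11 f12 : E2 -> R) (t : E2) : 'M[R]_2 :=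
  mx2 (f11 t) (f12 t) 0 0.

(* e^{-2P} (dt1^2 + eps0 dt2^2) + h11 (dz1 + f11 dt1)^2
   + 2 h12 (dz1 + f11 dt1) (dz2 + f12 dt1) *)
Definition normal_form (eps0 : R) (P h11 h12 f11 f12 : E2 -> R) :
    E2 -> 'M[R]_(2 + 2) :=
  adapted_metric (conformal_metric eps0 P) (null_fibre_metric h11 h12)
    (shift_form f11 f12).

(* The coordinate fields of the new z-coordinates generate the same Lie
   algebra as the old ones; in particular the new t-coordinates are constant
   on the leaves. *)
Definition adapted_change (W : set E4) (Psi : E4 -> E4) : Prop :=
  exists2 A : 'M[R]_2, A \in unitmx & forall y, W y -> forall a : 'I_2,
    'D_(ddz a y) Psi y = \sum_b A a b *: ddz b (Psi y).

Definition soliton_metric (eps0 : R) (psi : E2 -> R) (t : E2) :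
    'M[R]_(2 + 2) :=
  (Num.sqrt (t1 t))^-1 *: (dt 0 ⊙ dt 0 + eps0 *: (dt 1 ⊙ dt 1))
  + (2 * (t2 t / t1 t `^ (3 / 2))) *: (dt 0 ⊙ dz 0)
  + (psi t * t1 t + 4 * eps0 / (9 * Num.sqrt (t1 t))) *: (dz 0 ⊙ dz 0)
  + (2 * t1 t) *: (dz 0 ⊙ dz 1).

Definition soliton_field (a1 a2 a3 : R) (x : E4) : E4 :=
  a1 *: ddz 0 x + (a2 * rsubmx x 0 0 + a3) *: ddz 1 x.

Definition soliton_orbit_metric (eps0 : R) (t : E2) : 'M[R]_2 :=
  (t1 t `^ (- (1 / 2))) *: mx2 1 0 0 eps0.

Definition psi_equation (O : set E2) (eps0 a2 : R) (psi : E2 -> R) : Prop :=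
  forall t, O t ->
    pd 0 (pd 0 psi) t + eps0 * pd 1 (pd 1 psi) t + (t1 t)^-1 * pd 0 psi t
    = 2 * a2 / Num.sqrt (t1 t).

End AdaptedCoordinates.

(* Main.v *)
(* Write q, h, phi, f for h12, h11, f11, f12 and E (dt1^2 + eps0 dt2^2) for the
   orbit metric. Since X is tangent to the leaves and preserves the orthogonal
   distribution, only the derivatives of its components along z1 and along the
   lift of d/dt1 survive; the soliton equation expresses the derivatives along
   z1 through functions of (t1, t2), and Schwarz's theorem then makes them
   constants A and B. On the orbit space the soliton equation becomes an
   overdetermined system for the Hessian of q, whose integrability condition is
   A q_1 = 0; hence A = 0 and q is harmonic. Two first integrals follow:
   (q_1^2 + eps0 q_2^2) / (E sqrt |q|) and q^2 f_2 / E are constant. Therefore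
   |q|, up to a constant factor, and its harmonic conjugate are isothermal
   coordinates in which the orbit metric is t1^(-1/2) (dt1^2 + eps0 dt2^2), and
   shifts of z1 and z2 by primitives of closed forms bring the connection form
   to its final shape. The only remaining equation, for the coefficient of dz1^2,
   is the linear equation for psi. *)
Require Import Defs.
From HB Require Import structures.
From Stdlib Require ZArith Ring_polynom InitialRing Ring_theory.
From mathcomp Require Import all_boot all_order all_algebra.
From mathcomp Require Import all_classical all_reals all_analysis.
From mathcomp Require Import ring lra.
Set Implicit Arguments.
Unset Strict Implicit.
Unset Printing Implicit Defensive.
Import Order.TTheory GRing.Theory Num.Theory.
Import numFieldNormedType.Exports.
Local Open Scope classical_set_scope.
Local Open Scope ring_scope.

(** * Smooth functions on open sets *)

(** The obstacle is the Ricci tensor of a metric with five free coefficient functions. It is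
    polynomial in their 2-jets and in the inverses of E and q, so its components are certified by
    normalising polynomials with integer coefficients. The same expressions give the necessary
    conditions and the converse, that every member of the family is a soliton. The gradient
    condition on h12 enters through the first integral of q: its value must be positive, since the
    scale of the new t1 is its power 2/3. Of the scales of z1 and z2, one normalises the curvature
    of the connection form, the other makes the coefficient of 2 dz1 dz2 equal to t1. The shape of
    the coefficient of dz1^2 comes from its linear equation: t1 solves the homogeneous part, so that
    psi enters through its derivatives only, and 4 eps0 / (9 sqrt t1) is the particular solution
    that absorbs the curvature term. Once A = 0, the z1-component of X is constant, and its
    z2-component has differential B d(z1 + F) with dF = f_1^1 dt1; this is the origin of a1, a2 and
    a3. *)

Section Differentiability.
Variable R : realType.

(** The epsilon form of the little-o definition. Differentiability of maps known only through
    inequalities, such as a local inverse, is reduced to it. *)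
Lemma differentiable_estimate (V W : normedModType R) (f : V -> W) x
    (L : {linear V -> W}) : continuous L ->
  (forall e, 0 < e -> \forall y \near x,
     `|f y - f x - L (y - x)| <= e * `|y - x|) ->
  differentiable f x /\ ('d f x = L :> (V -> W)).
Proof.
move=> cL fL.
have fE : f \o shift x = cst (f x) + L +o_ 0 id.
  apply/eqaddoP => e e0; have := fL e e0.
  rewrite (near_shift 0 x); apply: filterS => h /=.
  by rewrite !fctE/= subr0 addrK opprD addrA.
have dE := diff_unique cL fE; split=> //.
apply/diff_locallyP; split; first by rewrite dE.
by rewrite dE.
Qed.

Lemma differentiable_near_estimate (V W : normedModType R) (f : V -> W) x :
  differentiable f x -> forall e, 0 < e -> \forall y \near x,
     `|f y - f x - 'd f x (y - x)| <= e * `|y - x|.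
Proof.
move=> /diff_locallyP[_ /eqaddoP fE] e e0.
have := fE e e0; rewrite (near_shift 0 x); apply: filterS => h /=.
by rewrite !fctE/= subr0 addrK opprD addrA.
Qed.

Lemma near_eq_differentiable (V W : normedModType R) (f g : V -> W) x :
  (\near x, f x = g x) -> differentiable f x -> differentiable g x.
Proof.
move=> fg df.
have [] // := @differentiable_estimate _ _ g x ('d f x).
  exact: diff_continuous.
move=> e e0; have := differentiable_near_estimate df e0.
have -> := nbhs_singleton fg.
by move: fg; apply: filterS2 => y ->.
Qed.

Lemma rV_coordE n (v : 'rV[R]_n) : v = \sum_j v 0 j *: delta_mx 0 j.
Proof. exact: row_sum_delta. Qed.

Lemma derive_pdE n (f : 'rV[R]_n -> R) x v : differentiable f x ->
  'D_v f x = \sum_j v 0 j * pd j f x.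
Proof.
move=> df; rewrite deriveE// {1}(rV_coordE v) linear_sum.
by apply: eq_bigr => j _; rewrite linearZ /= /pd deriveE.
Qed.

Lemma differentiable_rV n m (F : 'rV[R]_n -> 'rV[R]_m) x :
  (forall j, differentiable (fun y => F y 0 j) x) -> differentiable F x.
Proof.
move=> dF.
have -> : F = \sum_j (fun y => F y 0 j *: delta_mx 0 j).
  by apply/funext => y; rewrite {1}(rV_coordE (F y)) fct_sumE.
apply: differentiable_sum => j.
exact: (@differentiableZl _ _ _ (fun y => F y 0 j)).
Qed.

Lemma continuous_rV (T : topologicalType) m (F : T -> 'rV[R]_m) x :
  (forall j, {for x, continuous (fun y => F y 0 j)}) -> {for x, continuous F}.
Proof.
move=> cF; apply/cvgrPdist_le => e e0; near=> y.
rewrite [leLHS]/Num.Def.normr/= mx_normrE; apply: bigmax_le => [|[i j] _].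
  exact: ltW.
rewrite /= !mxE (ord1 i).
move: j; near: y; apply: filter_forall => j.
have /cvgrPdist_le/(_ e e0) := cF j.
exact.
Unshelve. all: by end_near. Qed.

Lemma derive_comp_rV n m (h : 'rV[R]_m -> R) (F : 'rV[R]_n -> 'rV[R]_m) x v :
  differentiable F x -> differentiable h (F x) ->
  'D_v (h \o F) x = \sum_j pd j h (F x) * 'D_v (fun y => F y 0 j) x.
Proof.
move=> dF dh; rewrite deriveE; last exact: differentiable_comp.
rewrite diff_comp//= -deriveE// derive_pdE//; apply: eq_bigr => j _.
by rewrite mulrC -deriveE// (derive_mx (diff_derivable dF)) mxE.
Qed.

Lemma pd_near n i (f g : 'rV[R]_n -> R) x :
  (\near x, f x = g x) -> pd i f x = pd i g x.
Proof. exact: near_eq_derive. Qed.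

Lemma pd_on n i U (f g : 'rV[R]_n -> R) x : open U -> U x ->
  (forall y, U y -> f y = g y) -> pd i f x = pd i g x.
Proof.
move=> oU Ux fg; apply: pd_near.
by apply: filterS (open_nbhs_nbhs (conj oU Ux)) => y /fg.
Qed.

Lemma pd_cst n i (c : R) (x : 'rV[R]_n) : pd i (fun=> c) x = 0.
Proof. exact: derive_cst. Qed.

Lemma pdD n i (f g : 'rV[R]_n -> R) x :
  differentiable f x -> differentiable g x ->
  pd i (fun y => f y + g y) x = pd i f x + pd i g x.
Proof. by move=> df dg; rewrite /pd -deriveD//; exact: diff_derivable. Qed.

Lemma pdN n i (f : 'rV[R]_n -> R) x : differentiable f x ->
  pd i (fun y => - f y) x = - pd i f x.
Proof. by move=> df; rewrite /pd -deriveN//; exact: diff_derivable. Qed.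

Lemma pdB n i (f g : 'rV[R]_n -> R) x :
  differentiable f x -> differentiable g x ->
  pd i (fun y => f y - g y) x = pd i f x - pd i g x.
Proof. by move=> df dg; rewrite /pd -deriveB//; exact: diff_derivable. Qed.

Lemma pdM n i (f g : 'rV[R]_n -> R) x :
  differentiable f x -> differentiable g x ->
  pd i (fun y => f y * g y) x = pd i f x * g x + f x * pd i g x.
Proof.
move=> df dg; rewrite /pd.
have -> : (fun y => f y * g y) = f * g by [].
rewrite (deriveM (diff_derivable df) (diff_derivable dg)) addrC.
by rewrite -[_ *: 'D__ f x]/(_ * _) [X in X + _]mulrC.
Qed.

Lemma pd_coord n i j (x : 'rV[R]_n) : pd i (fun y => y 0 j) x = (i == j)%:R.
Proof.
have /derive_mx : derivable (@id 'rV[R]_n) x (delta_mx 0 i) by exact: derivable_id.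
by rewrite derive_id => /matrixP/(_ 0 j); rewrite !mxE eqxx/= eq_sym /pd => ->.
Qed.

Lemma pd_scomp n i (g : R -> R) (f : 'rV[R]_n -> R) x dg :
  differentiable f x -> is_derive (f x) 1 g dg ->
  differentiable (g \o f) x /\ pd i (g \o f) x = dg * pd i f x.
Proof.
move=> df Hg.
have dgx : differentiable g (f x) by apply/derivable1_diffP; case: Hg.
split; first exact: differentiable_comp.
rewrite /pd deriveE; last exact: differentiable_comp.
rewrite diff_comp//= -[X in 'd g _ X]mulr1 -[_ * 1]/(_ *: 1) linearZ/=.
by rewrite -!deriveE// derive_val; exact: mulrC.
Qed.

End Differentiability.

Section Smoothness.
Variable R : realType.

Lemma Ck_diff n k U (f : 'rV[R]_n -> R) x : Ck k.+1 U f -> U x ->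
  differentiable f x.
Proof. by move=> [df _] /df. Qed.

Lemma Ck_pd n k U (f : 'rV[R]_n -> R) i : Ck k.+1 U f -> Ck k U (pd i f).
Proof. by case=> _; exact. Qed.

Lemma CkW n k U (f : 'rV[R]_n -> R) : Ck k.+1 U f -> Ck k U f.
Proof.
elim: k f => [|k IH] f fU.
  by move=> x /(Ck_diff fU); exact: differentiable_continuous.
split; first by case: fU.
by move=> i; apply: IH; exact: Ck_pd.
Qed.

Lemma Ck_cont n k U (f : 'rV[R]_n -> R) x : Ck k U f -> U x -> {for x, continuous f}.
Proof. by elim: k f => [f fU /fU//|k IH f /CkW/IH]. Qed.

Lemma Ck_sub n k U V (f : 'rV[R]_n -> R) : V `<=` U -> Ck k U f -> Ck k V f.
Proof.
move=> VU; elim: k f => [f fU x /VU/fU//|k IH f [df pf]].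
by split=> [x /VU/df//|i]; exact: IH (pf i).
Qed.

Lemma near_eq_continuous (T : topologicalType) (f g : T -> R) x :
  (\forall y \near nbhs x, f y = g y) -> {for x, continuous f} ->
  {for x, continuous g}.
Proof.
move=> fg cf; rewrite /prop_for /continuous_at -(nbhs_singleton fg).
apply: cvg_trans cf; apply: near_eq_cvg.
exact: fg.
Qed.

Lemma Ck_on n k U (f g : 'rV[R]_n -> R) : open U ->
  (forall x, U x -> f x = g x) -> Ck k U f -> Ck k U g.
Proof.
move=> oU; elim: k f g => [|k IH] f g fg.
  move=> fU x Ux.
  apply: near_eq_continuous (fU x Ux).
  by apply: filterS (open_nbhs_nbhs (conj oU Ux)) => y /fg.
move=> [df pf]; split=> [x Ux|i].
  apply: near_eq_differentiable (df x Ux).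
  by apply: filterS (open_nbhs_nbhs (conj oU Ux)) => y /fg.
by apply: IH (pf i) => x Ux; apply: pd_on Ux fg.
Qed.

Lemma Ck_cst n k U c : Ck k U (fun _ : 'rV[R]_n => c).
Proof.
elim: k c => [|k IH] c; first by move=> x _; exact: cst_continuous.
split=> [x _|i]; first exact: differentiable_cst.
by rewrite (_ : pd i _ = fun=> 0)//; apply/funext => x; exact: pd_cst.
Qed.

Lemma CkD n k U (f g : 'rV[R]_n -> R) : open U -> Ck k U f -> Ck k U g ->
  Ck k U (fun x => f x + g x).
Proof.
move=> oU; elim: k f g => [|k IH] f g fU gU.
  by move=> x Ux; exact: continuousD (fU x Ux) (gU x Ux).
split=> [x Ux|i].
  by apply: differentiableD; [exact: Ck_diff fU Ux|exact: Ck_diff gU Ux].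
apply: (@Ck_on _ _ _ (fun x => pd i f x + pd i g x)) => // [x Ux|].
  by rewrite pdD//; [exact: Ck_diff fU Ux|exact: Ck_diff gU Ux].
by apply: IH; exact: Ck_pd.
Qed.

Lemma CkM n k U (f g : 'rV[R]_n -> R) : open U -> Ck k U f -> Ck k U g ->
  Ck k U (fun x => f x * g x).
Proof.
move=> oU; elim: k f g => [|k IH] f g fU gU.
  by move=> x Ux; exact: continuousM (fU x Ux) (gU x Ux).
split=> [x Ux|i].
  by apply: differentiableM; [exact: Ck_diff fU Ux|exact: Ck_diff gU Ux].
apply: (@Ck_on _ _ _ (fun x => pd i f x * g x + f x * pd i g x)) => // [x Ux|].
  by rewrite pdM//; [exact: Ck_diff fU Ux|exact: Ck_diff gU Ux].
by apply: CkD => //; apply: IH => //; [exact: Ck_pd|exact: CkW|exact: CkW|exact: Ck_pd].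
Qed.

Lemma CkN n k U (f : 'rV[R]_n -> R) : open U -> Ck k U f -> Ck k U (fun x => - f x).
Proof.
move=> oU fU; apply: (@Ck_on _ _ _ (fun x => -1 * f x)) => // [x _|].
  by rewrite mulN1r.
by apply: CkM => //; exact: Ck_cst.
Qed.

Lemma CkB n k U (f g : 'rV[R]_n -> R) : open U -> Ck k U f -> Ck k U g ->
  Ck k U (fun x => f x - g x).
Proof. by move=> oU fU gU; apply: CkD => //; exact: CkN. Qed.

Lemma Ck_sum n k U (I : Type) (r : seq I) (f : I -> 'rV[R]_n -> R) : open U ->
  (forall i, Ck k U (f i)) -> Ck k U (fun x => \sum_(i <- r) f i x).
Proof.
move=> oU fU; elim: r => [|i r IH].
  by apply: Ck_on (Ck_cst k U 0) => // x _; rewrite big_nil.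
apply: (@Ck_on _ _ _ (fun x => f i x + \sum_(i <- r) f i x)) => // [x _|].
  by rewrite big_cons.
exact: CkD.
Qed.

Lemma Ck_coord n k U j : open U -> Ck k U (fun x : 'rV[R]_n => x 0 j).
Proof.
move=> oU; case: k => [|k]; first by move=> x _; exact: coord_continuous.
split=> [x _|i]; first exact: differentiable_coord.
by apply: (@Ck_on _ _ _ (fun=> (i == j)%:R)) (Ck_cst _ _ _) => // x _; rewrite pd_coord.
Qed.

Lemma Ck_comp n m k U V (h : 'rV[R]_m -> R) (F : 'rV[R]_n -> 'rV[R]_m) :
  open U -> (forall x, U x -> V (F x)) ->
  (forall j, Ck k U (fun x => F x 0 j)) -> Ck k V h -> Ck k U (h \o F).
Proof.
move=> oU UV; elim: k h => [|k IH] h FU hV.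
  move=> x Ux; apply: continuous_comp; last exact/hV/UV.
  by apply: continuous_rV => j; exact: FU.
have dF x : U x -> differentiable F x.
  by move=> Ux; apply: differentiable_rV => j; exact: Ck_diff (FU j) Ux.
split=> [x Ux|i].
  by apply: differentiable_comp; [exact: dF|exact/(Ck_diff hV)/UV].
apply: (@Ck_on _ _ _ (fun x => \sum_j (pd j h \o F) x * pd i (fun y => F y 0 j) x)) => //.
  move=> x Ux; rewrite /pd derive_comp_rV//; first exact: dF.
  exact/(Ck_diff hV)/UV.
apply: Ck_sum => // j; apply: CkM => //.
  by apply: IH; [move=> l; exact/CkW/FU|exact: Ck_pd].
exact/Ck_pd/FU.
Qed.

(** [G] is a class of functions of one variable closed under differentiation on [A], for instance
    the multiples of powers. Such a class replaces smoothness on the line: the induction on k stays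
    inside it by the chain rule. *)
Lemma Ck_scomp n k U (A : set R) (G : (R -> R) -> Prop) (g : R -> R)
    (f : 'rV[R]_n -> R) : open U ->
  (forall g, G g -> exists2 g', G g' & forall a, A a -> is_derive a 1 g (g' a)) ->
  G g -> (forall x, U x -> A (f x)) -> Ck k U f -> Ck k U (g \o f).
Proof.
move=> oU GG Gg fA fU; elim: k g Gg fU => [|k IH] g Gg fU.
  have [g' Gg' dg] := GG _ Gg.
  move=> x Ux; apply: continuous_comp; first exact: fU.
  apply: differentiable_continuous; apply/derivable1_diffP.
  by case: (dg _ (fA _ Ux)).
have [g' Gg' dg] := GG _ Gg.
have gf x : U x -> differentiable f x /\ is_derive (f x) 1 g (g' (f x)).
  by move=> Ux; split; [exact: Ck_diff fU Ux|exact/dg/fA].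
split=> [x /gf[df dgf]|i].
  by apply: differentiable_comp => //; apply/derivable1_diffP; case: dgf.
apply: (@Ck_on _ _ _ (fun x => (g' \o f) x * pd i f x)) => // [x /gf[df dgf]|].
  by have [_ ->] := pd_scomp i df dgf.
apply: CkM => //; [apply: IH => //; exact: CkW|exact: Ck_pd].
Qed.

Lemma Ck_inv n k U (f : 'rV[R]_n -> R) : open U -> (forall x, U x -> f x != 0) ->
  Ck k U f -> Ck k U (fun x => (f x)^-1).
Proof.
move=> oU f0; apply: (@Ck_scomp _ _ _ [set a | a != 0]
  (fun g => exists c m, g = fun a => c * a^-1 ^+ m) GRing.inv _ oU) => //; last first.
  by exists 1, 1%N; apply/funext => a; rewrite mul1r expr1.
move=> _ [c [m ->]]; exists (fun a => (- c * m%:R) * a^-1 ^+ m.+1).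
  by exists (- c * m%:R), m.+1.
move=> a a0.
have dv : is_derive a 1 (GRing.inv : R -> R) (- a^-1 ^+ 2).
  have := @is_deriveV R id a 1 1 a0 (is_derive_id _ _).
  by rewrite exprVn -[_ *: _]/(_ * _) mulr1.
have -> : (fun a => c * a^-1 ^+ m) = c *: ((GRing.inv : R -> R) ^+ m).
  by apply/funext => b; rewrite !fctE.
case: m => [|m].
  rewrite expr0 mulr0 mul0r.
  have -> : c *: (1 : R -> R) = cst c by apply/funext => b; rewrite -[LHS]/(c * 1) mulr1.
  exact: is_derive_cst.
apply: is_derive_eq.
rewrite -![_ *: _]/(_ * _) !exprS; ring.
Qed.

Lemma Ck_powR n k U (f : 'rV[R]_n -> R) p : open U -> (forall x, U x -> 0 < f x) ->
  Ck k U f -> Ck k U (fun x => f x `^ p).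
Proof.
move=> oU f0; apply: (@Ck_scomp _ _ _ [set a | 0 < a]
  (fun g => exists c p, g = fun a => c * a `^ p) (powR (R:=R) ^~ p) _ oU) => //; last first.
  by exists 1, p; apply/funext => a; rewrite mul1r.
move=> _ [c [q ->]]; exists (fun a => c * q * a `^ (q - 1)).
  by exists (c * q), (q - 1).
move=> a a0; have dp := is_derive1_powR q a0.
rewrite -mulrA.
have -> : (fun a => c * a `^ q) = c *: (powR (R:=R) ^~ q) by [].
exact: is_deriveZ.
Qed.

Lemma Ck_expR n k U (f : 'rV[R]_n -> R) : open U ->
  Ck k U f -> Ck k U (fun x => expR (f x)).
Proof.
move=> oU; apply: (@Ck_scomp _ _ _ setT (eq expR) expR _ oU) => // _ <-.
by exists expR => // a _; exact: is_derive_expR.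
Qed.

End Smoothness.

(** * Mean value theorem and symmetry of second derivatives *)

Section MeanValue.
Variables (R : realType) (n : nat).
Implicit Types (f : 'rV[R]_n -> R) (x y v p : 'rV[R]_n).

Lemma is_derive_line f x v s : differentiable f (x + s *: v) ->
  is_derive s 1 (fun t => f (x + t *: v)) ('D_v f (x + s *: v)).
Proof.
move=> /(@diff_derivable _ _ _ _ _ v) df.
have gE : (fun h => h^-1 *: ((fun t => f (x + t *: v)) (h *: 1 + s) - f (x + s *: v)))
    = fun h => h^-1 *: (f (h *: v + (x + s *: v)) - f (x + s *: v)).
  apply/funext => h; congr (_ *: (f _ - _)).
  by rewrite -[h *: 1]/(h * 1) mulr1 scalerDl addrCA.
apply: DeriveDef; first by rewrite /derivable gE.
by rewrite /derive gE.
Qed.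

Lemma mvt_line f x v :
  (forall s : R, 0 <= s <= 1 -> differentiable f (x + s *: v)) ->
  exists2 s : R, 0 <= s <= 1 & f (x + v) - f x = 'D_v f (x + s *: v).
Proof.
move=> df.
have der (s : R) : s \in `[0, 1]%R -> is_derive s 1 (fun t => f (x + t *: v)) ('D_v f (x + s *: v)).
  by rewrite in_itv/= => s01; exact/is_derive_line/df.
have der' (s : R) (s01 : s \in `]0, 1[%R) := der s (subset_itv_oo_cc s01).
have cont : {within `[0, 1], continuous (fun t => f (x + t *: v))}.
  by apply: derivable_within_continuous => s s01; case: (der _ s01).
have [s] := MVT_segment (@ler01 R) der' cont.
rewrite in_itv/= => s01; rewrite scale1r scale0r addr0 subr0 mulr1 => fE.
by exists s.
Qed.

Lemma segment_ball p (r : R) x y (s : R) : ball p r x -> ball p r y -> 0 <= s <= 1 ->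
  ball p r (x + s *: (y - x)).
Proof.
rewrite -!ball_normE/= => px py /andP[s0 s1].
have -> : p - (x + s *: (y - x)) = (1 - s) *: (p - x) + s *: (p - y).
  by apply/rowP => i; rewrite !mxE; ring.
have s1' : 0 <= 1 - s by rewrite subr_ge0.
rewrite (le_lt_trans (ler_normD _ _))// !normrZ (ger0_norm s0) (ger0_norm s1').
move: s0; rewrite le_eqVlt => /orP[/eqP<-|s0]; first by rewrite subr0 mul1r mul0r addr0.
have : (1 - s) * `|p - x| <= (1 - s) * r by apply: ler_wpM2l => //; exact: ltW.
have : s * `|p - y| < s * r by rewrite ltr_pM2l.
lra.
Qed.

Lemma cst_on_ball f p r x : (forall y, ball p r y -> differentiable f y) ->
  (forall y i, ball p r y -> pd i f y = 0) -> ball p r x -> f x = f p.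
Proof.
move=> df pf px.
have pp : ball p r p.
  by apply: ballxx; move: px; rewrite -ball_normE/=; exact: le_lt_trans.
have [s s01|s s01 fE] := @mvt_line f p (x - p).
  exact/df/segment_ball.
apply/eqP; rewrite -subr_eq0; apply/eqP.
rewrite -[in LHS](subrKC p x) fE derive_pdE; last exact/df/segment_ball.
by rewrite big1// => i _; rewrite pf ?mulr0//; exact/segment_ball.
Qed.

Lemma derive_scale f x (s : R) i : differentiable f x ->
  'D_(s *: delta_mx 0 i) f x = s * pd i f x.
Proof. by move=> df; rewrite /pd !deriveE// linearZ. Qed.

(** The mean value theorem is used twice: along [ei] for the difference [phi] of f on two parallel
    segments, then along [ej] for [pd i f]. The condition on s keeps the whole parallelogram in the
    ball. *)
Lemma second_difference U f p i j r s : Ck 2 U f -> (forall x, ball p r x -> U x) ->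
  0 < s -> s + s < r ->
  exists2 y, ball p r y &
    f (p + s *: delta_mx 0 j + s *: delta_mx 0 i) - f (p + s *: delta_mx 0 i)
    - f (p + s *: delta_mx 0 j) + f p = s ^+ 2 * pd j (pd i f) y.
Proof.
move=> f2 prU s0 sr.
set ei := delta_mx 0 i; set ej := delta_mx 0 j.
have nd k : `|delta_mx 0 k : 'rV[R]_n| <= 1.
  rewrite [leLHS]/Num.Def.normr/= mx_normrE; apply: bigmax_le => // -[a b] _.
  by rewrite /= mxE; case: (_ && _); rewrite ?normr1 ?normr0.
have inb (a b : R) : 0 <= a <= 1 -> 0 <= b <= 1 -> ball p r (p + b *: (s *: ej) + a *: (s *: ei)).
  move=> /andP[a0 a1] /andP[b0 b1]; rewrite -ball_normE/=.
  rewrite -addrA opprD addNKr normrN (le_lt_trans (ler_normD _ _))//.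
  rewrite !normrZ (ger0_norm a0) (ger0_norm b0) (gtr0_norm s0).
  apply: le_lt_trans sr; apply: lerD.
    by rewrite -[leRHS]mul1r ler_pM ?mulr_ge0 ?normr_ge0 ?(ltW s0)// ler_piMr ?(ltW s0)// nd.
  by rewrite -[leRHS]mul1r ler_pM ?mulr_ge0 ?normr_ge0 ?(ltW s0)// ler_piMr ?(ltW s0)// nd.
have d1 y : ball p r y -> differentiable f y by move=> /prU; exact: Ck_diff f2.
have le01 : 0 <= (1:R) <= 1 by rewrite ler01 lexx.
have le00 : 0 <= (0:R) <= 1 by rewrite ler01 lexx.
pose phi t := f (p + s *: ej + t *: (s *: ei)) - f (p + t *: (s *: ei)).
pose dphi t := 'D_(s *: ei) f (p + s *: ej + t *: (s *: ei)) - 'D_(s *: ei) f (p + t *: (s *: ei)).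
have der (t : R) : t \in `[0, 1]%R -> is_derive t 1 phi (dphi t).
  rewrite in_itv/= => t01; apply: is_deriveB; apply: is_derive_line; apply: d1.
    by have := inb t 1 t01 le01; rewrite scale1r.
  by have := inb t 0 t01 le00; rewrite scale0r addr0.
have der' (t : R) (t01 : t \in `]0, 1[%R) := der t (subset_itv_oo_cc t01).
have cont : {within `[0, 1], continuous phi}.
  by apply: derivable_within_continuous => t t01; case: (der _ t01).
have [t] := MVT_segment (@ler01 R) der' cont.
rewrite in_itv/= => t01; rewrite /phi !scale1r !scale0r !addr0 subr0 mulr1 => phiE.
have De x : ball p r x -> 'D_(s *: ei) f x = s * pd i f x.
  by move=> xb; apply: derive_scale; exact: d1.
have f1 := Ck_pd i f2.
have [b b01|b b01 fE] := @mvt_line (pd i f) (p + t *: (s *: ei)) (s *: ej).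
  by apply: Ck_diff f1 _; apply: prU; rewrite addrAC; exact: inb.
exists (p + b *: (s *: ej) + t *: (s *: ei)); first exact: inb.
have -> : f (p + s *: ej + s *: ei) - f (p + s *: ei) - f (p + s *: ej) + f p
  = f (p + s *: ej + s *: ei) - f (p + s *: ei) - (f (p + s *: ej) - f p) by ring.
rewrite phiE /dphi !De; first last.
- by have := inb t 1 t01 le01; rewrite scale1r.
- by have := inb t 0 t01 le00; rewrite scale0r addr0.
rewrite -mulrBr addrAC fE addrAC.
have f1x : differentiable (pd i f) (p + b *: (s *: ej) + t *: (s *: ei)).
  by apply: Ck_diff f1 _; apply: prU; exact: inb.
by rewrite (derive_scale s j f1x) expr2 mulrA.
Qed.

(** The second difference is symmetric in i and j, so the two mixed derivatives take a common value
    at two points close to p; continuity at p concludes. *)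
Lemma pd_comm U f i j p : open U -> Ck 2 U f -> U p ->
  pd i (pd j f) p = pd j (pd i f) p.
Proof.
move=> oU f2 Up; apply/eqP; rewrite -subr_eq0 -normr_le0; apply/ler_addgt0Pl => e e0.
rewrite addr0.
have c1 := Ck_cont (Ck_pd i (Ck_pd j f2)) Up.
have c2 := Ck_cont (Ck_pd j (Ck_pd i f2)) Up.
have e2 : 0 < e / 2 by rewrite divr_gt0.
have nU : \forall y \near p, U y by exact: open_nbhs_nbhs.
have : nbhs p _ := filterI nU (filterI ((cvgrPdist_le _ _).1 c1 _ e2) ((cvgrPdist_le _ _).1 c2 _
  e2)).
rewrite nbhs_ballP => -[r /= r0 rb].
have s0 : 0 < r / 4 by rewrite divr_gt0.
have sr : r / 4 + r / 4 < r by lra.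
have pU x : ball p r x -> U x by move=> /rb[].
have [y py yE] := second_difference i j f2 pU s0 sr.
have [z pz zE] := second_difference j i f2 pU s0 sr.
have [_ [+ _]] := rb _ pz; have [_ [_ +]] := rb _ py.
have : pd j (pd i f) y = pd i (pd j f) z.
  apply: (@mulfI _ ((r / 4) ^+ 2)); first by rewrite expf_neq0 ?gt_eqF.
  apply: etrans (esym yE) (etrans _ zE).
  rewrite [p + r / 4 *: delta_mx 0 j + _]addrAC; congr (_ + f p).
  exact: addrAC.
set a := pd i _ p; set b := pd j _ p => ->; set c := pd _ _ z.
clearbody a b c => ac bc.
rewrite -(subrKA c a (- b)) (splitr e).
by apply: le_trans (ler_normD (a - c) (c - b)) _; apply: lerD; rewrite // distrC.
Qed.

End MeanValue.

(** Joins completeness with the normed structure of matrices, as the Banach fixed point theorem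
    below requires. *)
HB.instance Definition _ (R : realType) m n := Complete.on 'M[R]_(m, n).

(** * Inverse function theorem *)

Section InverseFunction.
Variable R : realType.

Lemma Ck_prod n k U (I : Type) (r : seq I) (f : I -> 'rV[R]_n -> R) : open U ->
  (forall i, Ck k U (f i)) -> Ck k U (fun x => \prod_(i <- r) f i x).
Proof.
move=> oU fU; elim: r => [|i r IH].
  by apply: Ck_on (Ck_cst k U 1) => // x _; rewrite big_nil.
apply: (@Ck_on _ _ _ _ (fun x => f i x * \prod_(i <- r) f i x)) => // [x _|].
  by rewrite big_cons.
exact: CkM.
Qed.

Lemma Ck_det n k U m (A : 'rV[R]_n -> 'M[R]_m) : open U ->
  (forall i j, Ck k U (fun x => A x i j)) -> Ck k U (fun x => \det (A x)).
Proof.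
move=> oU AU; apply: Ck_sum => // s; apply: CkM => //; first exact: Ck_cst.
exact: Ck_prod.
Qed.

Lemma Ck_invmx n k U m (A : 'rV[R]_n -> 'M[R]_m) i j : open U ->
  (forall x, U x -> A x \in unitmx) ->
  (forall i j, Ck k U (fun x => A x i j)) -> Ck k U (fun x => invmx (A x) i j).
Proof.
move=> oU uA AU.
apply: (@Ck_on _ _ _ _ (fun x => (\det (A x))^-1 * ((-1) ^+ (j + i) *
   \det (row' j (col' i (A x)))))) => // [x Ux|].
  by rewrite /invmx uA// !mxE.
apply: CkM => //.
  apply: Ck_inv => // [x /uA|]; first by rewrite unitmxE unitfE.
  exact: Ck_det.
apply: CkM => //; first exact: Ck_cst.
apply: Ck_det => // a b.
by apply: Ck_on (AU (lift j a) (lift i b)) => // x _; rewrite !mxE.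
Qed.

Lemma coord_norm n (v : 'rV[R]_n) i : `|v 0 i| <= `|v|.
Proof.
rewrite [leRHS]/Num.Def.normr/= mx_normrE.
exact: (le_bigmax _ (fun k : 'I_1 * 'I_n => `|v k.1 k.2|) (0, i)).
Qed.

Lemma rV_norm_le n (v : 'rV[R]_n) e : 0 <= e -> (forall i, `|v 0 i| <= e) -> `|v| <= e.
Proof.
move=> e0 ve; rewrite [leLHS]/Num.Def.normr/= mx_normrE.
by apply: bigmax_le => // -[a i] _; rewrite /= (ord1 a).
Qed.

Lemma mulmx_norm n m (v : 'rV[R]_n) (A : 'M[R]_(n, m)) :
  `|v *m A| <= (1 + \sum_i \sum_j `|A i j|) * `|v|.
Proof.
have S0 : 0 <= \sum_i \sum_j `|A i j|.
  by apply: sumr_ge0 => i _; exact: sumr_ge0.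
apply: rV_norm_le => [|j]; first by rewrite mulr_ge0// addr_ge0.
rewrite mxE (le_trans (ler_norm_sum _ _ _))//.
apply: (@le_trans _ _ ((\sum_i \sum_j `|A i j|) * `|v|)); last first.
  by rewrite ler_wpM2r// lerDr.
rewrite mulr_suml ler_sum// => i _; rewrite normrM mulrC.
apply: ler_pM; rewrite ?coord_norm//.
by rewrite (bigD1 j)//= lerDl sumr_ge0.
Qed.

Lemma mulmxr_continuous n m (A : 'M[R]_(n, m)) : continuous (mulmxr A : 'rV[R]_n -> 'rV[R]_m).
Proof.
move=> x; apply: continuous_rV => j.
apply: (@Ck_cont _ _ 0 setT) => //.
apply: (@Ck_on _ _ _ _ (fun y => \sum_i y 0 i * A i j)) => // [|y _|].
- exact: openT.
- by rewrite /= mxE.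
by apply: Ck_sum => [|i]; [exact: openT|apply: CkM; [exact: openT|apply: Ck_coord; exact:
  openT|exact: Ck_cst]].
Qed.

Definition jac n (F : 'rV[R]_n -> 'rV[R]_n) x : 'M[R]_n :=
  \matrix_(i, j) pd i (fun y => F y 0 j) x.

Lemma mvt_norm n (H : 'rV[R]_n -> 'rV[R]_n) p r (c : R) x y : 0 <= c ->
  (forall z j, ball p r z -> differentiable (fun y => H y 0 j) z) ->
  (forall z i j, ball p r z -> `|pd i (fun y => H y 0 j) z| <= c) ->
  ball p r x -> ball p r y -> `|H y - H x| <= n%:R * c * `|y - x|.
Proof.
move=> c0 dH Hc px py.
apply: rV_norm_le => [|j]; first by rewrite !mulr_ge0.
have [s s01|s s01 HE] := @mvt_line _ _ (fun y => H y 0 j) x (y - x).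
  exact/dH/segment_ball.
rewrite !mxE -{1}(subrKC x y) HE derive_pdE; last exact/dH/segment_ball.
rewrite (le_trans (ler_norm_sum _ _ _))//.
have -> : n%:R * c * `|y - x| = \sum_(i < n) c * `|y - x|.
  by rewrite sumr_const card_ord -mulrA mulr_natl.
apply: ler_sum => i _; rewrite normrM mulrC ler_pM// ?coord_norm//.
exact/Hc/segment_ball.
Qed.

Lemma near_lipschitz_continuous (V W : normedModType R) (f : V -> W) x k : 0 < k ->
  (\forall z \near x, `|f x - f z| <= k * `|x - z|) -> {for x, continuous f}.
Proof.
move=> k0 fk; apply/cvgrPdist_le => d d0.
have dk0 : 0 < d / k by rewrite divr_gt0.
have : \forall z \near x, `|x - z| <= d / k.
  by have /cvgrPdist_le/(_ _ dk0) : x @[x --> x] --> x by exact: cvg_id.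
apply: filterS2 fk => z fk xz; apply: le_trans fk _.
by rewrite mulrC -ler_pdivlMr.
Qed.

(** With A the inverse Jacobian at p, the map H = id - F A has zero derivative at p, hence contracts
    by 1/2 on a small ball, and F x = y says that x is a fixed point of H + y A. The partial
    derivatives of the inverse are entries of the inverse Jacobian taken along the inverse itself,
    which raises its regularity one order at a time. *)
Lemma inverse_function n U (F : 'rV[R]_n -> 'rV[R]_n) p :
  open U -> U p -> smooth_map_on U F -> jac F p \in unitmx ->
  exists V W Psi, [/\ coordinate_change V W F Psi, V p, V `<=` U,
    (forall x, V x -> jac F x \in unitmx) &
    forall y, W y -> forall i j,
      pd i (fun z => Psi z 0 j) y = invmx (jac F (Psi y)) i j].
Proof.
move=> oU Up sF uJ; set A := invmx (jac F p).
have dF x j : U x -> differentiable (fun y => F y 0 j) x by exact: (Ck_diff (sF j 1%N)).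
pose H x := x - F x *m A.
have HE j : (fun y => H y 0 j) = fun y => y 0 j - \sum_k F y 0 k * A k j.
  by apply/funext => y; rewrite !mxE.
have sS j : smooth_on U (fun y => \sum_k F y 0 k * A k j).
  by move=> k; apply: Ck_sum => // l; apply: CkM => //; [exact: sF|exact: Ck_cst].
have sH j : smooth_on U (fun y => H y 0 j).
  by move=> k; rewrite HE; apply: CkB => //; [exact: Ck_coord|exact: sS].
have pdH x i j : U x -> pd i (fun y => H y 0 j) x = (1%:M - jac F x *m A) i j.
  move=> Ux; rewrite HE pdB; last exact: Ck_diff (sS j 1%N) Ux.
    rewrite pd_coord !mxE; congr (_ - _).
    rewrite /pd deriveE; last exact: Ck_diff (sS j 1%N) Ux.
    rewrite -deriveE; last exact: Ck_diff (sS j 1%N) Ux.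
    have -> : (fun y => \sum_k F y 0 k * A k j) = \sum_k (A k j *: (fun y => F y 0 k)).
      by apply/funext => y; rewrite fct_sumE; apply: eq_bigr => k _; rewrite mulrC.
    rewrite derive_sum => [|k]; last exact/derivableZ/diff_derivable/dF.
    apply: eq_bigr => k _; rewrite deriveZ; last exact/diff_derivable/dF.
    by rewrite mxE mulrC.
  exact: differentiable_coord.
have Hp0 i j : pd i (fun y => H y 0 j) p = 0.
  by rewrite pdH// mulmxV// subrr mxE.
(* A row of n partial derivatives bounded by c yields the constant 1/2; [n.+1] keeps c well defined
   for n = 0. *)
pose c : R := (2 * n.+1%:R)^-1.
have c0 : 0 < c by rewrite invr_gt0 mulr_gt0.
have nc : n%:R * c <= 2^-1.
  rewrite /c invfM mulrCA ler_piMr// ler_pdivrMr// mul1r ler_nat//.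
have : nbhs p [set x | U x /\ forall i j, `|pd i (fun y => H y 0 j) x| <= c].
  apply: filterI; first exact: open_nbhs_nbhs.
  suff : \forall x \near p, forall i j, `|pd i (fun y => H y 0 j) x| <= c by [].
  apply: (@filter_forall _ _ (fun i x => forall j, `|pd i (fun y => H y 0 j) x| <= c) (nbhs p))
    => i.
  apply: (@filter_forall _ _ (fun j x => `|pd i (fun y => H y 0 j) x| <= c) (nbhs p)) => j.
  have /cvgrPdist_le/(_ _ c0) := Ck_cont (Ck_pd i (sH j 1%N)) Up.
  by apply: filterS => x; rewrite Hp0 sub0r normrN.
rewrite nbhs_ballP => -[r /= r0 rb].
have bU x : ball p r x -> U x by move=> /rb[].
have HL x y : ball p r x -> ball p r y -> `|H y - H x| <= 2^-1 * `|y - x|.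
  move=> px py; apply: le_trans (@mvt_norm n H p r c x y (ltW c0) _ _ px py) _.
  - by move=> z j /bU; exact: Ck_diff (sH j 1%N).
  - by move=> z i j /rb[_]; exact.
  - by rewrite ler_wpM2r.
pose K := 1 + \sum_i \sum_j `|A i j|.
have K0 : 0 < K by rewrite ltr_pwDl// sumr_ge0// => i _; exact: sumr_ge0.
(* The difference y - x is (H y - H x) + (F y - F x) A, and half of it absorbs the first term. This
   gives injectivity of F and the Lipschitz constant of its inverse. *)
have FL x y : ball p r x -> ball p r y -> `|y - x| <= 2 * K * `|F y - F x|.
  move=> px py; have := HL _ _ px py.
  have -> : H y - H x = (y - x) - (F y - F x) *m A.
    rewrite /H mulmxBl; move: (F y *m A) (F x *m A) => a b.
    by apply/rowP => i; rewrite !mxE; ring.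
  move=> h; have := mulmx_norm (F y - F x) A; rewrite -/K.
  have := ler_distD ((F y - F x) *m A) (y - x) 0.
  rewrite !subr0; move: h; set a := `|_|; set b := `|_|; set d := `|_|; set e := `|_|.
  rewrite -mulrA; lra.
(* On the ball of radius r/2 the map H moves points by at most r/4 from its value at p; this delta
   bounds the shift by (y - F p) A by another r/4, so [T] preserves that ball. *)
pose delta := r / (4 * K).
have delta0 : 0 < delta by rewrite divr_gt0// mulr_gt0.
pose W := ball (F p) delta.
pose V := [set x | ball p r x /\ W (F x)].
have surj y : W y -> exists x, ball p r x /\ F x = y.
  move=> Wy.
  pose T x := H x + y *m A.
  pose C := [set x : 'rV[R]_n | `|x - p| <= r / 2].
  have Cb x : C x -> ball p r x.
    by rewrite /C -ball_normE/= distrC => /le_lt_trans; apply; lra.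
  have Cp : C p by rewrite /C/= subrr normr0; lra.
  have TC : set_fun C C T.
    move=> x Cx; rewrite /C /T/=.
    have -> : H x + y *m A - p = (H x - H p) + (y - F p) *m A.
      rewrite mulmxBl [H p]/H; move: (H x) (y *m A) (F p *m A) => a b d.
      by apply/rowP => i; rewrite !mxE; ring.
    have h1 := HL _ _ (Cb _ Cp) (Cb _ Cx).
    have h2 := mulmx_norm (y - F p) A.
    have : K * `|y - F p| <= r / 4.
      move: Wy; rewrite /W -ball_normE/= distrC /delta => /ltW.
      rewrite invfM mulrA ler_pdivlMr// mulrC.
      by [].
    have := ler_normD (H x - H p) ((y - F p) *m A); move: h1 h2 Cx.
    rewrite /C/= -/K; lra.
  have ctr : is_contraction (mkfun_fun TC).
    exists (2^-1)%:nng => /=; split; first by rewrite /= invf_lt1// ltr1n.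
    move=> [x z] [Cx Cz] /=; rewrite /T opprD addrACA subrr addr0.
    by apply: HL; exact: Cb.
  have clC : closed C.
    have -> : C = closed_ball p (r / 2).
      rewrite closed_ballE ?divr_gt0//; apply/seteqP.
      by split=> x; rewrite /C /closed_ball_/= distrC.
    exact: closed_ball_closed.
  have [x Cx xT] := banach_fixed_point ctr clC (ex_intro _ p Cp).
  exists x; split; first exact: Cb.
  have {}xT : x = x - F x *m A + y *m A := xT.
  have FyA : (F x - y) *m A = 0.
    rewrite mulmxBl -(subrr x) {3}xT.
    by move: (F x *m A) (y *m A) => a b; apply/rowP => i; rewrite !mxE; ring.
  by apply/eqP; rewrite -subr_eq0 -(mulmxKV uJ (F x - y)) -/A FyA mul0mx.
pose Psi y := get [set x | ball p r x /\ F x = y].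
have PsiP y : W y -> ball p r (Psi y) /\ F (Psi y) = y.
  by move=> Wy; have [x xP] := surj y Wy; exact: (@getPex _ [set x | ball p r x /\ F x = y])
    (ex_intro _ x xP).
have PsiK x : V x -> Psi (F x) = x.
  move=> [px WFx]; have [pP FP] := PsiP _ WFx.
  apply/eqP; rewrite -subr_eq0 -normr_le0.
  by have := FL _ _ px pP; rewrite FP subrr normr0 mulr0.
have FL' y z : W y -> W z -> `|Psi y - Psi z| <= 2 * K * `|y - z|.
  by move=> /PsiP[py {2}<-] /PsiP[pz {2}<-]; exact: FL.
(* A kernel vector of the Jacobian would be fixed by [1%:M - jac F x *m A], whose norm is at most
   1/2. *)
have uV x : ball p r x -> jac F x \in unitmx.
  move=> px; rewrite unitmxE unitfE; apply/negP => /det0P[v v0 vJ].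
  have : `|v| <= 2^-1 * `|v|.
    have vE : v = v *m (1%:M - jac F x *m A).
      by rewrite mulmxBr mulmx1 mulmxA vJ mul0mx subr0.
    rewrite {1}vE; apply: rV_norm_le => [|j]; first by rewrite mulr_ge0.
    rewrite mxE (le_trans (ler_norm_sum _ _ _))//.
    apply: (@le_trans _ _ (n%:R * c * `|v|)); last by rewrite ler_wpM2r.
    have -> : n%:R * c * `|v| = \sum_(i < n) c * `|v|.
      by rewrite sumr_const card_ord -mulrA mulr_natl.
    apply: ler_sum => i _; rewrite normrM mulrC ler_pM// ?coord_norm//.
    by rewrite -pdH; [have [_] := rb _ px; exact|exact: bU].
  have : 0 < `|v| by rewrite normr_gt0.
  lra.
have oW : open W by exact: ball_open.
have oV : open V.
  rewrite openE => x [px WFx]; apply: filterI.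
    by apply: open_nbhs_nbhs; split=> //; exact: ball_open.
  have cF : {for x, continuous F}.
    by apply: continuous_rV => j; exact: (Ck_cont (sF j 0%N) (bU _ px)).
  by apply: cF; exact: open_nbhs_nbhs.
have dPsi y : W y -> differentiable Psi y /\
    'd Psi y = (mulmxr (invmx (jac F (Psi y))) : 'rV[R]_n -> 'rV[R]_n) :> (_ -> _).
  move=> Wy; have [px Fx] := PsiP _ Wy.
  set x := Psi y in px Fx *; set B := invmx _.
  apply: differentiable_estimate; first exact: mulmxr_continuous.
  move=> e e0.
  pose KB := 1 + \sum_i \sum_j `|B i j|.
  have KB0 : 0 < KB.
    by rewrite (lt_le_trans ltr01)// lerDl sumr_ge0// => i _; exact: sumr_ge0.
  have dFx : differentiable F x by apply: differentiable_rV => j; exact/dF/bU.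
  have dFE v : 'd F x v = v *m jac F x.
    apply/rowP => j; rewrite -deriveE// (derive_mx (diff_derivable dFx)) !mxE.
    rewrite derive_pdE; last exact/dF/bU.
    by apply: eq_bigr => i _; rewrite !mxE.
  (* Up to sign, the remainder of [Psi] at y is the remainder of F at x multiplied by B. The factor
     [KB] bounds B, and [2 * K] turns the distance from x into the distance from y. *)
  have e'0 : 0 < e / (KB * (2 * K)) by rewrite divr_gt0 ?mulr_gt0.
  have nx := differentiable_near_estimate dFx e'0.
  have cP : {for y, continuous Psi}.
    apply: (@near_lipschitz_continuous _ _ Psi y (2 * K)); first exact: mulr_gt0.
    by apply: filterS (open_nbhs_nbhs (conj oW Wy)) => z; exact: FL'.
  near=> z.
  have Wz : W z by near: z; exact: open_nbhs_nbhs.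
  have [pz Fz] := PsiP _ Wz.
  have hz : `|F (Psi z) - F x - 'd F x (Psi z - x)| <= e / (KB * (2 * K)) * `|Psi z - x|.
    by near: z; exact: cP nx.
  rewrite /= -normrN.
  have -> : - (Psi z - x - (z - y) *m B) = (F (Psi z) - F x - 'd F x (Psi z - x)) *m B.
    by rewrite dFE [RHS]mulmxBl /B mulmxK ?uV// Fx Fz opprB.
  apply: le_trans (mulmx_norm _ _) _; rewrite -/KB.
  have h2 := FL' _ _ Wz Wy.
  have : KB * (e / (KB * (2 * K)) * `|Psi z - x|) <= KB * (e / (KB * (2 * K)) * (2 * K * `|z - y|)).
    by rewrite !ler_pM2l.
  have -> : KB * (e / (KB * (2 * K)) * (2 * K * `|z - y|)) = e * `|z - y|.
    by field; rewrite !gt_eqF.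
  by apply: le_trans; rewrite ler_pM2l.
have pdPsi y : W y -> forall i j,
    pd i (fun z => Psi z 0 j) y = invmx (jac F (Psi y)) i j.
  move=> Wy i j; have [dy dE] := dPsi y Wy.
  have := derive_mx (@diff_derivable _ _ _ _ _ (delta_mx 0 i) dy).
  move=> /matrixP/(_ 0 j); rewrite mxE /pd => <-.
  by rewrite deriveE// dE/= -rowE mxE.
have sPsi k j : Ck k W (fun z => Psi z 0 j).
  elim: k j => [|k IH] j.
    move=> y /dPsi[dy _]; apply: differentiable_continuous.
    exact: (differentiable_comp dy (differentiable_coord _ _ _)).
  split=> [y /dPsi[dy _]|i].
    exact: (differentiable_comp dy (differentiable_coord _ _ _)).
  apply: (@Ck_on _ _ _ _ (fun y => invmx (jac F (Psi y)) i j)) => // [y Wy|].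
    by rewrite pdPsi.
  apply: Ck_invmx => // [y /PsiP[py _]|a b]; first exact: uV.
  apply: (@Ck_on _ _ _ _ (pd a (fun y => F y 0 b) \o Psi)) => // [y Wy|].
    by rewrite /= mxE.
  by apply: (@Ck_comp _ _ _ _ _ U) => // [y /PsiP[/bU//]|]; exact: (Ck_pd a (sF b k.+1)).
exists V, W, Psi; split=> //.
- split=> //.
  + split=> j k; last exact: sPsi.
    by apply: Ck_sub (sF j k) => x [/bU].
  + split=> [x []//|y Wy]; have [py Fy] := PsiP _ Wy.
    by split=> //; rewrite Fy.
  + by split=> // y /PsiP[].
- by split; exact: ballxx.
- by move=> x [/bU].
- by move=> x [/uV].
Unshelve. all: end_near.
Qed.
End InverseFunction.

(** * Closed one-forms of the plane *)

Section Poincare.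
Variable R : realType.
Notation mu := (@lebesgue_measure R).

Definition pt (x y : R) : 'rV[R]_2 := \row_j (if j == 0 then x else y).

Lemma pt0 x y : pt x y 0 0 = x. Proof. by rewrite mxE. Qed.
Lemma pt1 x y : pt x y 0 1 = y. Proof. by rewrite mxE. Qed.

Lemma ord2 (j : 'I_2) : j = 0 \/ j = 1.
Proof. by case: j => [[|[|//]] ?]; [left|right]; exact: val_inj. Qed.

Lemma sum2E (V : nmodType) (F : 'I_2 -> V) : \sum_j F j = F 0 + F 1.
Proof. by rewrite big_ord_recl big_ord1; congr (_ + F _); exact: val_inj. Qed.

Lemma ptE (x : 'rV[R]_2) : x = pt (x 0 0) (x 0 1).
Proof. by apply/rowP => j; case: (ord2 j) => ->; rewrite ?pt0 ?pt1. Qed.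

Lemma pt_ball (p : 'rV[R]_2) r x y :
  ball p r (pt x y) <-> `|p 0 0 - x| < r /\ `|p 0 1 - y| < r.
Proof.
rewrite -ball_normE/=; split=> [|[h0 h1]].
  move=> h; have := coord_norm (p - pt x y) 0; have := coord_norm (p - pt x y) 1.
  by rewrite !mxE/= => ? ?; split; exact: le_lt_trans h.
rewrite [X in X < _]/Num.Def.normr/= mx_normrE.
apply: bigmax_lt => [|[i j] _]; first exact: le_lt_trans h0.
by rewrite /= (ord1 i) !mxE; case: (ord2 j) => ->.
Qed.

Lemma is_derive_pt0 (f : 'rV[R]_2 -> R) x y : differentiable f (pt x y) ->
  is_derive x 1 (fun t => f (pt t y)) (pd 0 f (pt x y)).
Proof.
have E t : pt t y = pt 0 y + t *: delta_mx 0 0.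
  by apply/rowP => j; case: (ord2 j) => ->; rewrite !mxE//= ?mulr1 ?mulr0 ?add0r ?addr0.
move=> df; under eq_fun do rewrite E.
rewrite E in df *; exact: is_derive_line.
Qed.

Lemma is_derive_pt1 (f : 'rV[R]_2 -> R) x y : differentiable f (pt x y) ->
  is_derive y 1 (fun t => f (pt x t)) (pd 1 f (pt x y)).
Proof.
have E t : pt x t = pt x 0 + t *: delta_mx 0 1.
  by apply/rowP => j; case: (ord2 j) => ->; rewrite !mxE//= ?mulr1 ?mulr0 ?add0r ?addr0.
move=> df; under eq_fun do rewrite E.
rewrite E in df *; exact: is_derive_line.
Qed.

(** Parametrising the segment by [0, 1] makes the order of a and b irrelevant. *)
Lemma mvt_between (f df : R -> R) (a b : R) :
  (forall t : R, `|t - a| <= `|b - a| -> is_derive t 1 f (df t)) ->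
  exists2 c : R, `|c - a| <= `|b - a| & f b - f a = df c * (b - a).
Proof.
move=> fd.
have der (s : R) : s \in `[0, 1]%R ->
    is_derive s 1 (fun s => f (a + s * (b - a))) (df (a + s * (b - a)) * (b - a)).
  rewrite in_itv/= => /andP[s0 s1].
  apply: (@is_derive1_comp _ f (fun s => a + s * (b - a))).
    apply: fd; rewrite addrAC subrr add0r normrM (ger0_norm s0).
    by rewrite ler_piMl.
  have := is_deriveD (is_derive_cst a s 1) (is_deriveM (is_derive_id s 1) (is_derive_cst (b - a)
    s 1)).
  rewrite scaler0 !add0r -[_ *: 1]/(_ * 1) mulr1; exact.
have der' (s : R) (s01 : s \in `]0, 1[%R) := der s (subset_itv_oo_cc s01).
have cont : {within `[0, 1], continuous (fun s => f (a + s * (b - a)))}.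
  by apply: derivable_within_continuous => s s01; case: (der _ s01).
have [s] := MVT_segment (@ler01 R) der' cont.
rewrite in_itv/= mul1r mul0r addr0 subr0 mulr1 subrKC => /andP[s0 s1] fE.
exists (a + s * (b - a)) => //.
by rewrite addrAC subrr add0r normrM (ger0_norm s0) ler_piMl.
Qed.

(** The increment of f is split along a horizontal and a vertical segment; on each, the mean value
    theorem compares it with a partial derivative at a point close to p. *)
Lemma differentiable_partials (f g0 g1 : 'rV[R]_2 -> R) p r :
  0 < r ->
  (forall x y, ball p r (pt x y) ->
     is_derive x 1 (fun t => f (pt t y)) (g0 (pt x y)) /\
     is_derive y 1 (fun t => f (pt x t)) (g1 (pt x y))) ->
  {for p, continuous g0} -> {for p, continuous g1} ->
  [/\ differentiable f p, pd 0 f p = g0 p & pd 1 f p = g1 p].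
Proof.
move=> r0 fd c0 c1.
pose h (y : 'rV[R]_2) := y 0 0 * g0 p + y 0 1 * g1 p.
have sh : smooth_on setT h.
  by move=> k; apply: CkD; [|apply: CkM..]; try exact: openT;
     try exact: Ck_cst; apply: Ck_coord; exact: openT.
have dh : differentiable h p by exact: (Ck_diff (sh 1%N) I).
have hE : forall v, 'd h p v = v 0 0 * g0 p + v 0 1 * g1 p.
  move=> v; rewrite -(deriveE v dh) (derive_pdE v dh) sum2E.
  have dc i := @differentiable_coord R 1 2 p 0 i.
  have dM i c : differentiable (fun y : 'rV[R]_2 => y 0 i * c) p.
    by apply: differentiableM.
  by rewrite !pdD// !pdM// !pd_coord !pd_cst /= !mulr0 !mul0r !addr0 !mul1r add0r.
have [||df dE] := @differentiable_estimate _ _ _ f p ('d h p).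
- exact: diff_continuous.
- move=> e e0.
  have e2 : 0 < e / 2 by rewrite divr_gt0.
  have /cvgrPdist_le/(_ _ e2) n0 := c0; have /cvgrPdist_le/(_ _ e2) n1 := c1.
  have : nbhs p _ := filterI n0 n1; rewrite nbhs_ballP => -[d /= d0 db].
  have rd : 0 < Num.min r d by rewrite lt_min r0.
  have : \forall y \near p, ball p (Num.min r d) y by exact: nbhsx_ballx.
  apply: filterS => y; rewrite (ptE y) => /pt_ball[]; rewrite !lt_min.
  move=> /andP[r0y d0y] /andP[r1y d1y].
  set y0 := y 0 0 in r0y d0y *; set y1 := y 0 1 in r1y d1y *.
  have [t|a ap aE] := @mvt_between (fun t => f (pt t y1)) (fun t => g0 (pt t y1)) (p 0 0) y0.
    move=> tp; apply: (fd _ _ _).1; apply/pt_ball; split=> //.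
    by rewrite distrC (le_lt_trans tp)// distrC.
  have [t|b bp bE] := @mvt_between (fun t => f (pt (p 0 0) t)) (fun t => g1 (pt (p 0 0) t)) (p 0
    1) y1.
    move=> tp; apply: (fd _ _ _).2; apply/pt_ball; split=> //.
      by rewrite subrr normr0.
    by rewrite distrC (le_lt_trans tp)// distrC.
  have [ga _] : `|g0 p - g0 (pt a y1)| <= e / 2 /\ `|g1 p - g1 (pt a y1)| <= e / 2.
    by apply: db; apply/pt_ball; split=> //; rewrite distrC (le_lt_trans ap)// distrC.
  have [_ gb] : `|g0 p - g0 (pt (p 0 0) b)| <= e / 2 /\ `|g1 p - g1 (pt (p 0 0) b)| <= e / 2.
    apply: db; apply/pt_ball; split; first by rewrite subrr normr0.
    by rewrite distrC (le_lt_trans bp)// distrC.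
  rewrite hE !mxE/=; move: aE bE => /= aE bE.
  have -> : f (pt y0 y1) - f p - ((y0 - p 0 0) * g0 p + (y1 - p 0 1) * g1 p) =
      (g0 (pt a y1) - g0 p) * (y0 - p 0 0) + (g1 (pt (p 0 0) b) - g1 p) * (y1 - p 0 1).
    have -> : f (pt y0 y1) - f p = (f (pt y0 y1) - f (pt (p 0 0) y1))
        + (f (pt (p 0 0) y1) - f (pt (p 0 0) (p 0 1))) by rewrite -(ptE p); ring.
    rewrite aE bE; ring.
  have n0' := coord_norm (pt y0 y1 - p) 0; have n1' := coord_norm (pt y0 y1 - p) 1.
  rewrite !mxE/= in n0' n1'.
  rewrite [X in _ <= X * _](splitr e) [leRHS]mulrDl.
  apply: le_trans (ler_normD _ _) _.
  by apply: lerD; rewrite normrM; apply: ler_pM => //; rewrite distrC.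
- have pdE i : pd i f p = (delta_mx 0 i : 'rV[R]_2) 0 0 * g0 p + (delta_mx 0 i : 'rV[R]_2) 0 1 *
  g1 p.
    by rewrite -hE -dE -(deriveE _ df).
  split; [exact: df|rewrite pdE !mxE /=; ring|rewrite pdE !mxE /=; ring].
Qed.

Lemma primitive_closed (g : R -> R) (a b : R) : a < b ->
  (forall t, a <= t <= b -> {for t, continuous g}) ->
  forall t, a < t < b ->
    is_derive t 1 (fun x => \int[mu]_(s in `[a, x]) g s) (g t).
Proof.
move=> ab cg t /andP[at_ tb].
have gi : mu.-integrable `[a, b] (EFin \o g).
  apply: continuous_compact_integrable; first exact: segment_compact.
  apply: continuous_in_subspaceT => x; rewrite inE/= in_itv/=; exact: cg.
have [|d dE] := continuous_FTC1_closed tb gi at_.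
  by apply: cg; rewrite !ltW.
by apply: DeriveDef; [exact: d|rewrite -derive1E dE].
Qed.

Lemma Rintegral_derive (F g : R -> R) (a b : R) : a < b ->
  (forall t, a <= t <= b -> is_derive t 1 F (g t)) ->
  (forall t, a <= t <= b -> {for t, continuous g}) ->
  \int[mu]_(s in `[a, b]) g s = F b - F a.
Proof.
move=> ab dF cg.
have cF t : a <= t <= b -> {for t, continuous F}.
  by move=> /dF[+ _] => /derivable1_diffP; exact: differentiable_continuous.
have ab' := ltW ab.
rewrite /Rintegral (@continuous_FTC2 _ g F)//.
- apply: continuous_in_subspaceT => x; rewrite inE/= in_itv/=; exact: cg.
- split.
  + by move=> x; rewrite in_itv/= => /andP[ax xb]; have [] // := dF x; rewrite !ltW.
  + by apply: cvg_at_right_filter; apply: cF; rewrite lexx.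
  + by apply: cvg_at_left_filter; apply: cF; rewrite lexx ab'.
- move=> x; rewrite in_itv/= => /andP[ax xb].
  by rewrite derive1E; have [|_ ->] // := dF x; rewrite !ltW.
Qed.

(** The primitive integrates [a0] along a horizontal segment and then [a1] along a vertical one. Its
    derivative in the second variable is immediate; in the first, closedness turns the integral of
    [pd 0 a1] into that of [pd 1 a0], whose lower boundary term cancels the horizontal contribution.
    Its partial derivatives being [a0] and [a1], it is smooth. *)
Lemma poincare (p : 'rV[R]_2) r (a0 a1 : 'rV[R]_2 -> R) : 0 < r ->
  smooth_on (ball p r) a0 -> smooth_on (ball p r) a1 ->
  (forall x, ball p r x -> pd 1 a0 x = pd 0 a1 x) ->
  exists d s, [/\ 0 < d, d <= r, smooth_on (ball p d) s &
    forall x, ball p d x -> pd 0 s x = a0 x /\ pd 1 s x = a1 x].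
Proof.
move=> r0 s0 s1 a01.
have oB d : open (ball p d) by exact: ball_open.
have := ballxx p r0 => pp.
have /cvgrPdist_le/(_ _ ltr01) n1 := Ck_cont (Ck_pd 0 (s1 1%N)) pp.
have : nbhs p _ := n1; rewrite nbhs_ballP => -[d1 /= d10 d1b].
pose d := Num.min r d1.
have d0 : 0 < d by rewrite lt_min r0.
have dr : d <= r by rewrite ge_min lexx.
have bsub x : ball p d x -> ball p r x by exact: le_ball.
(* The constant that dominates [pd 0 a1] when differentiating under the integral. *)
pose M := `|pd 0 a1 p| + 1.
have Mb x : ball p d x -> `|pd 0 a1 x| <= M.
  move=> xd; have : `|pd 0 a1 p - pd 0 a1 x| <= 1.
    by apply: d1b; apply: le_ball xd; rewrite ge_min lexx orbT.
  have := ler_distD (pd 0 a1 p) (pd 0 a1 x) 0; rewrite !subr0 distrC /M; lra.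
(* The path starts at the lower left corner of the ball of radius d/2, a square in the sup norm, so
   that every upper limit of integration exceeds the lower one. *)
pose b0 := p 0 0 - d / 2; pose b1 := p 0 1 - d / 2.
have inb x y : `|p 0 0 - x| < d -> `|p 0 1 - y| < d -> ball p d (pt x y).
  by move=> *; apply/pt_ball.
have cpt0 (a : 'rV[R]_2 -> R) x y : smooth_on (ball p r) a -> ball p d (pt x y) ->
    {for x, continuous (fun t => a (pt t y))}.
  move=> sa /bsub xy; apply: differentiable_continuous; apply/derivable1_diffP.
  by have [] := is_derive_pt0 (Ck_diff (sa 1%N) xy).
have cpt1 (a : 'rV[R]_2 -> R) x y : smooth_on (ball p r) a -> ball p d (pt x y) ->
    {for y, continuous (fun t => a (pt x t))}.
  move=> sa /bsub xy; apply: differentiable_continuous; apply/derivable1_diffP.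
  by have [] := is_derive_pt1 (Ck_diff (sa 1%N) xy).
pose S0 x := \int[mu]_(s in `[b0, x]) a0 (pt s b1).
pose S1 x y := \int[mu]_(s in `[b1, y]) a1 (pt x s).
pose S (x : 'rV[R]_2) := S0 (x 0 0) + S1 (x 0 0) (x 0 1).
have rng (c x : R) : `|c - x| < d / 2 -> c - d / 2 < x < c + d / 2.
  by rewrite ltr_norml; lra.
have rng' (c x : R) : c - d / 2 <= x <= c + d / 2 -> `|c - x| < d.
  by rewrite ltr_norml; lra.
have dS x y : ball p (d / 2) (pt x y) ->
     is_derive x 1 (fun t => S (pt t y)) (a0 (pt x y)) /\
     is_derive y 1 (fun t => S (pt x t)) (a1 (pt x y)).
  move=> /pt_ball[/rng xr /rng yr].
  have xr' : `|p 0 0 - x| < d by apply: rng'; case/andP: xr => *; rewrite !ltW.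
  have yr' : `|p 0 1 - y| < d by apply: rng'; case/andP: yr => *; rewrite !ltW.
  split; last first.
    have H : is_derive y 1 (S1 x) (a1 (pt x y)).
      apply: (@primitive_closed (fun t => a1 (pt x t)) b1 (p 0 1 + d / 2)) => //.
        by rewrite /b1; lra.
      by move=> t /rng' tr; apply: cpt1 => //; exact: inb.
    have := is_deriveD (is_derive_cst (S0 x) y 1) H; rewrite add0r.
    by under [X in _ -> is_derive _ _ X _]eq_fun do rewrite /S pt0 pt1.
  have H0 : is_derive x 1 S0 (a0 (pt x b1)).
    apply: (@primitive_closed (fun t => a0 (pt t b1)) b0 (p 0 0 + d / 2)) => //.
      by rewrite /b0; lra.
    move=> t /rng' tr; apply: cpt0 => //; apply: inb => //.
    by apply: rng'; rewrite /b1; lra.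
  have H1 : is_derive x 1 (S1 ^~ y) (a0 (pt x y) - a0 (pt x b1)).
    have yy s : b1 <= s <= y -> `|p 0 1 - s| < d.
      by move=> sI; apply: rng'; move: yr sI; rewrite /b1; lra.
    have b1y : b1 < y by case/andP: yr.
    pose f (t s : R) : R := a1 (pt t s).
    have mB : measurable (`[b1, y]%classic : set (measurableTypeR R)) by [].
    have Ix : `]p 0 0 - d / 2, p 0 0 + d / 2[%classic x by rewrite /= in_itv.
    have xx t : `]p 0 0 - d / 2, p 0 0 + d / 2[%classic t -> `|p 0 0 - t| < d.
      by rewrite /= in_itv/= => /andP[? ?]; apply: rng'; rewrite !ltW.
    have intf t : `]p 0 0 - d / 2, p 0 0 + d / 2[%classic t -> mu.-integrable `[b1, y] (EFin \o f
      t).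
      move=> /xx tI; apply: continuous_compact_integrable; first exact: segment_compact.
      apply: continuous_in_subspaceT => s; rewrite inE/= in_itv/= => /yy sI.
      by apply: cpt1 => //; exact: inb.
    have df t s : `]p 0 0 - d / 2, p 0 0 + d / 2[%classic t -> `[b1, y]%classic s ->
        is_derive t 1 (f ^~ s) (pd 0 a1 (pt t s)).
      move=> /xx tI; rewrite /= in_itv/= => /yy sI.
      by apply: is_derive_pt0; apply: (Ck_diff (s1 1%N)); apply/bsub/inb.
    have derf t s : `]p 0 0 - d / 2, p 0 0 + d / 2[%classic t -> `[b1, y]%classic s ->
        derivable (f ^~ s) t 1 by move=> tI sI; case: (df t s tI sI).
    have intG : mu.-integrable `[b1, y] (EFin \o cst M).
      by apply: continuous_compact_integrable; [exact: segment_compact|move=> ?; exact: cvg_cst].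
    have G0 (s : measurableTypeR R) : 0 <= cst M s by rewrite /= /M addr_ge0.
    have Gub t s : `]p 0 0 - d / 2, p 0 0 + d / 2[%classic t -> `[b1, y]%classic s ->
        `|partial1of2 f t s| <= cst M s.
      move=> tI sI; rewrite partial1of2E; have [_ ->] := df t s tI sI.
      apply: Mb; apply: inb; first exact: xx.
      by move: sI; rewrite /= in_itv/= => /yy.
    have D := derivable_under_integral mB Ix intf derf G0 intG Gub.
    have E := differentiation_under_integral mB Ix intf derf G0 intG Gub.
    apply: DeriveDef; first exact: D.
    rewrite -derive1E E.
    rewrite (@eq_Rintegral _ _ _ mu _ (fun s => pd 1 a0 (pt x s))); last first.
      move=> s; rewrite inE => sI; rewrite partial1of2E.
      have [_ ->] := df x s Ix sI; rewrite a01//.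
      by apply/bsub/inb; [exact: xx|move: sI; rewrite /= in_itv/= => /yy].
    apply: (@Rintegral_derive (fun s => a0 (pt x s)) (fun s => pd 1 a0 (pt x s)) b1 y b1y).
      by move=> s /yy sI; apply: is_derive_pt1; apply: (Ck_diff (s0 1%N)); apply/bsub/inb.
    by move=> s /yy sI; apply: (cpt1 (pd 1 a0)); [move=> k; exact: (Ck_pd 1 (s0 k.+1))|exact: inb].
  have := is_deriveD H0 H1; rewrite subrKC.
  by under [X in _ -> is_derive _ _ X _]eq_fun do rewrite /S pt0 pt1.
exists (d / 2), S.
have sub2 : ball p (d / 2) `<=` ball p r.
  by apply: le_ball; apply: le_trans dr; lra.
have dS' x : ball p (d / 2) x -> [/\ differentiable S x, pd 0 S x = a0 x & pd 1 S x = a1 x].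
  move=> xb; have : nbhs x (ball p (d / 2)).
    by apply: open_nbhs_nbhs; split=> //; exact: oB.
  rewrite nbhs_ballP => -[e /= e0 eb].
  apply: (@differentiable_partials S a0 a1 x e e0).
  - by move=> u v uv; apply: dS; exact: eb.
  - exact: Ck_cont (s0 0%N) (sub2 _ xb).
  - exact: Ck_cont (s1 0%N) (sub2 _ xb).
split.
- by rewrite divr_gt0.
- by apply: le_trans dr; lra.
- case=> [|k].
    by move=> x /dS'[dSx _ _]; exact: differentiable_continuous.
  split=> [x /dS'[]//|i].
  have [->|->] := ord2 i.
    by apply: (@Ck_on _ _ _ _ a0) (Ck_sub sub2 (s0 k)) => // x /dS'[].
  by apply: (@Ck_on _ _ _ _ a1) (Ck_sub sub2 (s1 k)) => // x /dS'[].
- by move=> x /dS'[].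
Qed.

End Poincare.

(** * Symbolic computation of the Ricci curvature *)

Module PolynomialExpressions.
Import BinNums BinInt Ring_polynom InitialRing Ring_theory.

Notation pexpr := (PExpr Z).

(** The default case covers constants and also sends powers to 0. This is sound where it is used,
    because [pexpr_in] rejects powers. *)
Fixpoint pexpr_derive (dv : positive -> pexpr) (p : pexpr) : pexpr :=
  match p with
  | PEX j => dv j
  | PEadd a b => PEadd (pexpr_derive dv a) (pexpr_derive dv b)
  | PEsub a b => PEsub (pexpr_derive dv a) (pexpr_derive dv b)
  | PEmul a b => PEadd (PEmul (pexpr_derive dv a) b) (PEmul a (pexpr_derive dv b))
  | PEopp a => PEopp (pexpr_derive dv a)
  | _ => PEO
  end.

Fixpoint pexpr_in (s : list positive) (p : pexpr) : bool :=
  match p with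
  | PEO | PEI | PEc _ => true
  | PEX j => List.existsb (BinPos.Pos.eqb j) s
  | PEadd a b | PEsub a b | PEmul a b => pexpr_in s a && pexpr_in s b
  | PEopp a => pexpr_in s a
  | PEpow _ _ => false
  end.

Fixpoint pexpr_sum n (F : nat -> pexpr) : pexpr :=
  if n is n'.+1 then PEadd (pexpr_sum n' F) (F n') else PEO.

Section Evaluation.
Variable R : realType.

Definition pexpr_eval : seq R -> pexpr -> R :=
  PEeval 0 1 +%R *%R (fun x y => x - y) -%R
    (gen_phiZ 0 1 +%R *%R -%R) id_phi_N (pow_N 1 *%R).

Lemma pexpr_eval_sum l n F :
  pexpr_eval l (pexpr_sum n F) = \sum_(i < n) pexpr_eval l (F i).
Proof.
elim: n => [|n IH]; first by rewrite big_ord0.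
by rewrite big_ord_recr /= -IH.
Qed.

(** The bound 100 on the rewriting affects only the power of the test: its correctness holds for
    every bound. *)
Definition pexpr_normal (rules : seq (pexpr * pexpr)) (p : pexpr) : Pol Z :=
  norm_subst Z0 (Zpos xH) Z.add Z.mul Z.sub Z.opp Z.eqb Z.quotrem 100
    (mk_monpol_list Z0 (Zpos xH) Z.add Z.mul Z.sub Z.opp Z.eqb Z.quotrem rules) p.

Definition pexpr_eqb rules (p q : pexpr) : bool :=
  Peq Z.eqb (pexpr_normal rules p) (pexpr_normal rules q).

Fixpoint pexpr_rules l (rules : seq (pexpr * pexpr)) : Prop :=
  if rules is (p, q) :: rules' then
    pexpr_eval l p = pexpr_eval l q /\ pexpr_rules l rules'
  else True.

Lemma pexpr_eqbP rules l p q : pexpr_rules l rules ->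
  pexpr_eqb rules p q -> pexpr_eval l p = pexpr_eval l q.
Proof.
move=> lr pq.
have Rth : ring_theory 0 1 +%R *%R (fun x y : R => x - y) -%R eq.
  split=> //; [exact: add0r|exact: addrC|exact: addrA|exact: mul1r|exact: mulrC
    |exact: mulrA|exact: mulrDl|exact: subrr].
have Rsth := RelationClasses.eq_equivalence (A := R).
have Reqe := Eq_ext +%R *%R (-%R : R -> R).
have ARth := Rth_ARth Rsth Reqe Rth.
apply: (ring_correct Rsth Reqe ARth (gen_phiZ_morph Rsth Reqe Rth)
  (pow_N_th _ _ Rsth) (Ztriv_div_th Rsth _) 100 l rules p q) => //.
elim: rules lr {pq} => [//|[a b] [|c rules] IH]; first by case.
by move=> [ab lr]; split=> //; exact: IH.
Qed.

Lemma pexpr_evalP n (env : 'rV[R]_n -> seq R) s (dv : positive -> pexpr) i x p :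
  (forall j, List.In j s ->
    differentiable (fun y => BinList.nth 0 j (env y)) x /\
    pd i (fun y => BinList.nth 0 j (env y)) x = pexpr_eval (env x) (dv j)) ->
  pexpr_in s p ->
  differentiable (fun y => pexpr_eval (env y) p) x /\
  pd i (fun y => pexpr_eval (env y) p) x = pexpr_eval (env x) (pexpr_derive dv p).
Proof.
move=> Hs; elim: p => //=.
- by move=> _; split; [exact: differentiable_cst|exact: pd_cst].
- by move=> _; split; [exact: differentiable_cst|exact: pd_cst].
- by move=> c _; split; [exact: differentiable_cst|exact: pd_cst].
- move=> j /List.existsb_exists[k [ks /BinPos.Pos.eqb_eq jk]].
  by rewrite -jk in ks; exact: Hs.
- move=> a IHa b IHb /andP[/IHa[da pa] /IHb[db pb]].
  by split; [exact: differentiableD|rewrite pdD// pa pb].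
- move=> a IHa b IHb /andP[/IHa[da pa] /IHb[db pb]].
  by split; [exact: differentiableB|rewrite pdB// pa pb].
- move=> a IHa b IHb /andP[/IHa[da pa] /IHb[db pb]].
  by split; [exact: differentiableM|rewrite pdM// pa pb].
- by move=> a IHa /IHa[da pa]; split; [exact: differentiableN|rewrite pdN// pa].
Qed.

Lemma pexpr_smooth n k (env : 'rV[R]_n -> seq R) s U p : open U ->
  (forall j, List.In j s -> Ck k U (fun y => BinList.nth 0 j (env y))) ->
  pexpr_in s p -> Ck k U (fun y => pexpr_eval (env y) p).
Proof.
move=> oU Hs; elim: p => //=.
- by move=> _; exact: Ck_cst.
- by move=> _; exact: Ck_cst.
- by move=> c _; exact: Ck_cst.
- move=> j /List.existsb_exists[i [js /BinPos.Pos.eqb_eq ij]].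
  by rewrite -ij in js; exact: Hs.
- by move=> a IHa b IHb /andP[/IHa da /IHb db]; exact: CkD.
- by move=> a IHa b IHb /andP[/IHa da /IHb db]; exact: CkB.
- by move=> a IHa b IHb /andP[/IHa da /IHb db]; exact: CkM.
- by move=> a IHa /IHa da; exact: CkN.
Qed.

End Evaluation.

Section SymbolicRicci.
Variables (n : nat) (dv : nat -> positive -> pexpr) (g gi : nat -> nat -> pexpr).

(** Coefficients are integers, so the factor 1/2 is cleared: this is twice the Christoffel symbol,
    and [ricci4] is four times the Ricci tensor. The linear terms of the latter therefore occur
    doubled, the quadratic ones do not. *)
Definition christoffel2 k i j : pexpr := pexpr_sum n (fun l =>
  PEmul (gi k l) (PEsub (PEadd (pexpr_derive (dv i) (g j l)) (pexpr_derive (dv j) (g i l)))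
    (pexpr_derive (dv l) (g i j)))).

Definition ricci4 i j : pexpr := pexpr_sum n (fun k =>
  PEadd (PEsub (PEadd (pexpr_derive (dv k) (christoffel2 k i j)) (pexpr_derive (dv k)
    (christoffel2 k i j)))
    (PEadd (pexpr_derive (dv j) (christoffel2 k i k)) (pexpr_derive (dv j) (christoffel2 k i k))))
  (pexpr_sum n (fun l => PEsub (PEmul (christoffel2 k k l) (christoffel2 l i j))
     (PEmul (christoffel2 k j l) (christoffel2 l i k))))).

Lemma pexpr_mulmx1 (R : realType) (l : seq R) rules (A : 'M[R]_n) :
  pexpr_rules l rules ->
  (forall i j, A i j = pexpr_eval l (g i j)) ->
  (forall i j : 'I_n, pexpr_eqb rules (pexpr_sum n (fun l => PEmul (g i l) (gi l j)))
     (if i == j then PEI else PEO)) ->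
  A *m (\matrix_(i, j) pexpr_eval l (gi i j)) = 1%:M.
Proof.
move=> lr Ag gK; apply/matrixP => i j; rewrite !mxE.
transitivity (pexpr_eval l (pexpr_sum n (fun l => PEmul (g i l) (gi l j)))).
  by rewrite pexpr_eval_sum; apply: eq_bigr => k _; rewrite Ag !mxE.
by rewrite (pexpr_eqbP lr (gK i j)); case: (i == j).
Qed.

Variables (R : realType) (U : set 'rV[R]_n) (G : 'rV[R]_n -> 'M[R]_n).
Variables (env : 'rV[R]_n -> seq R) (s : list positive) (rules : seq (pexpr * pexpr)).

(** The expressions [gi] are a mere candidate for the inverse metric; the product test modulo the
    rules identifies them with [invmx]. The list [s] contains the variables whose derivatives are
    known. *)
Lemma ricci4P :
  open U ->
  (forall x (i : 'I_n) j, U x -> List.In j s ->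
    differentiable (fun y => BinList.nth 0 j (env y)) x /\
    pd i (fun y => BinList.nth 0 j (env y)) x = pexpr_eval (env x) (dv i j)) ->
  (forall x, U x -> pexpr_rules (env x) rules) ->
  (forall x (i j : 'I_n), U x -> G x i j = pexpr_eval (env x) (g i j)) ->
  (forall i j : 'I_n, pexpr_eqb rules (pexpr_sum n (fun l => PEmul (g i l) (gi l j)))
     (if i == j then PEI else PEO)) ->
  (forall i j : 'I_n, pexpr_in s (g i j)) ->
  (forall k i j : 'I_n, pexpr_in s (christoffel2 k i j)) ->
  forall x (i j : 'I_n), U x -> 4 * ricci G x i j = pexpr_eval (env x) (ricci4 i j).
Proof.
move=> oU Hs Hr HG Hgi sg sG.
have Gi x (i j : 'I_n) : U x -> invmx (G x) i j = pexpr_eval (env x) (gi i j).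
  move=> Ux; have GB := pexpr_mulmx1 (Hr x Ux) (fun i j => HG x i j Ux) Hgi.
  have [uG _] := mulmx1_unit GB.
  by rewrite -[invmx _]mulmx1 -GB mulKmx// mxE.
have dg x (k i j : 'I_n) : U x ->
    pd k (fun y => G y i j) x = pexpr_eval (env x) (pexpr_derive (dv k) (g i j)).
  move=> Ux; rewrite (@pd_on _ _ _ U _ (fun y => pexpr_eval (env y) (g i j)) x)//.
    by have [] := pexpr_evalP (fun a => @Hs x k a Ux) (sg i j).
  by move=> y Uy; exact: HG.
have dG x (k i j : 'I_n) : U x ->
    2 * christoffel G k i j x = pexpr_eval (env x) (christoffel2 k i j).
  move=> Ux; rewrite /christoffel mulrA mulfV ?mul1r ?pnatr_eq0// pexpr_eval_sum.
  by apply: eq_bigr => l _; rewrite Gi// !dg.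
have ddG x (l k i j : 'I_n) : U x ->
    2 * pd l (christoffel G k i j) x = pexpr_eval (env x) (pexpr_derive (dv l) (christoffel2 k i
      j)).
  move=> Ux; have [d <-] := pexpr_evalP (fun a => @Hs x l a Ux) (sG k i j).
  have dc : differentiable (christoffel G k i j) x.
    apply: (@near_eq_differentiable _ _ _ (fun y => 2^-1 * pexpr_eval (env y) (christoffel2 k i
      j))).
      apply: filterS (open_nbhs_nbhs (conj oU Ux)) => y Uy.
      by rewrite -dG// mulrA mulVf ?mul1r ?pnatr_eq0.
    by apply: differentiableM => //; exact: differentiable_cst.
  rewrite -(@pd_on _ _ l U (fun y => 2 * christoffel G k i j y) (fun y => pexpr_eval (env y)
    (christoffel2 k i j)) x)//.
    by rewrite pdM// pd_cst mul0r add0r.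
  by move=> y Uy; rewrite dG.
move=> x i j Ux; rewrite mxE pexpr_eval_sum mulr_sumr; apply: eq_bigr => k _.
rewrite /= pexpr_eval_sum /= -!ddG//.
under [in RHS]eq_bigr => l _ do rewrite /= -!dG//.
rewrite mulrDr mulr_sumr.
move: (pd k (christoffel G k i j) x) (pd j (christoffel G k i k) x) => a b.
congr (_ + _); first by ring.
apply: eq_bigr => l _.
move: (christoffel G k k l x) (christoffel G l i j x) (christoffel G k j l x)
  (christoffel G l i k x) => c1 c2 c3 c4.
by ring.
Qed.

End SymbolicRicci.
End PolynomialExpressions.
Import PolynomialExpressions.

(** * Functions that depend on the orbit only *)

Section Orbits.
Variable R : realType.

Lemma orbE (x : 'rV[R]_(2 + 2)) j : orb x 0 j = x 0 (lshift 2 j).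
Proof. by rewrite mxE. Qed.

Lemma differentiable_orb (f : 'rV[R]_2 -> R) x : differentiable f (orb x) ->
  differentiable (fun y => f (orb y)) x.
Proof. by move=> df; apply: differentiable_comp df; exact: differentiable_lsubmx. Qed.

Lemma pd_orb (f : 'rV[R]_2 -> R) x (i : 'I_(2 + 2)) : differentiable f (orb x) ->
  pd i (fun y => f (orb y)) x = \sum_(j < 2) (i == lshift 2 j)%:R * pd j f (orb x).
Proof.
move=> df; rewrite /pd (@derive_comp_rV _ _ _ f (@orb R))//.
  apply: eq_bigr => j _; rewrite mulrC; congr (_ * _).
  under [X in 'D__ X _]eq_fun do rewrite orbE.
  exact: pd_coord.
exact: differentiable_lsubmx.
Qed.

Lemma pd_orb_lshift (f : 'rV[R]_2 -> R) x i : differentiable f (orb x) ->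
  pd (lshift 2 i) (fun y => f (orb y)) x = pd i f (orb x).
Proof.
move=> df; rewrite pd_orb// (bigD1 i)//= eqxx mul1r big1 ?addr0// => j ji.
by rewrite (inj_eq (@lshift_inj _ _)) eq_sym (negbTE ji) mul0r.
Qed.

Lemma pd_orb_rshift (f : 'rV[R]_2 -> R) x i : differentiable f (orb x) ->
  pd (rshift 2 i) (fun y => f (orb y)) x = 0.
Proof.
move=> df; rewrite pd_orb// big1// => j _.
by rewrite eq_rlshift mul0r.
Qed.

Lemma open_orb_preimage (O : set 'rV[R]_2) : open O -> open [set x | O (orb x)].
Proof.
move=> oO; rewrite openE => x Ox.
have c : {for x, continuous (@orb R)} by exact/differentiable_continuous/differentiable_lsubmx.
by apply: c; exact: open_nbhs_nbhs.
Qed.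

Lemma Ck_orb k O U (f : 'rV[R]_2 -> R) : open U -> (forall x, U x -> O (orb x)) ->
  Ck k O f -> Ck k U (fun x => f (orb x)).
Proof.
move=> oU UO fO; apply: (@Ck_comp _ _ _ _ _ O f (@orb R)) => // j.
by apply: Ck_on (Ck_coord k (lshift 2 j) oU) => // x _; rewrite orbE.
Qed.

End Orbits.

(** * Ricci tensor of a metric in adapted coordinates *)

Module AdaptedRicci.
Import BinNums BinPosDef Ring_polynom.

Declare Scope pexpr_scope.
Delimit Scope pexpr_scope with pexpr.
Local Notation "a + b" := (PEadd a b) : pexpr_scope.
Local Notation "a - b" := (PEsub a b) : pexpr_scope.
Local Notation "a * b" := (PEmul a b) : pexpr_scope.
Local Notation "- a" := (PEopp a) : pexpr_scope.
Local Notation "0" := PEO : pexpr_scope.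
Local Notation "1" := PEI : pexpr_scope.
Local Notation "''x_' n" := (PEX Z n%positive) (at level 8, n at level 2) : pexpr_scope.
Bind Scope pexpr_scope with PExpr.

(* E and u (resp. q and r) are mutually inverse; the rewriting of
   Ring_polynom requires them to be adjacent variables. *)
Local Notation eps := ('x_1)%pexpr.
Local Notation E := ('x_2)%pexpr.
Local Notation u := ('x_3)%pexpr.
Local Notation q := ('x_4)%pexpr.
Local Notation r := ('x_5)%pexpr.
Local Notation E1 := ('x_6)%pexpr.
Local Notation E2 := ('x_7)%pexpr.
Local Notation E11 := ('x_8)%pexpr.
Local Notation E12 := ('x_9)%pexpr.
Local Notation E22 := ('x_10)%pexpr.
Local Notation q1 := ('x_11)%pexpr.
Local Notation q2 := ('x_12)%pexpr.
Local Notation q11 := ('x_13)%pexpr.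
Local Notation q12 := ('x_14)%pexpr.
Local Notation q22 := ('x_15)%pexpr.
Local Notation h := ('x_16)%pexpr.
Local Notation h1 := ('x_17)%pexpr.
Local Notation h2 := ('x_18)%pexpr.
Local Notation h11 := ('x_19)%pexpr.
Local Notation h12 := ('x_20)%pexpr.
Local Notation h22 := ('x_21)%pexpr.
Local Notation f := ('x_22)%pexpr.
Local Notation f1 := ('x_23)%pexpr.
Local Notation f2 := ('x_24)%pexpr.
Local Notation f11 := ('x_25)%pexpr.
Local Notation f12 := ('x_26)%pexpr.
Local Notation f22 := ('x_27)%pexpr.
Local Notation a := ('x_28)%pexpr.
Local Notation a1 := ('x_29)%pexpr.
Local Notation a11 := ('x_30)%pexpr.

(** Two derivations are needed for the Ricci tensor, and the second one acts on first jets; second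
    jets are never differentiated. *)
Definition first_jets : list positive :=
  [:: 1; 2; 3; 4; 5; 6; 7; 11; 12; 16; 17; 18; 22; 23; 24; 28; 29]%positive.

(** Derivatives along z1 and z2 vanish, and so does that of [a] along t2: this is the assumption
    that f_1^1 depends on t1 alone. *)
Definition dv (i : nat) (j : positive) : pexpr :=
  let d := match j with
    | 2 => (E1, E2) | 3 => (- (u * u * E1), - (u * u * E2))
    | 4 => (q1, q2) | 5 => (- (r * r * q1), - (r * r * q2))
    | 6 => (E11, E12) | 7 => (E12, E22)
    | 11 => (q11, q12) | 12 => (q12, q22)
    | 16 => (h1, h2) | 17 => (h11, h12) | 18 => (h12, h22)
    | 22 => (f1, f2) | 23 => (f11, f12) | 24 => (f12, f22)
    | 28 => (a1, PEO) | 29 => (a11, PEO)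
    | _ => (PEO, PEO) end%positive%pexpr in
  match i with 0%nat => d.1 | 1%nat => d.2 | _ => PEO end.

Definition rules : seq (pexpr * pexpr) :=
  [:: (E * u, 1); (q * r, 1); (eps * eps, 1)]%pexpr.

Definition symmetric (m : nat -> nat -> pexpr) (i j : nat) := if leq i j then m i j else m j i.

Definition metric : nat -> nat -> pexpr := symmetric (fun i j => match i, j with
  | 0%nat, 0%nat => (E + h * a * a + (q * a * f + q * a * f))%pexpr
  | 0%nat, 2%nat => (h * a + q * f)%pexpr
  | 0%nat, 3%nat => (q * a)%pexpr
  | 1%nat, 1%nat => (eps * E)%pexpr
  | 2%nat, 2%nat => h
  | 2%nat, 3%nat => q
  | _, _ => PEO end).

(** In the horizontal frame, u (Y_0 Y_0 + eps Y_1 Y_1) plus the inverse of the fibre matrix with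
    rows (h, q) and (q, 0), where Y_0 = d/dt1 - a d/dz1 - f d/dz2 and Y_1 = d/dt2. *)
Definition inverse_metric : nat -> nat -> pexpr := symmetric (fun i j => match i, j with
  | 0%nat, 0%nat => u
  | 0%nat, 2%nat => (- (a * u))%pexpr
  | 0%nat, 3%nat => (- (f * u))%pexpr
  | 1%nat, 1%nat => (eps * u)%pexpr
  | 2%nat, 2%nat => (a * a * u)%pexpr
  | 2%nat, 3%nat => (a * f * u + r)%pexpr
  | 3%nat, 3%nat => (f * f * u - h * r * r)%pexpr
  | _, _ => PEO end).

Definition orbit_metric (i j : nat) : pexpr := match i, j with
  | 0%nat, 0%nat => E | 1%nat, 1%nat => (eps * E)%pexpr | _, _ => PEO end.

Definition orbit_inverse_metric (i j : nat) : pexpr := match i, j with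
  | 0%nat, 0%nat => u | 1%nat, 1%nat => (eps * u)%pexpr | _, _ => PEO end.

Definition twice (p : pexpr) : pexpr := PEadd p p.

(** Four times K E, with K the Gauss curvature of the orbit metric: minus twice d_1^2 + eps d_2^2
    applied to log E. *)
Definition kappa : pexpr :=
  (- twice ((E11 + eps * E22) * u - (E1 * E1 + eps * E2 * E2) * u * u))%pexpr.

(* Components of 4 Ric in the frame Y_i = d/dt_i - f_i^k d/dz_k, d/dz_k. *)
Definition ricYY (i j : nat) : pexpr := match i, j with
  | 0%nat, 0%nat => kappa - r * (twice (twice q11) - twice (u * (E1 * q1 - eps * E2 * q2)))
      + twice (r * r * q1 * q1)
  | 0%nat, 1%nat => - (r * (twice (twice q12) - twice (u * (E2 * q1 + E1 * q2))))
      + twice (r * r * q1 * q2)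
  | _, _ => eps * kappa - r * (twice (twice q22) - twice (u * (E2 * q2 - eps * E1 * q1)))
      + twice (r * r * q2 * q2) end%pexpr.

Definition ricYz (i : nat) : pexpr := match i with
  | 0%nat => - (twice (eps * r * (twice (q * q2 * f2 * u) + q * q * f22 * u - q * q * f2 * u * u
    * E2)))
  | _ => twice (r * (twice (q * q1 * f2 * u) + q * q * f12 * u - q * q * f2 * u * u * E1))
    end%pexpr.

Definition riczz : pexpr :=
  (u * (- twice (h11 + eps * h22) + twice (r * (h1 * q1 + eps * h2 * q2))
        - twice (h * r * r * (q1 * q1 + eps * q2 * q2)))
   + twice (eps * q * q * f2 * f2 * u * u))%pexpr.

Definition ricz12 : pexpr := (- twice (u * (q11 + eps * q22)))%pexpr.

(** Return from the frame to coordinates by d/dt1 = Y_0 + a d/dz1 + f d/dz2. In the frame, d/dz2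
    pairs nontrivially with d/dz1 only. *)
Definition ricci_expr : nat -> nat -> pexpr := symmetric (fun i j => match i, j with
  | 0%nat, 0%nat => ricYY 0 0 + twice (a * ricYz 0) + a * a * riczz + twice (a * f * ricz12)
  | 0%nat, 1%nat => ricYY 0 1 + a * ricYz 1
  | 0%nat, 2%nat => ricYz 0 + a * riczz + f * ricz12
  | 0%nat, 3%nat => a * ricz12
  | 1%nat, 1%nat => ricYY 1 1
  | 1%nat, 2%nat => ricYz 1
  | 2%nat, 2%nat => riczz
  | 2%nat, 3%nat => ricz12
  | _, _ => 0 end%pexpr).

Definition orbit_ricci_expr (i j : nat) : pexpr := match i, j with
  | 0%nat, 0%nat => kappa | 1%nat, 1%nat => (eps * kappa)%pexpr | _, _ => PEO end.

(** A boolean test over all components, to be run by one evaluation. *)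
Definition all2 n (P : nat -> nat -> bool) := all (fun i => all (P i) (iota 0 n)) (iota 0 n).

Lemma all2P n P : all2 n P -> forall i j : 'I_n, P i j.
Proof.
have in_iota (i : 'I_n) : nat_of_ord i \in iota O n by rewrite mem_iota /= add0n ltn_ord.
by move=> /allP Pn i j; have /allP Pi := Pn i (in_iota i); exact: Pi.
Qed.

Lemma metric_inverse : all2 4 (fun i j => pexpr_eqb rules
  (pexpr_sum 4 (fun l => PEmul (metric i l) (inverse_metric l j))) (if i == j then PEI else PEO)).
Proof. by vm_compute. Qed.

Lemma metric_in : all2 4 (fun i j => pexpr_in first_jets (metric i j)).
Proof. by vm_compute. Qed.

Lemma metric_in_zero_jets :
  all2 4 (fun i j => pexpr_in [:: 1; 2; 4; 16; 22; 28]%positive (metric i j)).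
Proof. by vm_compute. Qed.

Lemma christoffel_in : all (fun k => all2 4 (fun i j =>
  pexpr_in first_jets (christoffel2 4 dv metric inverse_metric k i j))) (iota 0 4).
Proof. by vm_compute. Qed.

Lemma ricci_exprP : all2 4 (fun i j => pexpr_eqb rules
  (ricci4 4 dv metric inverse_metric i j) (ricci_expr i j)).
Proof. by vm_compute. Qed.

Lemma orbit_metric_inverse : all2 2 (fun i j => pexpr_eqb rules
  (pexpr_sum 2 (fun l => PEmul (orbit_metric i l) (orbit_inverse_metric l j)))
  (if i == j then PEI else PEO)).
Proof. by vm_compute. Qed.

Lemma orbit_metric_in : all2 2 (fun i j => pexpr_in first_jets (orbit_metric i j)).
Proof. by vm_compute. Qed.

Lemma orbit_christoffel_in : all (fun k => all2 2 (fun i j =>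
  pexpr_in first_jets (christoffel2 2 dv orbit_metric orbit_inverse_metric k i j))) (iota 0 2).
Proof. by vm_compute. Qed.

Lemma orbit_ricci_exprP : all2 2 (fun i j => pexpr_eqb rules
  (ricci4 2 dv orbit_metric orbit_inverse_metric i j) (orbit_ricci_expr i j)).
Proof. by vm_compute. Qed.

Section Semantics.
Variables (R : realType) (e : R) (E_ q_ h_ f_ a_ : 'rV[R]_2 -> R) (O_ : set 'rV[R]_2).

(** The order is that of the variables x_1 to x_30. Each mixed derivative is listed once, as
    [pd 0 (pd 1 _)]; the other order is supplied by [pd_comm] in [env_derive]. *)
Definition env t : seq R := [:: e; E_ t; (E_ t)^-1; q_ t; (q_ t)^-1;
  pd 0 E_ t; pd 1 E_ t; pd 0 (pd 0 E_) t; pd 0 (pd 1 E_) t; pd 1 (pd 1 E_) t;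
  pd 0 q_ t; pd 1 q_ t; pd 0 (pd 0 q_) t; pd 0 (pd 1 q_) t; pd 1 (pd 1 q_) t;
  h_ t; pd 0 h_ t; pd 1 h_ t; pd 0 (pd 0 h_) t; pd 0 (pd 1 h_) t; pd 1 (pd 1 h_) t;
  f_ t; pd 0 f_ t; pd 1 f_ t; pd 0 (pd 0 f_) t; pd 0 (pd 1 f_) t; pd 1 (pd 1 f_) t;
  a_ t; pd 0 a_ t; pd 0 (pd 0 a_) t].

Lemma envE t vE1 vE2 vE11 vE12 vE22 vq1 vq2 vq11 vq12 vq22 vh1 vh2 vh11 vh12 vh22 vf1 vf2 vf11
  vf12 vf22 va1 va11 :
  pd 0 E_ t = vE1 ->
  pd 1 E_ t = vE2 ->
  pd 0 (pd 0 E_) t = vE11 ->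
  pd 0 (pd 1 E_) t = vE12 ->
  pd 1 (pd 1 E_) t = vE22 ->
  pd 0 q_ t = vq1 ->
  pd 1 q_ t = vq2 ->
  pd 0 (pd 0 q_) t = vq11 ->
  pd 0 (pd 1 q_) t = vq12 ->
  pd 1 (pd 1 q_) t = vq22 ->
  pd 0 h_ t = vh1 ->
  pd 1 h_ t = vh2 ->
  pd 0 (pd 0 h_) t = vh11 ->
  pd 0 (pd 1 h_) t = vh12 ->
  pd 1 (pd 1 h_) t = vh22 ->
  pd 0 f_ t = vf1 ->
  pd 1 f_ t = vf2 ->
  pd 0 (pd 0 f_) t = vf11 ->
  pd 0 (pd 1 f_) t = vf12 ->
  pd 1 (pd 1 f_) t = vf22 ->
  pd 0 a_ t = va1 -> pd 0 (pd 0 a_) t = va11 ->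
  env t = [:: e; E_ t; (E_ t)^-1; q_ t; (q_ t)^-1; vE1; vE2; vE11; vE12; vE22;
    vq1; vq2; vq11; vq12; vq22; h_ t; vh1; vh2; vh11; vh12; vh22;
    f_ t; vf1; vf2; vf11; vf12; vf22; a_ t; va1; va11].
Proof. by do 22! move=> <-. Qed.

Hypotheses (e2 : e * e = 1) (oO : open O_) (sE : smooth_on O_ E_) (sq : smooth_on O_ q_)
  (sh : smooth_on O_ h_) (sf : smooth_on O_ f_) (sa : smooth_on O_ a_)
  (E0 : forall t, O_ t -> E_ t != 0) (q0 : forall t, O_ t -> q_ t != 0)
  (a_t2 : forall t, O_ t -> pd 1 a_ t = 0).

Lemma env_rules t : O_ t -> pexpr_rules (env t) rules.
Proof. by move=> Ot; rewrite /pexpr_rules /pexpr_eval /= !mulfV ?E0 ?q0. Qed.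

Lemma env_derive t (i : 'I_2) j : O_ t -> List.In j first_jets ->
  differentiable (fun s => BinList.nth 0 j (env s)) t /\
  pd i (fun s => BinList.nth 0 j (env s)) t = pexpr_eval (env t) (dv i j).
Proof.
move=> Ot.
have d0 g : smooth_on O_ g -> differentiable g t by move=> sg; exact: Ck_diff (sg 1%nat) Ot.
have d1 g k : smooth_on O_ g -> differentiable (pd k g) t.
  by move=> sg; exact: Ck_diff (Ck_pd k (sg 2%nat)) Ot.
have dV g k : smooth_on O_ g -> (forall s, O_ s -> g s != 0) ->
    differentiable (fun s => (g s)^-1) t /\
    pd k (fun s => (g s)^-1) t = - ((g t)^-1 * (g t)^-1 * pd k g t).
  move=> sg g0; split; first by apply: Ck_diff Ot; exact: Ck_inv (sg 1%nat).
  rewrite /pd deriveV; [|exact: g0|exact/diff_derivable/d0].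
  by rewrite -[_ *: _]/(_ * _) mulNr -exprVn expr2.
have swap g : smooth_on O_ g -> pd 1 (pd 0 g) t = pd 0 (pd 1 g) t.
  by move=> sg; exact: pd_comm oO (sg 2%nat) Ot.
have a01 : pd 1 (pd 0 a_) t = 0.
  rewrite swap// (@pd_on _ _ _ O_ _ (fun=> 0))// pd_cst//.
rewrite /first_jets /=.
have [->|->] := ord2 i.
- case=> [<-|]; first by split; [exact: differentiable_cst|exact: pd_cst].
  case=> [<-|]; first by split; [exact: d0 sE|reflexivity].
  case=> [<-|]; first exact: dV sE E0.
  case=> [<-|]; first by split; [exact: d0 sq|reflexivity].
  case=> [<-|]; first exact: dV sq q0.
  case=> [<-|]; first by split; [exact: d1 sE|reflexivity].
  case=> [<-|]; first by split; [exact: d1 sE|reflexivity].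
  case=> [<-|]; first by split; [exact: d1 sq|reflexivity].
  case=> [<-|]; first by split; [exact: d1 sq|reflexivity].
  case=> [<-|]; first by split; [exact: d0 sh|reflexivity].
  case=> [<-|]; first by split; [exact: d1 sh|reflexivity].
  case=> [<-|]; first by split; [exact: d1 sh|reflexivity].
  case=> [<-|]; first by split; [exact: d0 sf|reflexivity].
  case=> [<-|]; first by split; [exact: d1 sf|reflexivity].
  case=> [<-|]; first by split; [exact: d1 sf|reflexivity].
  case=> [<-|]; first by split; [exact: d0 sa|reflexivity].
  case=> [<-|]; first by split; [exact: d1 sa|reflexivity].
  by [].
- case=> [<-|]; first by split; [exact: differentiable_cst|exact: pd_cst].
  case=> [<-|]; first by split; [exact: d0 sE|reflexivity].
  case=> [<-|]; first exact: dV sE E0.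
  case=> [<-|]; first by split; [exact: d0 sq|reflexivity].
  case=> [<-|]; first exact: dV sq q0.
  case=> [<-|]; first by split; [exact: d1 sE|exact: swap sE].
  case=> [<-|]; first by split; [exact: d1 sE|reflexivity].
  case=> [<-|]; first by split; [exact: d1 sq|exact: swap sq].
  case=> [<-|]; first by split; [exact: d1 sq|reflexivity].
  case=> [<-|]; first by split; [exact: d0 sh|reflexivity].
  case=> [<-|]; first by split; [exact: d1 sh|exact: swap sh].
  case=> [<-|]; first by split; [exact: d1 sh|reflexivity].
  case=> [<-|]; first by split; [exact: d0 sf|reflexivity].
  case=> [<-|]; first by split; [exact: d1 sf|exact: swap sf].
  case=> [<-|]; first by split; [exact: d1 sf|reflexivity].
  case=> [<-|]; first by split; [exact: d0 sa|exact: a_t2].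
  case=> [<-|]; first by split; [exact: d1 sa|exact: a01].
  by [].
Qed.

Let M (t : 'rV[R]_2) := adapted_metric (fun t => E_ t *: mx2 1 0 0 e)
  (null_fibre_metric h_ q_) (shift_form a_ f_) t.

Lemma adapted_metricE t (i j : 'I_(2 + 2)) : M t i j = pexpr_eval (env t) (metric i j).
Proof.
rewrite /M /adapted_metric !sum2E /theta !sum2E !mxE !big_ord1 !mxE /=.
case: i => [[|[|[|[|//]]]] Hi]; case: j => [[|[|[|[|//]]]] Hj];
  rewrite /= /pexpr_eval /metric /symmetric /=; by field.
Qed.

Lemma adapted_metric_unit t : O_ t -> M t \in unitmx.
Proof.
move=> Ot; have [] // := mulmx1_unit (@pexpr_mulmx1 (2 + 2) metric inverse_metric R
  (env t) rules (M t) (env_rules Ot) (adapted_metricE t) (all2P metric_inverse)).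
Qed.

Lemma smooth_adapted_metric (i j : 'I_(2 + 2)) : smooth_on O_ (fun t => M t i j).
Proof.
move=> k; apply: (@Ck_on _ _ _ _ (fun t => pexpr_eval (env t) (metric i j))) => //.
  by move=> t _; rewrite adapted_metricE.
apply: (@pexpr_smooth _ _ _ _ [:: 1; 2; 4; 16; 22; 28]%positive) => //.
  move=> l; do 6! (case=> [<-|]; first by [exact: Ck_cst|exact: sE|exact: sq|exact: sh|exact:
    sf|exact: sa]).
  by [].
exact: (all2P metric_in_zero_jets).
Qed.

Lemma adapted_metric_tr t : (M t)^T = M t.
Proof.
apply/matrixP => i j; rewrite mxE !adapted_metricE /metric /symmetric.
by case: (ltngtP i j) => // ->.
Qed.

Lemma ricci_adapted (U : set 'rV[R]_(2 + 2)) G : open U ->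
  (forall x, U x -> O_ (orb x)) -> (forall x, U x -> G x = M (orb x)) ->
  forall x (i j : 'I_(2 + 2)), U x ->
    4 * ricci G x i j = pexpr_eval (env (orb x)) (ricci_expr i j).
Proof.
move=> oU UO GM x i j Ux.
rewrite -(pexpr_eqbP (env_rules (UO x Ux)) (all2P ricci_exprP i j)).
apply: (@ricci4P (2 + 2) dv metric inverse_metric R U G (fun y => env (orb y)) first_jets rules)
  => //.
- move=> y k l Uy lj; have Oy := UO y Uy.
  have D := fun m => env_derive m Oy lj.
  have dl : differentiable (fun s => BinList.nth 0 l (env s)) (orb y) by case: (D 0).
  split; first exact: (differentiable_orb dl).
  rewrite (pd_orb _ dl) sum2E.
  have b10 (v w : R) : true%:R * v + false%:R * w = v by rewrite mul1r mul0r addr0.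
  have b01 (v w : R) : false%:R * v + true%:R * w = w by rewrite mul1r mul0r add0r.
  have b00 (v w : R) : false%:R * v + false%:R * w = 0 by rewrite !mul0r addr0.
  case: k => [[|[|[|[|//]]]] Hk].
  + have -> : (Ordinal Hk == lshift 2 0) = true by [].
    have -> : (Ordinal Hk == lshift 2 1) = false by [].
    by rewrite b10; case: (D 0).
  + have -> : (Ordinal Hk == lshift 2 0) = false by [].
    have -> : (Ordinal Hk == lshift 2 1) = true by [].
    by rewrite b01; case: (D 1).
  + have -> : (Ordinal Hk == lshift 2 0) = false by [].
    have -> : (Ordinal Hk == lshift 2 1) = false by [].
    by rewrite b00.
  + have -> : (Ordinal Hk == lshift 2 0) = false by [].
    have -> : (Ordinal Hk == lshift 2 1) = false by [].
    by rewrite b00.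
- by move=> y Uy; exact/env_rules/UO.
- by move=> y k l Uy; rewrite GM// adapted_metricE.
- exact: (all2P metric_inverse).
- exact: (all2P metric_in).
- move=> k; apply: (@all2P 4 (fun i j => pexpr_in first_jets
    (christoffel2 4 dv metric inverse_metric k i j))).
  have /allP/(_ (nat_of_ord k)) := christoffel_in; apply.
  by rewrite mem_iota /= add0n ltn_ord.
Qed.

Lemma ricci_orbit (gt : 'rV[R]_2 -> 'M[R]_2) :
  (forall t, O_ t -> gt t = E_ t *: mx2 1 0 0 e) ->
  forall t (i j : 'I_2), O_ t ->
    4 * ricci gt t i j = pexpr_eval (env t) (orbit_ricci_expr i j).
Proof.
move=> gtE t i j Ot.
rewrite -(pexpr_eqbP (env_rules Ot) (all2P orbit_ricci_exprP i j)).
apply: (@ricci4P 2 dv orbit_metric orbit_inverse_metric R O_ gt env first_jets rules) => //.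
- by move=> s k l Os; exact: env_derive.
- exact: env_rules.
- move=> s k l Os; rewrite gtE// !mxE.
  have [->|->] := ord2 k; have [->|->] := ord2 l; rewrite /pexpr_eval /=; ring.
- exact: (all2P orbit_metric_inverse).
- exact: (all2P orbit_metric_in).
- move=> k; apply: (@all2P 2 (fun i j => pexpr_in first_jets
    (christoffel2 2 dv orbit_metric orbit_inverse_metric k i j))).
  have /allP/(_ (nat_of_ord k)) := orbit_christoffel_in; apply.
  by rewrite mem_iota /= add0n ltn_ord.
Qed.

End Semantics.
End AdaptedRicci.
Import AdaptedRicci.

(** * The soliton family *)

Section Partials.
Variables (R : realType) (n : nat) (U : set 'rV[R]_n).
Implicit Types (f g : 'rV[R]_n -> R) (df dg : 'I_n -> 'rV[R]_n -> R).

(** A function together with its gradient in closed form. Composing the rules below makes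
    unification compute the gradient of an expression along with its differentiability. *)
Definition partials f df : Prop := forall x, U x ->
  differentiable f x /\ forall i, pd i f x = df i x.

Lemma partials_pd f : smooth_on U f -> partials f (fun i => pd i f).
Proof. by move=> sf x Ux; split=> //; exact: Ck_diff (sf 1%N) Ux. Qed.

Lemma partials_cst c : partials (fun=> c) (fun _ _ => 0).
Proof. by move=> x _; split=> [|i]; [exact: differentiable_cst|exact: pd_cst]. Qed.

Lemma partials_coord j : partials (fun x => x 0 j) (fun i _ => (i == j)%:R).
Proof. by move=> x _; split=> [|i]; [exact: differentiable_coord|exact: pd_coord]. Qed.

Lemma partialsD f g df dg : partials f df -> partials g dg ->
  partials (fun x => f x + g x) (fun i x => df i x + dg i x).
Proof.
move=> Hf Hg x Ux; have [Df Ef] := Hf x Ux; have [Dg Eg] := Hg x Ux.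
by split=> [|i]; [exact: differentiableD|rewrite pdD// Ef Eg].
Qed.

Lemma partialsN f df : partials f df -> partials (fun x => - f x) (fun i x => - df i x).
Proof.
move=> Hf x Ux; have [Df Ef] := Hf x Ux.
by split=> [|i]; [exact: differentiableN|rewrite pdN// Ef].
Qed.

Lemma partialsM f g df dg : partials f df -> partials g dg ->
  partials (fun x => f x * g x) (fun i x => df i x * g x + f x * dg i x).
Proof.
move=> Hf Hg x Ux; have [Df Ef] := Hf x Ux; have [Dg Eg] := Hg x Ux.
by split=> [|i]; [exact: differentiableM|rewrite pdM// Ef Eg].
Qed.

Lemma partialsX f df k : partials f df ->
  partials (fun x => f x ^+ k) (fun i x => k%:R * f x ^+ k.-1 * df i x).
Proof.
move=> Hf; elim: k => [|k IH].
  move=> x Ux; have [D E] := partials_cst 1 Ux.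
  by split=> // i; rewrite E !mul0r.
move=> x Ux; have [D E] := partialsM Hf IH Ux.
have -> : (fun y => f y ^+ k.+1) = (fun y => f y * f y ^+ k) by apply/funext => y; rewrite exprS.
split=> // i; rewrite E; case: k {IH D E} => [|k] /=; first by rewrite !mul0r mulr0 addr0 expr0
  mulr1 !mul1r.
by rewrite !exprS -[k.+2%:R]natr1; ring.
Qed.

Lemma partialsV f df : (forall x, U x -> f x != 0) -> partials f df ->
  partials (fun x => (f x)^-1) (fun i x => - df i x / f x ^+ 2).
Proof.
move=> f0 Hf x Ux; have [Df Ef] := Hf x Ux.
have H : is_derive (f x) 1 (GRing.inv : R -> R) (- f x ^- 2).
  have := @is_deriveV R id (f x) 1 1 (f0 x Ux) (is_derive_id _ _).
  by rewrite -[_ *: _]/(_ * _) mulr1.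
split=> [|i].
  apply: (@differentiable_comp _ _ _ _ f (GRing.inv : R -> R)) => //.
  by apply/derivable1_diffP; case: H.
by have [_ ->] := pd_scomp i Df H; rewrite Ef !mulNr mulrC.
Qed.

Lemma partials_powR f df p : (forall x, U x -> 0 < f x) -> partials f df ->
  partials (fun x => f x `^ p) (fun i x => p * f x `^ (p - 1) * df i x).
Proof.
move=> f0 Hf x Ux; have [Df Ef] := Hf x Ux.
have H := is_derive1_powR p (f0 x Ux).
split=> [|i]; last by have [_ ->] := pd_scomp i Df H; rewrite Ef.
apply: (@differentiable_comp _ _ _ _ f (fun y => y `^ p)) => //.
by apply/derivable1_diffP; case: H.
Qed.

Lemma eq_partials f g df dg : open U -> partials f df ->
  (forall x, U x -> f x = g x) -> (forall x i, U x -> df i x = dg i x) -> partials g dg.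
Proof.
move=> oU Hf fg dfg x Ux; have [Df Ef] := Hf x Ux; split=> [|i].
  apply: near_eq_differentiable Df.
  by apply: filterS (open_nbhs_nbhs (conj oU Ux)) => y /fg.
by rewrite -(pd_on i oU Ux fg) Ef dfg.
Qed.

Lemma pd_partials2 f df ddf i j x : open U -> partials f df ->
  partials (df j) ddf -> U x -> pd i (pd j f) x = ddf i x.
Proof.
move=> oU Hf Hdf Ux; rewrite (@pd_on _ _ i U _ (df j))//.
  by have [_ ->] := Hdf x Ux.
by move=> y Uy; have [_ ->] := Hf y Uy.
Qed.

End Partials.

Section TangentFields.
Variable R : realType.

Lemma sum4E (V : nmodType) (F : 'I_(2 + 2) -> V) :
  \sum_j F j = (F (lshift 2 0) + F (lshift 2 1)) + (F (rshift 2 0) + F (rshift 2 1)).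
Proof. by rewrite big_split_ord /= !sum2E. Qed.

(** The transport term drops out: X has no t-components, and the coefficients of the metric do not
    depend on z. *)
Lemma lie_metric_tangent U (G : 'rV[R]_(2 + 2) -> 'M[R]_(2 + 2)) M
    (X : 'rV[R]_(2 + 2) -> 'rV[R]_(2 + 2)) x i j :
  open U -> (forall x, U x -> G x = M (orb x)) ->
  (forall i j, smooth_on [set orb x | x in U] (fun t => M t i j)) ->
  (forall x k, U x -> X x 0 (lshift 2 k) = 0) -> U x ->
  lie_metric X G x i j = \sum_k
    (G x (rshift 2 k) j * pd i (fun y => X y 0 (rshift 2 k)) x
     + G x i (rshift 2 k) * pd j (fun y => X y 0 (rshift 2 k)) x).
Proof.
move=> oU GM sM X0 Ux; rewrite mxE sum4E sum2E.
have dX k l : pd l (fun y => X y 0 (lshift 2 k)) x = 0.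
  by rewrite (@pd_on _ _ l U _ (fun=> 0))// ?pd_cst// => y Uy; exact: X0.
have dG k : pd (rshift 2 k) (fun y => G y i j) x = 0.
  rewrite (@pd_on _ _ _ U _ (fun y => M (orb y) i j))//; last by move=> y Uy; rewrite GM.
  rewrite (@pd_orb_rshift _ (fun t => M t i j))//.
  by apply: Ck_diff (sM i j 1%N) _; exists x.
by rewrite !X0// !dX !dG !mulr0 !mul0r !addr0 !add0r.
Qed.

End TangentFields.

Section SolitonFamily.
Variables (R : realType) (eps0 : R) (O : set 'rV[R]_2).
Hypotheses (eps2 : eps0 * eps0 = 1) (oO : open O) (t1_gt0 : forall t, O t -> 0 < t1 t).

Definition family_conformal (t : 'rV[R]_2) : R := t1 t `^ (- (1 / 2)).
Local Notation E := family_conformal.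

Lemma family_conformal_gt0 t : O t -> 0 < E t.
Proof. by move=> /t1_gt0 t0; exact: powR_gt0. Qed.

(** It expresses t1 as a rational function of E, which turns identities with half-integer powers of
    t1 into identities between rational functions. *)
Lemma family_conformal_sqr t : O t -> E t ^+ 2 * t1 t = 1.
Proof.
move=> /t1_gt0 t0; rewrite expr2 -powRD; last by apply/implyP => _; rewrite gt_eqF.
have -> : - (1 / 2) + - (1 / 2) = - 1 :> R by field.
by rewrite powR_inv1 ?ltW// mulVf ?gt_eqF.
Qed.

Lemma family_conformal_sqrt t : O t -> (Num.sqrt (t1 t))^-1 = E t.
Proof. by move=> /t1_gt0 t0; rewrite -powR12_sqrt ?ltW// -powRN /family_conformal div1r. Qed.

Lemma family_powR t : O t -> t1 t `^ (3 / 2) = (E t)^-1 * t1 t.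
Proof.
move=> /t1_gt0 t0; rewrite /family_conformal powRN invrK.
have -> : 3 / 2 = 1 / 2 + 1 :> R by field.
by rewrite powRD ?powRr1 ?ltW//; apply/implyP => _; rewrite gt_eqF.
Qed.

Lemma smooth_t1 : smooth_on O (@t1 R).
Proof. by move=> k; exact: Ck_coord. Qed.

Lemma smooth_t2 : smooth_on O (@t2 R).
Proof. by move=> k; exact: Ck_coord. Qed.

Lemma smooth_family_conformal : smooth_on O E.
Proof. by move=> k; apply: Ck_powR => //; exact: smooth_t1. Qed.

Lemma partials_t1 : partials O (@t1 R) (fun i _ => (i == 0)%:R).
Proof. exact: partials_coord. Qed.

Lemma partials_family_conformal :
  partials O E (fun i t => - 2^-1 * E t * (t1 t)^-1 * (i == 0)%:R).
Proof.
apply: (eq_partials oO (partials_powR (- (1 / 2)) t1_gt0 partials_t1)) => //.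
move=> t i Ot; have t0 := t1_gt0 Ot; rewrite powRD; last by apply/implyP => _; rewrite gt_eqF.
by rewrite powR_inv1 ?ltW// -/(E t) div1r !mulrA.
Qed.

Lemma partials_t2 : partials O (@t2 R) (fun i _ => (i == 1)%:R).
Proof. exact: partials_coord. Qed.

Lemma t1_neq0 t : O t -> t1 t != 0.
Proof. by move=> /t1_gt0; rewrite lt0r => /andP[]. Qed.

Let E1 i j t : O t -> pd i (pd j E) t =
  (3 / 4) * E t * (t1 t)^-1 ^+ 2 * (i == 0)%:R * (j == 0)%:R.
Proof.
move=> Ot.
have := partialsM (partialsM (partialsM (@partials_cst R 2 O (- 2^-1)) partials_family_conformal)
   (partialsV t1_neq0 partials_t1)) (@partials_cst R 2 O (j == 0)%:R).
move=> H; rewrite (pd_partials2 i oO partials_family_conformal H Ot).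
have := t1_neq0 Ot.
by move: (E t) (t1 t) => x y y0; case: (i == 0); case: (j == 0); field.
Qed.

Let dE t : O t -> pd 0 E t = - 2^-1 * E t * (t1 t)^-1 /\ pd 1 E t = 0.
Proof.
by move=> Ot; have [_ H] := partials_family_conformal Ot; rewrite !H /= mulr1 mulr0.
Qed.

Let dt1 t : O t -> [/\ pd 0 (@t1 R) t = 1, pd 1 (@t1 R) t = 0, pd 0 (pd 0 (@t1 R)) t = 0,
  pd 0 (pd 1 (@t1 R)) t = 0 & pd 1 (pd 1 (@t1 R)) t = 0].
Proof.
move=> Ot; have [_ H] := partials_t1 Ot; rewrite !H.
by rewrite !(pd_partials2 _ oO partials_t1 (@partials_cst R 2 O _) Ot).
Qed.

Lemma gauss_family : gauss_curvature O (soliton_orbit_metric eps0)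
   (fun t => - (t1 t `^ (- (3 / 2)) / 4)).
Proof.
move=> t Ot; have t0 := t1_neq0 Ot; have E0 := lt0r_neq0 (family_conformal_gt0 Ot).
apply/matrixP => i j.
have s1 : smooth_on O (fun=> 1 : R) by move=> k; exact: Ck_cst.
(* The four functions 1 are placeholders for q, h, f and a: the orbit metric involves E alone. *)
have H := @ricci_orbit R eps0 E (fun=> 1) (fun=> 1) (fun=> 1) (fun=> 1) O eps2 oO
  smooth_family_conformal s1 s1 s1 s1 (fun t Ot => lt0r_neq0 (family_conformal_gt0 Ot))
  (fun t Ot => oner_neq0 R) (fun t Ot => pd_cst _ _ _) (soliton_orbit_metric eps0)
  (fun t Ot => erefl _) t i j Ot.
have -> : t1 t `^ (- (3 / 2)) = E t * (t1 t)^-1 by rewrite powRN family_powR// invfM invrK.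
have sq := family_conformal_sqr Ot.
have [E_1 E_2] := dE Ot.
apply: (@mulfI _ 4); first by rewrite pnatr_eq0.
rewrite H [in RHS]mxE [in RHS]mxE [in RHS]mxE -/(E t).
have [->|->] := ord2 i; have [->|->] := ord2 j; rewrite /pexpr_eval /= ?E_1 ?E_2 ?E1//=.
all: move: sq t0 E0; move: (E t) (t1 t) => x y sq y0 x0.
all: have xx : x * x = y^-1 by apply: (mulIf y0); rewrite -expr2 sq mulVf.
- have -> : 4 * (- (x / y / 4) * (x * 1)) = - (x * x) / y by field.
  by rewrite xx; field; rewrite y0 x0.
- by ring.
- by ring.
- have -> : 4 * (- (x / y / 4) * (x * eps0)) = - (x * x) / y * eps0 by field.
  by rewrite xx; field; rewrite y0 x0.
Qed.

Variables (a2 : R) (psi : 'rV[R]_2 -> R).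
Hypotheses (psi_smooth : smooth_on O psi) (psi_eq : psi_equation O eps0 a2 psi).

Definition family_fibre t := psi t * t1 t + 4 / 9 * eps0 * E t.
(** This is t2 t1^(-5/2): with q = t1, the term 2 q f dt1 dz1 becomes the required 2 t2 t1^(-3/2)
    dt1 dz1. *)
Definition family_shift t := t2 t * (E t * (t1 t)^-1 ^+ 2).
Local Notation h := family_fibre.
Local Notation f := family_shift.

Lemma smooth_family_fibre : smooth_on O h.
Proof.
move=> k; apply: CkD => //; apply: CkM => //.
- exact: smooth_t1.
- exact: Ck_cst.
- exact: smooth_family_conformal.
Qed.

Lemma smooth_family_shift : smooth_on O f.
Proof.
have sV k : Ck k O (fun t => (@t1 R t)^-1) by apply: Ck_inv => //; [exact: t1_neq0|exact:
  smooth_t1].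
move=> k; apply: CkM => //; first exact: smooth_t2.
by apply: CkM => //; [exact: smooth_family_conformal|exact: CkM].
Qed.

Lemma soliton_metric_adapted t : O t -> soliton_metric eps0 psi t =
  adapted_metric (fun t => E t *: mx2 1 0 0 eps0) (null_fibre_metric h (@t1 R))
    (shift_form (fun=> 0) f) t.
Proof.
move=> Ot; have t0 := t1_neq0 Ot; have E0 := lt0r_neq0 (family_conformal_gt0 Ot).
apply/matrixP => i j; rewrite adapted_metricE /soliton_metric family_powR//.
have -> : Num.sqrt (t1 t) = (E t)^-1 by rewrite -family_conformal_sqrt// invrK.
rewrite !mxE !big_ord1 !mxE /=.
rewrite /pexpr_eval /metric /symmetric /= /h /f.
case: i => [[|[|[|[|//]]]] Hi]; case: j => [[|[|[|[|//]]]] Hj] /=.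
all: move: E0 t0; move: (E t) (t1 t) (t2 t) (psi t) => x y z w x0 y0.
all: by field; rewrite ?x0 ?y0.
Qed.

Let dh t : O t -> [/\ pd 0 h t = pd 0 psi t * t1 t + psi t - 2 / 9 * eps0 * E t * (t1 t)^-1,
   pd 1 h t = pd 1 psi t * t1 t,
   pd 0 (pd 0 h) t = pd 0 (pd 0 psi) t * t1 t + 2 * pd 0 psi t + 1 / 3 * eps0 * E t * (t1 t)^-1
     ^+ 2 &
   pd 1 (pd 1 h) t = pd 1 (pd 1 psi) t * t1 t].
Proof.
move=> Ot.
have PE := partials_family_conformal; have Pt := partials_t1; have PV := partialsV t1_neq0 Pt.
have Pp := partials_pd psi_smooth; have Pc := @partials_cst R 2 O.
have Ph := partialsD (partialsM Pp Pt) (partialsM (Pc (4 / 9 * eps0)) PE).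
have dPE := partialsM (partialsM (partialsM (Pc (- 2^-1)) PE) PV).
have Pp' i : partials O (pd i psi) (fun k => pd k (pd i psi)).
  by apply: partials_pd => k; exact: Ck_pd (psi_smooth k.+1).
have Ph' i := partialsD (partialsD (partialsM (Pp' i) Pt) (partialsM Pp (Pc (i == 0)%:R)))
  (partialsD (partialsM (Pc 0) PE)
    (partialsM (Pc (4 / 9 * eps0)) (dPE _ _ (Pc (i == 0)%:R)))).
have [_ E1h] := Ph t Ot.
have E2h i := pd_partials2 i oO Ph (Ph' i) Ot.
rewrite /h !E1h !E2h /=.
have := t1_neq0 Ot; move: (E t) (t1 t) (psi t) (pd 0 psi t) (pd 1 psi t) => x y z z1 z2 y0.
by split; field.
Qed.

Let df t : O t -> [/\ pd 1 f t = E t * (t1 t)^-1 ^+ 2,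
   pd 1 (pd 1 f) t = 0 & pd 0 (pd 1 f) t = - (5 / 2) * E t * (t1 t)^-1 ^+ 3].
Proof.
move=> Ot.
have PE := partials_family_conformal; have Pt := partials_t1; have PV := partialsV t1_neq0 Pt.
have Pc := @partials_cst R 2 O.
have Pg := partialsM PE (partialsX 2 PV).
have Pf := partialsM partials_t2 Pg.
have [_ E1f] := Pf t Ot.
have Pf1 : partials O (pd 1 f) (fun i t => - (5 / 2) * E t * (t1 t)^-1 ^+ 3 * (i == 0)%:R).
  apply: (eq_partials oO Pg) => [x Ox|x i Ox].
    have [_ ->] := Pf x Ox; have := t1_neq0 Ox.
    by rewrite /= => ?; field.
  have := t1_neq0 Ox; rewrite /=; case: (i == 0) => /= ?; by field.
have [_ E2f] := Pf1 t Ot.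
rewrite !E2f /f E1f /= mulr1 mulr0.
have := t1_neq0 Ot; move: (E t) (t1 t) => x y y0.
by split=> //; field.
Qed.

Lemma family_ricci_soliton a1 a3 :
  ricci_soliton [set x | O (orb x)] (soliton_metric eps0 psi \o @orb R)
    (soliton_field a1 a2 a3) 0.
Proof.
set U := [set x | O (orb x)].
have oU : open U by exact: open_orb_preimage.
pose M := adapted_metric (fun t => E t *: mx2 1 0 0 eps0) (null_fibre_metric h (@t1 R))
    (shift_form (fun=> 0) f).
have GM x : U x -> (soliton_metric eps0 psi \o @orb R) x = M (orb x) by exact:
  soliton_metric_adapted.
have sE := smooth_family_conformal; have sh := smooth_family_fibre.
have sf := smooth_family_shift; have st := smooth_t1.
have s0 : smooth_on O (fun=> 0 : R) by move=> k; exact: Ck_cst.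
have E0 t (Ot : O t) := lt0r_neq0 (family_conformal_gt0 Ot).
have sX : smooth_map_on U (soliton_field a1 a2 a3).
  move=> j k; rewrite /soliton_field.
  apply: (@Ck_on _ _ _ _ (fun x => a1 * ddz 0 x 0 j + (a2 * x 0 (rshift 2 0) + a3) * ddz 1 x 0
    j)) => //.
    by move=> x _; rewrite !mxE.
  apply: CkD => //; apply: CkM => //; try exact: Ck_cst.
  apply: CkD => //; try exact: Ck_cst.
  by apply: CkM => //; [exact: Ck_cst|exact: Ck_coord].
split=> //.
  split=> [i j k|x Ux].
    apply: (@Ck_on _ _ _ _ (fun x => M (orb x) i j)) => //; first by move=> x Ux; rewrite GM.
    apply: (@Ck_orb _ _ O _ (fun t => M t i j)) => //.
    exact: smooth_adapted_metric.
  rewrite GM//; split; first exact: adapted_metric_tr.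
  by apply: adapted_metric_unit Ux => // t Ot; [exact: t1_neq0].
move=> x Ux; apply/matrixP => i j; rewrite [in RHS]mxE mul0r mxE [X in _ + X]mxE.
have X0 y k : U y -> soliton_field a1 a2 a3 y 0 (lshift 2 k) = 0.
  by move=> _; rewrite !mxE !eq_lrshift !andbF !mulr0 addr0.
have dX0 k : pd k (fun y => soliton_field a1 a2 a3 y 0 (rshift 2 0)) x = 0.
  rewrite (@pd_on _ _ k U _ (fun=> a1)) ?pd_cst// => y _.
  by rewrite !mxE /= mulr1 mulr0 addr0.
have dX1 k : pd k (fun y => soliton_field a1 a2 a3 y 0 (rshift 2 1)) x = a2 * (nat_of_ord k ==
  2)%:R.
  have -> : (nat_of_ord k == 2)%N = (k == rshift 2 0) by [].
  have PX := partialsD (partialsM (@partials_cst R (2 + 2) U a2) (@partials_coord _ _ U (rshift 2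
    0)))
    (@partials_cst R (2 + 2) U a3).
  rewrite (@pd_on _ _ k U _ (fun y => a2 * y 0 (rshift 2 0) + a3)) => //.
    by have [_ ->] := PX x Ux; rewrite mul0r add0r addr0.
  by move=> y _; rewrite !mxE /= mulr1 mulr0 add0r.
rewrite (@lie_metric_tangent _ U _ M) => //; last first.
  move=> a b k; apply: (@Ck_sub _ _ _ O); first by move=> _ [y Uy <-].
  exact: smooth_adapted_metric.
rewrite sum2E !dX0 !dX1.
apply: (@mulfI _ 4); first by rewrite pnatr_eq0.
rewrite mulr0 mulrDr (ricci_adapted eps2 oO sE st sh sf s0 E0 t1_neq0 (fun t _ => pd_cst _ _ _)
  oU _ GM)//.
rewrite GM// !adapted_metricE.
have [E_1 E_2] := dE Ux; have [q_1 q_2 q_11 q_12 q_22] := dt1 Ux.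
have [h_1 h_2 h_11 h_22] := dh Ux; have [f_2 f_22 f_12] := df Ux.
(* The equation for psi, solved for the jet to be eliminated; it is needed in the dz1^2
   component. *)
have peq : pd 0 (pd 0 psi) (orb x) = 2 * a2 * E (orb x) - eps0 * pd 1 (pd 1 psi) (orb x)
    - (t1 (orb x))^-1 * pd 0 psi (orb x).
  have := psi_eq Ux; rewrite (family_conformal_sqrt Ux).
  move: (pd 0 (pd 0 psi) _) (pd 1 (pd 1 psi) _) (pd 0 psi _) (t1 _)^-1 (E _).
  by move=> A B C D F <-; ring.
have sq' := family_conformal_sqr Ux.
have y0 := t1_neq0 Ux; have x0 := E0 _ Ux.
have E_11 : pd 0 (pd 0 E) (orb x) = (3 / 4) * E (orb x) * (t1 (orb x))^-1 ^+ 2.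
  by rewrite (E1 0 0 Ux) !mulr1.
have E_12 : pd 0 (pd 1 E) (orb x) = 0 by rewrite (E1 0 1 Ux) mulr0.
have E_22 : pd 1 (pd 1 E) (orb x) = 0 by rewrite (E1 1 1 Ux) mulr0.
rewrite {}peq in h_11.
have z_1 : pd 0 (fun _ : 'rV[R]_2 => 0 : R) (orb x) = 0 by exact: pd_cst.
have z_11 : pd 0 (pd 0 (fun _ : 'rV[R]_2 => 0 : R)) (orb x) = 0.
  have -> : pd 0 (fun _ : 'rV[R]_2 => 0 : R) = fun=> 0 by apply/funext => y; exact: pd_cst.
  exact: pd_cst.
set l := env _ _ _ _ _ _ _.
have lE : l = [:: eps0; E (orb x); (E (orb x))^-1; t1 (orb x); (t1 (orb x))^-1;
    - 2^-1 * E (orb x) * (t1 (orb x))^-1; 0; (3 / 4) * E (orb x) * (t1 (orb x))^-1 ^+ 2; 0; 0;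
    1; 0; 0; 0; 0; h (orb x);
    pd 0 psi (orb x) * t1 (orb x) + psi (orb x) - 2 / 9 * eps0 * E (orb x) * (t1 (orb x))^-1;
    pd 1 psi (orb x) * t1 (orb x);
    (2 * a2 * E (orb x) - eps0 * pd 1 (pd 1 psi) (orb x)
      - (t1 (orb x))^-1 * pd 0 psi (orb x)) * t1 (orb x) + 2 * pd 0 psi (orb x)
      + 1 / 3 * eps0 * E (orb x) * (t1 (orb x))^-1 ^+ 2;
    pd 0 (pd 1 h) (orb x); pd 1 (pd 1 psi) (orb x) * t1 (orb x);
    f (orb x); pd 0 f (orb x); E (orb x) * (t1 (orb x))^-1 ^+ 2; pd 0 (pd 0 f) (orb x);
    - (5 / 2) * E (orb x) * (t1 (orb x))^-1 ^+ 3; 0; 0; 0; 0].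
  by rewrite /l (envE eps0 E_1 E_2 E_11 E_12 E_22 q_1 q_2 q_11 q_12 q_22 h_1 h_2 h_11 erefl h_22
    erefl f_2 erefl f_12 f_22 z_1 z_11).
rewrite lE {lE l E_1 E_2 q_1 q_2 q_11 q_12 q_22 h_1 h_2 h_11 h_22 f_2 f_22 f_12 E_11 E_12 E_22
  z_1 z_11}.
have hE : h (orb x) = psi (orb x) * t1 (orb x) + 4 / 9 * eps0 * E (orb x) by [].
move: hE sq' x0 y0; move: (pd 0 psi _) (pd 1 psi _) (pd 1 (pd 1 psi) _) (pd 0 (pd 1 h) _)
  (pd 0 f _) (pd 0 (pd 0 f) _) => z1 z2 z22 h12 f1 f11.
move: (E _) (t1 _) (h _) (f _) (psi _) => x_ y h_ f_ z hE sq' x0 y0.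
(* With t1 = E^(-2) and eps0 replaced by its two values, every component is a rational identity. *)
have {}sq' : y = (x_ ^+ 2)^-1 by apply: (mulfI (expf_neq0 2 x0)); rewrite sq' mulfV ?expf_neq0.
rewrite {}hE {y y0}sq'.
have e1 : eps0 = 1 \/ eps0 = -1.
  by move/eqP: eps2; rewrite -expr2 sqrf_eq1 => /orP[]/eqP; [left|right].
case: i => [[|[|[|[|//]]]] Hi]; case: j => [[|[|[|[|//]]]] Hj].
all: rewrite /pexpr_eval /=.
all: move=> *.
all: have [e1'|e1'] := e1; rewrite ?e1'.
all: by field.
Qed.
End SolitonFamily.

(** * The equations on the orbit space *)

Section OrbitEquations.
Variables (R : realType) (eps : R).

(** The last hypothesis has the exact form in which the [partials] rules deliver the two expressions
    of a third derivative of q, the zeros being derivatives of constants. After elimination of the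
    second derivatives of q and of E11, the difference of its sides is 2 eps E (a q1). *)
Lemma integrability_algebra (a E E1 E2 E11 E12 E21 E22 q q1 q2 q11 q12 q21 q22 : R) :
  eps = 1 \/ eps = -1 -> E != 0 -> q != 0 ->
  4 * q11 = 2 * (a * q * E) + (2 * (E1 * q1 - eps * E2 * q2) / E + (q1 ^+ 2 - eps * q2 ^+ 2) / q) ->
  4 * q12 = 2 * (E2 * q1 + E1 * q2) / E + 2 * q1 * q2 / q ->
  4 * q22 = eps * (2 * (a * q * E) - (2 * (E1 * q1 - eps * E2 * q2) / E + (q1 ^+ 2 - eps * q2 ^+
    2) / q)) ->
  E11 + eps * E22 = (E1 ^+ 2 + eps * E2 ^+ 2) / E - a * E ^+ 2 + E * (q1 ^+ 2 + eps * q2 ^+ 2) /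
    (2 * q ^+ 2) ->
  E21 = E12 -> q21 = q12 ->
  0 * (2 * (a * q * E) - (2 * (E1 * q1 - eps * E2 * q2) / E + (q1 ^+ 2 - eps * q2 ^+ 2) / q))
  + eps * (0 * (a * q * E) + 2 * ((0 * q + a * q1) * E + a * q * E1)
    - ((0 * (E1 * q1 - eps * E2 * q2)
        + 2 * (E11 * q1 + E1 * q11 - ((0 * E2 + eps * E12) * q2 + eps * E2 * q12))) / E
       + 2 * (E1 * q1 - eps * E2 * q2) * (- E1 / E ^+ 2)
       + ((2 * q1 ^+ 1 * q11 - (0 * q2 ^+ 2 + eps * (2 * q2 ^+ 1 * q12))) / q
          + (q1 ^+ 2 - eps * q2 ^+ 2) * (- q1 / q ^+ 2))))
  = (0 * (E2 * q1 + E1 * q2) + 2 * (E22 * q1 + E2 * q21 + (E21 * q2 + E1 * q22))) / E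
    + 2 * (E2 * q1 + E1 * q2) * (- E2 / E ^+ 2)
    + (((0 * q1 + 2 * q21) * q2 + 2 * q1 * q22) / q + 2 * q1 * q2 * (- q2 / q ^+ 2)) ->
  a * q1 = 0.
Proof.
have K (x y : R) : 4 * x = y -> x = y / 4 by move=> <-; field.
move=> e1 E0 q0 /K-> /K-> /K-> /(canRL (addrK _)) -> -> -> /eqP.
rewrite -subr_eq0; set D := (X in X == 0) => /eqP D0.
have : D = 2 * eps * E * (a * q1).
  by rewrite /D {D D0}; case: e1 => ->; field; rewrite E0 q0.
rewrite D0 => /esym/eqP; rewrite mulf_eq0 => /orP[|/eqP//].
by case: e1 => ->; rewrite !mulf_eq0 (negbTE E0) ?oppr_eq0 oner_eq0 pnatr_eq0.
Qed.

(** The left sides are the derivatives of N = q1^2 + eps q2^2, so N has the same logarithmic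
    derivative as E sqrt |q|. *)
Lemma gradient_algebra (E E1 E2 q q1 q2 q11 q12 q22 : R) :
  eps = 1 \/ eps = -1 -> E != 0 -> q != 0 ->
  4 * q11 = (2 * (E1 * q1 - eps * E2 * q2) / E + (q1 ^+ 2 - eps * q2 ^+ 2) / q) ->
  4 * q12 = 2 * (E2 * q1 + E1 * q2) / E + 2 * q1 * q2 / q ->
  4 * q22 = - eps * ((2 * (E1 * q1 - eps * E2 * q2) / E + (q1 ^+ 2 - eps * q2 ^+ 2) / q)) ->
  2 * (q1 * q11 + eps * q2 * q12) = (q1 ^+ 2 + eps * q2 ^+ 2) * (E1 / E + q1 / (2 * q)) /\
  2 * (q1 * q12 + eps * q2 * q22) = (q1 ^+ 2 + eps * q2 ^+ 2) * (E2 / E + q2 / (2 * q)).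
Proof.
have K (x y : R) : 4 * x = y -> x = y / 4 by move=> <-; field.
move=> e1 E0 q0 /K-> /K-> /K->.
by case: e1 => ->; split; field; rewrite E0 q0.
Qed.

Variables (B : set 'rV[R]_2) (E q : 'rV[R]_2 -> R).
Hypotheses (eps1 : eps = 1 \/ eps = -1) (oB : open B) (sE : smooth_on B E) (sq : smooth_on B q)
  (E0 : forall t, B t -> E t != 0) (q0 : forall t, B t -> q t != 0).

Variable a : R.
Hypotheses
  (q11E : forall t, B t -> 4 * pd 0 (pd 0 q) t = 2 * (a * q t * E t)
     + (2 * (pd 0 E t * pd 0 q t - eps * pd 1 E t * pd 1 q t) / E t
        + (pd 0 q t ^+ 2 - eps * pd 1 q t ^+ 2) / q t))
  (q12E : forall t, B t -> 4 * pd 0 (pd 1 q) t =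
     2 * (pd 1 E t * pd 0 q t + pd 0 E t * pd 1 q t) / E t + 2 * pd 0 q t * pd 1 q t / q t)
  (q22E : forall t, B t -> 4 * pd 1 (pd 1 q) t = eps * (2 * (a * q t * E t)
     - (2 * (pd 0 E t * pd 0 q t - eps * pd 1 E t * pd 1 q t) / E t
        + (pd 0 q t ^+ 2 - eps * pd 1 q t ^+ 2) / q t)))
  (traceE : forall t, B t -> pd 0 (pd 0 E) t + eps * pd 1 (pd 1 E) t =
     (pd 0 E t ^+ 2 + eps * pd 1 E t ^+ 2) / E t - a * E t ^+ 2
     + E t * (pd 0 q t ^+ 2 + eps * pd 1 q t ^+ 2) / (2 * q t ^+ 2)).

(* The derivative of [q12E] along t2 and that of [q22E] along t1 express the
   same third derivative of q; the other equations reduce the difference of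
   the two expressions to a multiple of a * pd 0 q. *)
Lemma laplacian_coefficient_eq0 t : B t -> a * pd 0 q t = 0.
Proof.
move=> Bt.
have pdS f i : smooth_on B f -> smooth_on B (pd i f) by move=> sf k; exact: Ck_pd (sf k.+1).
have PE := partials_pd sE; have Pq := partials_pd sq.
have PEi i := partials_pd (pdS _ i sE); have Pqi i := partials_pd (pdS _ i sq).
have Pc := @partials_cst R 2 B.
have PVE := partialsV E0 PE; have PVq := partialsV q0 Pq.
have P22 := partialsM (Pc eps) (partialsD (partialsM (Pc 2) (partialsM (partialsM (Pc a) Pq) PE))
  (partialsN (partialsD (partialsM (partialsM (Pc 2) (partialsD (partialsM (PEi 0) (Pqi 0))
     (partialsN (partialsM (partialsM (Pc eps) (PEi 1)) (Pqi 1))))) PVE)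
   (partialsM (partialsD (partialsX 2 (Pqi 0)) (partialsN (partialsM (Pc eps) (partialsX 2 (Pqi
     1))))) PVq)))).
have P12 := partialsD (partialsM (partialsM (Pc 2) (partialsD (partialsM (PEi 1) (Pqi 0))
     (partialsM (PEi 0) (Pqi 1)))) PVE)
   (partialsM (partialsM (partialsM (Pc 2) (Pqi 0)) (Pqi 1)) PVq).
have d4 i j : pd i (fun t => 4 * pd j (pd 1 q) t) t = 4 * pd i (pd j (pd 1 q)) t.
  have P4 := partialsM (Pc 4) (partials_pd (pdS _ j (pdS _ 1 sq))).
  by have [_ ->] := P4 t Bt; rewrite mul0r add0r.
have c1 := pd_comm 0 1 oB (sE 2%N) Bt.
have c2 := pd_comm 0 1 oB (sq 2%N) Bt.
have c3 := pd_comm 0 1 oB (pdS _ 1 sq 2%N) Bt.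
have H0 := d4 0 1; rewrite (pd_on 0 oB Bt q22E) in H0.
have H1 := d4 1 0; rewrite (pd_on 1 oB Bt q12E) in H1.
have [_ /(_ 0) V0] := P22 t Bt; have [_ /(_ 1) V1] := P12 t Bt.
have D := etrans (esym V0) (etrans (etrans H0 (etrans (congr1 (fun x => 4 * x) c3) (esym H1))) V1).
exact: (integrability_algebra eps1 (E0 Bt) (q0 Bt) (q11E Bt) (q12E Bt) (q22E Bt) (traceE Bt)
  (esym c1) (esym c2) D).
Qed.

End OrbitEquations.

(** * Isothermal coordinates on the orbit space *)

Section OrbitCoordinates.
Variables (R : realType) (eps : R) (p0 : 'rV[R]_2) (r : R) (E q f phi : 'rV[R]_2 -> R) (s c : R).
Local Notation B := (ball p0 r).
Local Notation N t := (pd 0 q t ^+ 2 + eps * pd 1 q t ^+ 2).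
Hypotheses (eps1 : eps = 1 \/ eps = -1) (r0 : 0 < r)
  (sE : smooth_on B E) (sq : smooth_on B q) (sf : smooth_on B f) (sphi : smooth_on B phi)
  (E0 : forall t, B t -> 0 < E t) (s2 : s * s = 1) (q0 : forall t, B t -> 0 < s * q t)
  (N0 : 0 < N p0) (c0 : c != 0)
  (q11E : forall t, B t -> 4 * pd 0 (pd 0 q) t =
     (2 * (pd 0 E t * pd 0 q t - eps * pd 1 E t * pd 1 q t) / E t
        + (pd 0 q t ^+ 2 - eps * pd 1 q t ^+ 2) / q t))
  (q12E : forall t, B t -> 4 * pd 0 (pd 1 q) t =
     2 * (pd 1 E t * pd 0 q t + pd 0 E t * pd 1 q t) / E t + 2 * pd 0 q t * pd 1 q t / q t)
  (q22E : forall t, B t -> 4 * pd 1 (pd 1 q) t = - eps *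
     ((2 * (pd 0 E t * pd 0 q t - eps * pd 1 E t * pd 1 q t) / E t
        + (pd 0 q t ^+ 2 - eps * pd 1 q t ^+ 2) / q t)))
  (fE : forall t, B t -> q t ^+ 2 * pd 1 f t / E t = c)
  (phi_t2 : forall t, B t -> pd 1 phi t = 0).

Let oB : open B. Proof. exact: ball_open. Qed.
Let s0 : s != 0. Proof. by apply/eqP => s0; move/eqP: s2; rewrite s0 mul0r eq_sym oner_eq0. Qed.
Let qn0 t : B t -> q t != 0.
Proof. by move=> /q0; rewrite lt0r mulf_eq0 negb_or => /andP[/andP[]]. Qed.
Let En0 t : B t -> E t != 0. Proof. by move=> /E0 /lt0r_neq0. Qed.

(** Here s is the sign of q, so the power is 1 / sqrt |q|. By [gradient_algebra] the logarithmic
    derivatives of the three factors cancel. *)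
Lemma harmonic_gradient t : B t ->
  N t / E t * (s * q t) `^ (- (1 / 2)) = N p0 / E p0 * (s * q p0) `^ (- (1 / 2)).
Proof.
have pdS g i : smooth_on B g -> smooth_on B (pd i g) by move=> sg k; exact: Ck_pd (sg k.+1).
have PE := partials_pd sE; have Pq := partials_pd sq.
have Pqi i := partials_pd (pdS _ i sq).
have Pc := @partials_cst R 2 B.
have PVE := partialsV En0 PE.
have Psq := partials_powR (- (1 / 2)) q0 (partialsM (Pc s) Pq).
have P := partialsM (partialsM (partialsD (partialsX 2 (Pqi 0)) (partialsM (Pc eps) (partialsX 2
  (Pqi 1)))) PVE) Psq.
apply: (@cst_on_ball _ _ (fun t => N t / E t * (s * q t) `^ (- (1 / 2))) p0 r t).
  by move=> x /P[].
move=> x i Bx; have [_ ->] := P x Bx.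
have [G0 G1] := gradient_algebra eps1 (En0 Bx) (qn0 Bx) (q11E Bx) (q12E Bx) (q22E Bx).
have Gi : 2 * (pd 0 q x * pd i (pd 0 q) x + eps * pd 1 q x * pd i (pd 1 q) x) =
    N x * (pd i E x / E x + pd i q x / (2 * q x)).
  have [->|->] := ord2 i; first exact: G0.
  by rewrite -(pd_comm 0 1 oB (sq 2%N) Bx).
rewrite powRD; last by apply/implyP => _; rewrite mulf_neq0// qn0.
rewrite powR_inv1; last exact/ltW/q0.
move: Gi (En0 Bx) (qn0 Bx) s0; rewrite /= {G0 G1 P Psq}.
move: (pd i (pd 0 q) x) (pd i (pd 1 q) x) (pd 0 q x) (pd 1 q x) (pd i q x) (pd i E x) (E x) (q x)
  => a b d e g h E' q' + E0' q0' s0'.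
move: (_ `^ _) => w Gi.
have -> : (2%:R * d ^+ 1 * a + (0 * e ^+ 2 + eps * (2%:R * e ^+ 1 * b))) = 2 * (d * a + eps * e *
  b) by ring.
by rewrite Gi; field; rewrite E0' q0' s0'.
Qed.

(* The new t1 is tau = |q| / lam and the new t2 its harmonic conjugate; F and S
   are the shifts of z1 and z2. The factor lam is the square of the cube root
   of the constant of [harmonic_gradient]: this choice gives the orbit metric
   the factor tau^(-1/2) exactly. *)
Lemma orbit_coordinates : exists lam mu nu V W Phi Psi F S,
  [/\ [/\ 0 < lam, mu != 0, mu * c = s * lam & nu = s * lam * mu],
      coordinate_change V W Phi Psi, V p0 /\ V `<=` B,
      (smooth_on V F /\ smooth_on V S) &
      forall t, V t ->
      let tau := @t1 R \o Phi in let g := (tau t) `^ (- (1 / 2)) in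
      [/\ s * q t = lam * tau t /\ 0 < tau t,
          pd 0 F t = phi t /\ pd 1 F t = 0,
          pd 0 S t = nu * f t - t2 (Phi t) * (g * (tau t)^-1 ^+ 2 * pd 0 tau t) /\
          pd 1 S t = - (t2 (Phi t) * (g * (tau t)^-1 ^+ 2 * pd 1 tau t)),
          (pd 0 tau t ^+ 2 + eps * pd 1 tau t ^+ 2) * g = E t /\
          [/\ pd 0 tau t = s / lam * pd 0 q t, pd 1 tau t = s / lam * pd 1 q t,
              pd 0 (@t2 R \o Phi) t = - eps * pd 1 tau t & pd 1 (@t2 R \o Phi) t = pd 0 tau t] &
          let D := pd 0 tau t ^+ 2 + eps * pd 1 tau t ^+ 2 in
          [/\ pd 0 (fun y => Psi y 0 0) (Phi t) = pd 0 tau t / D,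
              pd 0 (fun y => Psi y 0 1) (Phi t) = eps * pd 1 tau t / D,
              pd 1 (fun y => Psi y 0 0) (Phi t) = - pd 1 tau t / D &
              pd 1 (fun y => Psi y 0 1) (Phi t) = pd 0 tau t / D]]].
Proof.
have Bp : B p0 by exact: ballxx.
pose k0 := N p0 / E p0 * (s * q p0) `^ (- (1 / 2)).
have k0_gt0 : 0 < k0 by rewrite !mulr_gt0 ?invr_gt0 ?E0// powR_gt0// q0.
pose k := k0 `^ (1 / 3).
have k_gt0 : 0 < k by exact: powR_gt0.
have k3 : k ^+ 3 = k0.
  by rewrite -powR_mulrn ?ltW// -powRrM (_ : 1 / 3 * 3%:R = 1) ?powRr1 ?ltW//; field.
pose lam := k ^+ 2.
have lam0 : 0 < lam by rewrite exprn_gt0.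
have lamn0 := lt0r_neq0 lam0; have kn0 := lt0r_neq0 k_gt0.
pose tau t := s / lam * q t.
have tau_gt0 t : B t -> 0 < tau t.
  by move=> Bt; rewrite /tau mulrAC divr_gt0// q0.
have sqE t : s * q t = lam * tau t by rewrite /tau; field.
have Pc := @partials_cst R 2 B.
have stau : smooth_on B tau by move=> m; apply: CkM => //; exact: Ck_cst.
have taui i t : B t -> pd i tau t = s / lam * pd i q t.
  by move=> Bt; have [_ ->] := partialsM (Pc (s / lam)) (partials_pd sq) Bt; rewrite mul0r add0r.
have pdS g i : smooth_on B g -> smooth_on B (pd i g) by move=> sg m; exact: Ck_pd (sg m.+1).
have tauij i j t : B t -> pd i (pd j tau) t = s / lam * pd i (pd j q) t.
  move=> Bt; rewrite (pd_on i oB Bt (taui j)).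
  by have [_ ->] := partialsM (Pc (s / lam)) (partials_pd (pdS _ j sq)) Bt; rewrite mul0r add0r.
pose G t := tau t `^ (- (1 / 2)).
have G_gt0 t : B t -> 0 < G t by move=> /tau_gt0; exact: powR_gt0.
have Dtau t : B t -> (pd 0 tau t ^+ 2 + eps * pd 1 tau t ^+ 2) * G t = E t.
  move=> Bt; have H := harmonic_gradient Bt.
  rewrite -/k0 -k3 sqE powRM ?ltW ?tau_gt0// -/(G t) in H.
  have kk : lam `^ (- (1 / 2)) = k^-1.
    have e1 : 2%:R * - (1 / 2) = - 1 :> R by field.
    by rewrite /lam -(powR_mulrn _ (ltW k_gt0)) -powRrM e1 powR_inv1// ltW.
  rewrite kk in H; rewrite !taui//.
  have : N t * G t = k ^+ 4 * E t.
    have -> : N t * G t = (N t / E t * (k^-1 * G t)) * k * E t by field; rewrite kn0 En0.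
    by rewrite H; ring.
  move=> H2; have -> : ((s / lam * pd 0 q t) ^+ 2 + eps * (s / lam * pd 1 q t) ^+ 2) * G t =
    (s * s) * (N t * G t) / lam ^+ 2 by field.
  by rewrite s2 H2 /lam; field.
have Dn0 t : B t -> pd 0 tau t ^+ 2 + eps * pd 1 tau t ^+ 2 != 0.
  move=> Bt; have := En0 Bt; rewrite -(Dtau t Bt).
  by rewrite mulf_eq0 negb_or => /andP[].
have Ptau := partials_pd stau; have Ptaui i := partials_pd (pdS _ i stau).
(* The equality q_11 + eps q_22 = 0 says that - eps tau_2 dt1 + tau_1 dt2 is closed; its primitive
   is the harmonic conjugate [sg]. *)
have lap t : B t -> pd 1 (fun t => - eps * pd 1 tau t) t = pd 0 (pd 0 tau) t.
  move=> Bt; have [_ ->] := partialsM (Pc (- eps)) (Ptaui 1) Bt.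
  rewrite mul0r add0r !tauij//.
  have : eps * pd 1 (pd 1 q) t = - pd 0 (pd 0 q) t.
    apply: (@mulfI _ 4); first by rewrite pnatr_eq0.
    rewrite mulrCA q22E// mulrN q11E//.
    by case: eps1 => ->; rewrite ?opprK ?mulN1r ?mul1r ?mulrN ?mulNr ?mulN1r ?mul1r ?opprK.
  by move=> H; rewrite mulNr mulrCA H; ring.
have [d1 [sg [d10 d1r ssg sgE]]] := poincare r0
  (fun m => CkM oB (Ck_cst m B (- eps)) (pdS _ 1 stau m)) (pdS _ 0 stau) lap.
have [d2 [F [d20 d2r sF FE]]] : exists d F, [/\ 0 < d, d <= r, smooth_on (ball p0 d) F &
    forall x, ball p0 d x -> pd 0 F x = phi x /\ pd 1 F x = 0].
  apply: (@poincare R p0 r phi (fun=> 0)) => // [m|x Bx]; first exact: Ck_cst.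
  by rewrite phi_t2// pd_cst.
(* With this nu, the derivative of nu f along t2 is E / tau^2. Then nu f dt1 and sg tau^(-5/2) d tau
   have the same exterior derivative, and S is a primitive of their difference. *)
pose nu := lam ^+ 2 / c.
pose H t := G t * (tau t)^-1 ^+ 2.
have sub1 : ball p0 d1 `<=` B by exact: le_ball.
have oB1 : open (ball p0 d1) by exact: ball_open.
have sG : smooth_on B G by move=> m; apply: Ck_powR => //; exact: stau.
have taun0 t : B t -> tau t != 0 by move=> /tau_gt0/lt0r_neq0.
have sV : smooth_on B (fun t => (tau t)^-1) by move=> m; apply: Ck_inv => //; exact: stau.
have sH : smooth_on B H.
  by move=> m; apply: CkM => //; exact: CkM.
have sHi i : smooth_on (ball p0 d1) (fun t => sg t * (H t * pd i tau t)).
  move=> m; apply: CkM => //; apply: CkM => //; first exact: Ck_sub sub1 (sH m).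
  exact: Ck_sub sub1 (pdS _ i stau m).
have sa0 : smooth_on (ball p0 d1) (fun t => nu * f t - sg t * (H t * pd 0 tau t)).
  move=> m; apply: CkB => //; last exact: sHi.
  by apply: CkM => //; [exact: Ck_cst|exact: Ck_sub sub1 (sf m)].
have sa1 : smooth_on (ball p0 d1) (fun t => - (sg t * (H t * pd 1 tau t))).
  by move=> m; apply: CkN => //; exact: sHi.
have closedS t : ball p0 d1 t -> pd 1 (fun t => nu * f t - sg t * (H t * pd 0 tau t)) t =
    pd 0 (fun t => - (sg t * (H t * pd 1 tau t))) t.
  move=> B1t; have Bt := sub1 _ B1t; have [sg0 sg1] := sgE t B1t.
  have restr g dg : partials B g dg -> partials (ball p0 d1) g dg by move=> Hg x /sub1; exact: Hg.
  have Pc1 := @partials_cst R 2 (ball p0 d1).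
  have PG := partials_powR (- (1 / 2)) tau_gt0 Ptau.
  have PV := partialsV taun0 Ptau.
  have PH := restr _ _ (partialsM PG (partialsX 2 PV)).
  have Psg := partials_pd ssg.
  have P0 := partialsD (partialsM (Pc1 nu) (restr _ _ (partials_pd sf)))
    (partialsN (partialsM Psg (partialsM PH (restr _ _ (Ptaui 0))))).
  have P1 := partialsN (partialsM Psg (partialsM PH (restr _ _ (Ptaui 1)))).
  have [_ /(_ 1) V0] := P0 t B1t; have [_ /(_ 0) V1] := P1 t B1t.
  apply: etrans V0 (etrans _ (esym V1)).
  rewrite sg0 sg1 (pd_comm 1 0 oB (stau 2%N) Bt).
  rewrite powRD; last by apply/implyP => _; exact: taun0.
  rewrite powR_inv1; last exact/ltW/tau_gt0.
  rewrite -/(G t) /H.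
  have f2 : pd 1 f t = c * E t / (lam ^+ 2 * tau t ^+ 2).
    have qt : q t ^+ 2 = lam ^+ 2 * tau t ^+ 2.
      by rewrite -exprMn -sqE exprMn [s ^+ 2]expr2 s2 mul1r.
    by rewrite -(fE Bt) qt; field; rewrite taun0// En0// lamn0.
  rewrite f2 -(Dtau t Bt) /nu.
  move: (taun0 t Bt); move: (pd 0 tau t) (pd 1 tau t) (pd 0 (pd 1 tau) t) (tau t) (G t) (sg t) (f
    t).
  move=> x1 x2 x12 x g y z x0.
  by field; rewrite x0 lamn0 c0.
have [d3 [S [d30 d31 sS SE]]] := poincare d10 sa0 sa1 closedS.
pose d := Num.min d2 d3.
have d0 : 0 < d by rewrite lt_min d20.
have subd2 : ball p0 d `<=` ball p0 d2 by apply: le_ball; rewrite ge_min lexx.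
have subd3 : ball p0 d `<=` ball p0 d3 by apply: le_ball; rewrite ge_min lexx orbT.
have subd1 : ball p0 d `<=` ball p0 d1 by move=> x /subd3; exact: le_ball.
have subB : ball p0 d `<=` B by move=> x /subd1/sub1.
pose Phi t := pt (tau t) (sg t).
have Phi1 : @t1 R \o Phi = tau by apply/funext => t; rewrite /= /t1 pt0.
have Phi2 : @t2 R \o Phi = sg by apply/funext => t; rewrite /= /t2 pt1.
have oBd : open (ball p0 d) by exact: ball_open.
have sPhi : smooth_map_on (ball p0 d) Phi.
  move=> j m; have [->|->] := ord2 j.
    by apply: Ck_on (Ck_sub subB (stau m)) => // t _; rewrite pt0.
  by apply: Ck_on (Ck_sub subd1 (ssg m)) => // t _; rewrite pt1.
have Pp0 : ball p0 d p0 by exact: ballxx.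
pose D t := pd 0 tau t ^+ 2 + eps * pd 1 tau t ^+ 2.
(* By the Cauchy-Riemann equations the Jacobian of [Phi] has determinant D; this is its explicit
   inverse. *)
pose J t := mx2 (pd 0 tau t / D t) (eps * pd 1 tau t / D t) (- pd 1 tau t / D t) (pd 0 tau t / D t).
have jacJ t : ball p0 d t -> jac Phi t *m J t = 1%:M.
  move=> dt; have [sg0 sg1] := sgE t (subd1 _ dt); have := Dn0 t (subB _ dt); rewrite -/(D t) => D0.
  have Phi1' : (fun y => Phi y 0 0) = tau by exact: Phi1.
  have Phi2' : (fun y => Phi y 0 1) = sg by exact: Phi2.
  have -> : jac Phi t = mx2 (pd 0 tau t) (- eps * pd 1 tau t) (pd 1 tau t) (pd 0 tau t).
    apply/matrixP => i j; rewrite mxE [RHS]mxE.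
    have [->|->] := ord2 i; have [->|->] := ord2 j => /=.
    - by rewrite Phi1'.
    - by rewrite Phi2' sg0.
    - by rewrite Phi1'.
    - by rewrite Phi2' sg1.
  move: D0; rewrite /J /D; move: (pd 0 tau t) (pd 1 tau t) => x y xy0.
  apply/matrixP => i j; rewrite mxE sum2E !mxE.
  by have [->|->] := ord2 i; have [->|->] := ord2 j => /=; field.
have uJ t : ball p0 d t -> jac Phi t \in unitmx by move=> /jacJ/mulmx1_unit[].
have [V [W [Psi [cc Vp VB _ PsiE]]]] := inverse_function oBd Pp0 sPhi (uJ _ Pp0).
(* Once nu is fixed by the curvature, mu = nu / (s lam) is the scale of z1 for which the coefficient
   q mu / nu equals tau. *)
exists lam, (s * lam / c), nu, V, W, Phi, Psi, F, S.
have mu0 : s * lam / c != 0 by rewrite !mulf_neq0 ?invr_eq0.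
have nuE : nu = s * lam * (s * lam / c).
  have -> : s * lam * (s * lam / c) = (s * s) * lam ^+ 2 / c by field.
  by rewrite s2 mul1r.
split=> //.
- by split=> //; rewrite divfK.
- by split=> // x /VB/subB.
- by split=> m; [exact: Ck_sub (fun x Vx => subd2 _ (VB _ Vx)) (sF m)
     |exact: Ck_sub (fun x Vx => subd3 _ (VB _ Vx)) (sS m)].
move=> t Vt; rewrite !Phi1 !Phi2.
have Bt := subB _ (VB _ Vt); have [sg0 sg1] := sgE t (subd1 _ (VB _ Vt)).
split.
- by split; [exact: sqE|exact: tau_gt0].
- exact: FE (subd2 _ (VB _ Vt)).
- have -> : t2 (Phi t) = sg t by exact: pt1.
  exact: SE (subd3 _ (VB _ Vt)).
- by split; [exact: Dtau|split; [exact: taui|exact: taui|exact: sg0|exact: sg1]].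
- have WP : W (Phi t) by case: cc => _ _ [h _] _; exact: h.
  have PK : Psi (Phi t) = t by case: cc => _ _ _ [h _]; exact: h.
  rewrite !(PsiE _ WP) PK.
  have -> : invmx (jac Phi t) = J t.
    by rewrite -[invmx _]mulmx1 -(jacJ t (VB _ Vt)) mulKmx// uJ//; exact: VB.
  by split; rewrite mxE.
Qed.

End OrbitCoordinates.

(** * The equation for psi in the new orbit coordinates *)

Section ConformalLaplacian.
Variables (R : realType) (eps : R).

Lemma conformal_laplacian_algebra (g0 g1 g00 g01 g10 g11 x1 x2 x11 x12 x22 y1 y2 y11 y22 P1 P2
  P11 P22 : R) :
  eps = 1 \/ eps = -1 ->
  y1 = - eps * x2 -> y2 = x1 -> y11 = - eps * x12 -> y22 = x12 -> x11 = - eps * x22 ->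
  P11 = (g00 * x1 + g10 * y1) * x1 + g0 * x11 + ((g01 * x1 + g11 * y1) * y1 + g1 * y11) ->
  P22 = (g00 * x2 + g10 * y2) * x2 + g0 * x22 + ((g01 * x2 + g11 * y2) * y2 + g1 * y22) ->
  P1 = g0 * x1 + g1 * y1 -> P2 = g0 * x2 + g1 * y2 ->
  P11 + eps * P22 = (x1 ^+ 2 + eps * x2 ^+ 2) * (g00 + eps * g11) /\
  P1 * x1 + eps * (P2 * x2) = (x1 ^+ 2 + eps * x2 ^+ 2) * g0.
Proof. by move=> e1 -> -> -> -> -> -> -> -> ->; case: e1 => ->; split; ring. Qed.

Variables (V W : set 'rV[R]_2) (Phi : 'rV[R]_2 -> 'rV[R]_2).
Local Notation tau := (@t1 R \o Phi).
Local Notation sigma := (@t2 R \o Phi).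
Local Notation D t := (pd 0 tau t ^+ 2 + eps * pd 1 tau t ^+ 2).
Hypotheses (eps1 : eps = 1 \/ eps = -1) (oV : open V) (VW : forall t, V t -> W (Phi t))
  (sPhi : smooth_map_on V Phi)
  (sigma1 : forall t, V t -> pd 0 sigma t = - eps * pd 1 tau t)
  (sigma2 : forall t, V t -> pd 1 sigma t = pd 0 tau t).

Let stau : smooth_on V tau. Proof. exact: sPhi. Qed.
Let ssigma : smooth_on V sigma. Proof. exact: sPhi. Qed.

Lemma partials_comp g : smooth_on W g -> partials V (g \o Phi)
  (fun i t => pd 0 g (Phi t) * pd i tau t + pd 1 g (Phi t) * pd i sigma t).
Proof.
move=> sg t Vt.
have dPhi : differentiable Phi t by apply: differentiable_rV => j; exact: Ck_diff (sPhi j 1%N) Vt.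
have dg : differentiable g (Phi t) by exact: Ck_diff (sg 1%N) (VW Vt).
split=> [|i]; first exact: differentiable_comp.
by rewrite /pd (derive_comp_rV _ dPhi dg) sum2E.
Qed.

Lemma laplacian_tau t : V t -> pd 0 (pd 0 tau) t = - eps * pd 1 (pd 1 tau) t.
Proof.
move=> Vt; rewrite -(pd_on 0 oV Vt sigma2) (pd_comm 0 1 oV (ssigma 2%N) Vt).
rewrite (pd_on 1 oV Vt sigma1).
have Pi : partials V (pd 1 tau) (fun k => pd k (pd 1 tau)).
  by apply: partials_pd => k; exact: Ck_pd (stau k.+1).
by have [_ ->] := partialsM (@partials_cst R 2 V (- eps)) Pi Vt; rewrite mul0r add0r.
Qed.

(** The Cauchy-Riemann equations make [Phi] conformal with factor D: the mixed second derivatives of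
    g cancel, and the first-order terms vanish because tau and sigma are harmonic. *)
Lemma conformal_laplacian g t : smooth_on W g -> V t ->
  pd 0 (pd 0 (g \o Phi)) t + eps * pd 1 (pd 1 (g \o Phi)) t =
    D t * (pd 0 (pd 0 g) (Phi t) + eps * pd 1 (pd 1 g) (Phi t)) /\
  pd 0 (g \o Phi) t * pd 0 tau t + eps * (pd 1 (g \o Phi) t * pd 1 tau t) =
    D t * pd 0 g (Phi t).
Proof.
move=> sg Vt.
have sgi i : smooth_on W (pd i g) by move=> k; exact: Ck_pd (sg k.+1).
have Pt i : partials V (pd i tau) (fun k => pd k (pd i tau)).
  by apply: partials_pd => k; exact: Ck_pd (stau k.+1).
have Ps i : partials V (pd i sigma) (fun k => pd k (pd i sigma)).
  by apply: partials_pd => k; exact: Ck_pd (ssigma k.+1).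
have PP := partials_comp sg.
have P2 i := partialsD (partialsM (partials_comp (sgi 0)) (Pt i)) (partialsM (partials_comp (sgi
  1)) (Ps i)).
have E2 i := pd_partials2 i oV PP (P2 i) Vt.
have [_ E1] := PP t Vt.
have s00 : pd 0 (pd 0 sigma) t = - eps * pd 0 (pd 1 tau) t.
  rewrite (pd_on 0 oV Vt sigma1).
  by have [_ ->] := partialsM (@partials_cst R 2 V (- eps)) (Pt 1) Vt; rewrite mul0r add0r.
have s11 : pd 1 (pd 1 sigma) t = pd 0 (pd 1 tau) t.
  by rewrite (pd_on 1 oV Vt sigma2) (pd_comm 0 1 oV (stau 2%N) Vt).
exact: (conformal_laplacian_algebra eps1 (sigma1 Vt) (sigma2 Vt) s00 s11 (laplacian_tau Vt)
  (E2 0) (E2 1) (E1 0) (E1 1)).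
Qed.

End ConformalLaplacian.

Section PsiEquation.
Variables (R : realType) (eps : R) (V W : set 'rV[R]_2) (Phi Psi : 'rV[R]_2 -> 'rV[R]_2).
Local Notation tau := (@t1 R \o Phi).
Local Notation sigma := (@t2 R \o Phi).
Local Notation D t := (pd 0 tau t ^+ 2 + eps * pd 1 tau t ^+ 2).
Local Notation G t := (tau t `^ (- (1 / 2))).
Variables (E h : 'rV[R]_2 -> R) (mu a2 : R).
Hypotheses (eps1 : eps = 1 \/ eps = -1) (cc : coordinate_change V W Phi Psi)
  (sigma1 : forall t, V t -> pd 0 sigma t = - eps * pd 1 tau t)
  (sigma2 : forall t, V t -> pd 1 sigma t = pd 0 tau t)
  (tau_gt0 : forall t, V t -> 0 < tau t)
  (DG : forall t, V t -> D t * G t = E t) (E0 : forall t, V t -> E t != 0)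
  (sh : smooth_on V h) (mu0 : mu != 0)
  (h_eq : forall t, V t ->
    (E t)^-1 * (- 2 * (pd 0 (pd 0 h) t + eps * pd 1 (pd 1 h) t)
       + 2 / tau t * (pd 0 h t * pd 0 tau t + eps * pd 1 h t * pd 1 tau t)
       - 2 * h t / tau t ^+ 2 * D t)
    + 2 * eps / (mu ^+ 2 * tau t ^+ 2) + 4 * a2 * tau t / mu ^+ 2 = 0).

(* Solves psi * t1 + 4 eps / (9 sqrt t1) = mu^2 h, the required coefficient of
   dz1^2. *)
Definition soliton_psi (y : 'rV[R]_2) : R :=
  (mu ^+ 2 * h (Psi y) - 4 / 9 * eps * t1 y `^ (- (1 / 2))) / t1 y.

Let t1_gt0 y : W y -> 0 < t1 y.
Proof.
by case: cc => _ _ [_ WV] [_ PK] Wy; have := tau_gt0 (WV _ Wy); rewrite /= PK.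
Qed.

Lemma smooth_soliton_psi : smooth_on W soliton_psi.
Proof.
case: cc => -[oV oW] [_ sPsi] [_ WV] _ k.
have st : smooth_on W (@t1 R) by move=> m; exact: Ck_coord.
apply: CkM => //; last by apply: Ck_inv => // y /t1_gt0/lt0r_neq0.
apply: CkB => //; apply: CkM => //; try exact: Ck_cst.
  apply: (@Ck_comp _ _ _ _ _ V h Psi) => // j; exact: sPsi.
by apply: Ck_powR => //; exact: t1_gt0.
Qed.

(** Substitute mu^2 h = psi tau + 4/9 eps tau^(-1/2) into the equation for h. The factor tau solves
    its homogeneous part, so psi is left with its derivatives only; the second summand contributes
    -2 eps / (mu^2 tau^2) and cancels the curvature term. *)
Lemma psi_equation_soliton_psi : psi_equation W eps a2 soliton_psi.
Proof.
move=> y Wy; case: (cc) => -[oV oW] [sPhi sPsi] [VW WV] [PhiK PsiK].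
set t := Psi y; have Vt : V t by exact: WV.
have yE : Phi t = y by exact: PsiK.
have spsi := smooth_soliton_psi.
pose P := soliton_psi \o Phi.
have sP : smooth_on V P.
  by move=> k; apply: (@Ck_comp _ _ _ _ _ W) => [//|//|j|]; [exact: sPhi|exact: spsi].
have stau : smooth_on V tau by exact: sPhi.
have [L1 L2] := conformal_laplacian eps1 oV VW sPhi sigma1 sigma2 spsi Vt.
have taun0 s : V s -> tau s != 0 by move=> /tau_gt0/lt0r_neq0.
have Pc := @partials_cst R 2 V.
have Ptau := partials_pd stau; have PV := partialsV taun0 Ptau; have PP := partials_pd sP.
have Pi g i : smooth_on V g -> partials V (pd i g) (fun k => pd k (pd i g)).
  by move=> sg; apply: partials_pd => k; exact: Ck_pd (sg k.+1).
have PG : partials V (fun s => G s) (fun i s => - 2^-1 * G s * (tau s)^-1 * pd i tau s).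
  apply: (eq_partials oV (partials_powR (- (1 / 2)) tau_gt0 Ptau)) => // s i Vs.
  rewrite powRD; last by apply/implyP => _; exact: taun0.
  rewrite powR_inv1; last exact/ltW/tau_gt0.
  by rewrite -!/(G s) div1r !mulrA.
have hE s : V s -> (P s * tau s + 4 / 9 * eps * G s) * mu ^- 2 = h s.
  move=> Vs; rewrite /P /soliton_psi /= PhiK//.
  move: (taun0 s Vs); move: (h s) (t1 (Phi s) `^ _); rewrite /=; move: (t1 (Phi s)) => a b d a0.
  by field; rewrite a0 mu0.
have Ph := eq_partials oV (partialsM (partialsD (partialsM PP Ptau) (partialsM (Pc (4 / 9 * eps))
  PG))
  (Pc (mu ^- 2))) hE (fun s i Vs => erefl _).
have dPG i := partialsM (partialsM (partialsM (Pc (- 2^-1)) PG) PV) (Pi _ i stau).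
have Ph2 i := partialsD (partialsM (partialsD
    (partialsD (partialsM (Pi _ i sP) Ptau) (partialsM PP (Pi _ i stau)))
    (partialsD (partialsM (Pc 0) PG) (partialsM (Pc (4 / 9 * eps)) (dPG i)))) (Pc (mu ^- 2)))
  (partialsM (partialsD (partialsM PP Ptau) (partialsM (Pc (4 / 9 * eps)) PG)) (Pc 0)).
have E2 i := pd_partials2 i oV Ph (Ph2 i) Vt.
have [_ E1] := Ph t Vt.
have lt := laplacian_tau oV sPhi sigma1 sigma2 Vt.
have G2 : G t ^+ 2 * tau t = 1.
  rewrite expr2 -powRD; last by apply/implyP => _; exact: taun0.
  have -> : - (1 / 2) + - (1 / 2) = - 1 :> R by field.
  by rewrite powR_inv1 ?mulVf ?taun0// ltW// tau_gt0.
have sqrtE : (Num.sqrt (t1 y))^-1 = G t.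
  by rewrite /= yE -powR12_sqrt ?ltW ?t1_gt0// -powRN div1r.
have G0 : G t != 0.
  by apply/eqP => G0; move/eqP: G2; rewrite G0 expr0n mul0r eq_sym oner_eq0.
rewrite sqrtE; have := h_eq Vt; have := DG Vt; have := E0 Vt.
rewrite (E1 0) (E1 1) (E2 0) (E2 1) -(hE t Vt) {E1 E2 Ph Ph2 dPG hE PG PV sqrtE}.
rewrite yE in L1 L2; rewrite -/P in L1 L2; move: L1 L2 lt G2 G0; rewrite /= yE.
move: (pd 0 (pd 0 P) t) (pd 1 (pd 1 P) t) (pd 0 P t) (pd 1 P t) (P t) => P11 P22 P_1 P_2 P_0.
move: (pd 0 (pd 0 tau) t) (pd 1 (pd 1 tau) t) (pd 0 tau t) (pd 1 tau t) => x11 x22 x1 x2.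
move: (pd 0 (pd 0 soliton_psi) y) (pd 1 (pd 1 soliton_psi) y) (pd 0 soliton_psi y) => p00 p11 p_0.
move: (E t) (t1 y) (t1 y `^ _) => e x g L1 L2 -> G2 g0 e0 De heq.
have xE : x = (g ^+ 2)^-1.
  by apply: (mulfI (expf_neq0 2 g0)); rewrite G2 mulfV ?expf_neq0.
have d0 : x1 ^+ 2 + eps * x2 ^+ 2 != 0 by apply: contraNneq e0 => d0; rewrite -De d0 mul0r.
apply: (mulfI d0).
have -> : (x1 ^+ 2 + eps * x2 ^+ 2) * (p00 + eps * p11 + x^-1 * p_0) =
  (x1 ^+ 2 + eps * x2 ^+ 2) * (p00 + eps * p11) + x^-1 * ((x1 ^+ 2 + eps * x2 ^+ 2) * p_0) by ring.
rewrite -L1 -L2; apply/eqP; rewrite -subr_eq0; apply/eqP.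
(* The multiplier is the inverse of - 2 tau / (E mu^2), the coefficient of the Laplacian of psi in
   the equation for h. *)
apply: etrans (etrans (congr1 ( *%R (- (e * mu ^+ 2 / (2 * x)))) heq) (mulr0 _)).
rewrite -De xE {L1 L2 heq De e0 G2 xE}.
by have [e1|e1] := eps1; rewrite !e1 in d0 *; field; rewrite g0 mu0 /=;
  apply: contraNneq d0 => d0; apply/eqP; rewrite -[RHS]d0; ring.
Qed.

End PsiEquation.

(** * Reduction to the normal form *)

Section FibreDirections.
Variable R : realType.

(** The difference quotient is identically zero, so g may be arbitrary, in particular a curvature
    expression whose regularity has not been established. *)
Lemma pd_fibre (g : 'rV[R]_2 -> R) x i : pd (rshift 2 i) (fun y => g (orb y)) x = 0.
Proof.
have E : (fun y => g (orb y)) \o (fun h => h *: delta_mx 0 (rshift 2 i) + x) = fun _ : R => g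
  (orb x).
  apply/funext => h /=; congr g; apply/rowP => j; rewrite !orbE !mxE.
  by rewrite eq_lrshift andbF mulr0 add0r.
rewrite /pd /derive.
have -> : (fun h : R => h^-1 *: (g (orb (h *: delta_mx 0 (rshift 2 i) + x)) - g (orb x))) = fun=> 0.
  apply/funext => h; have /= -> := congr1 (fun F => F h) E.
  by rewrite subrr scaler0.
by apply: cvg_lim => //; exact: cvg_cst.
Qed.

Lemma ball_orb (p x : 'rV[R]_(2 + 2)) r : ball p r x -> ball (orb p) r (orb x).
Proof.
rewrite -!ball_normE/=; apply: le_lt_trans.
apply: rV_norm_le => // j.
by have := coord_norm (p - x) (lshift 2 j); rewrite !mxE.
Qed.

(** In the sup norm a ball is a product, so every point of the orbit ball lifts to the point of the
    ball with the z-coordinates of the centre. *)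
Lemma ball_row_mx (p : 'rV[R]_(2 + 2)) r t : ball (orb p) r t ->
  ball p r (row_mx t (rsubmx p)).
Proof.
rewrite -!ball_normE/= => pt; have r0 : 0 < r by exact: le_lt_trans pt.
rewrite [X in X < _]/Num.Def.normr/= mx_normrE.
apply: bigmax_lt => // -[a j] _ /=; rewrite (ord1 a) !mxE.
case: splitP => k jk.
  have -> : j = lshift 2 k by exact: val_inj.
  apply: le_lt_trans pt; have := coord_norm (orb p - t) k.
  by rewrite !mxE.
have -> : j = rshift 2 k by exact: val_inj.
by rewrite !mxE subrr normr0.
Qed.

Lemma orb_row_mx (t z : 'rV[R]_2) : orb (row_mx t z) = t.
Proof. exact: row_mxKl. Qed.

Lemma ord4 (j : 'I_(2 + 2)) :
  [\/ j = lshift 2 0, j = lshift 2 1, j = rshift 2 0 | j = rshift 2 1].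
Proof.
case: j => [[|[|[|[|//]]]] Hj].
- by apply: Or41; exact: val_inj.
- by apply: Or42; exact: val_inj.
- by apply: Or43; exact: val_inj.
- by apply: Or44; exact: val_inj.
Qed.

End FibreDirections.

(** * Components of the soliton field *)

Section SymmetryOfThePerp.
Variables (R : realType) (U : set 'rV[R]_(2 + 2)) (G : 'rV[R]_(2 + 2) -> 'M[R]_(2 + 2))
  (X : 'rV[R]_(2 + 2) -> 'rV[R]_(2 + 2)) (e : R) (E h q f a : 'rV[R]_2 -> R).
Let M (t : 'rV[R]_2) := adapted_metric (fun t => E t *: mx2 1 0 0 e)
  (null_fibre_metric h q) (shift_form a f) t.
Hypotheses (oU : open U) (GM : forall x, U x -> G x = M (orb x))
  (sf : smooth_on (orbit_space U) f) (sa : smooth_on (orbit_space U) a)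
  (q0 : forall x, U x -> q (orb x) != 0)
  (X_tangent : forall x, U x -> in_leaf (@ddz R) x (X x))
  (X_symmetry : perp_symmetry (@ddz R) U G X).

Local Notation t i := (lshift 2 i).
Local Notation z i := (rshift 2 i).
Local Notation Xz k := (fun y => X y 0 (z k)).

Lemma tangent_components x k : U x -> X x 0 (t k) = 0.
Proof.
move=> /X_tangent; rewrite /in_leaf => /submxP[c ->].
rewrite mxE big1// => i _; rewrite !mxE eq_lrshift andbF mulr0//.
Qed.

(** The horizontal lift of d/dt_i. As f_2^1 = f_2^2 = 0, only the first lift has z-components. *)
Definition perp_field (i : 'I_2) (y : 'rV[R]_(2 + 2)) : 'rV[R]_(2 + 2) :=
  delta_mx 0 (t i) - (i == 0)%:R *: (a (orb y) *: delta_mx 0 (z 0) + f (orb y) *: delta_mx 0 (z 1)).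

Lemma gdot_ddz x v k : U x -> gdot G x v (ddz k x) = \sum_j v 0 j * M (orb x) j (z k).
Proof.
move=> Ux; rewrite /gdot mxE (bigD1 (z k))//= big1 ?addr0 => [|j jk]; last first.
  by rewrite [X in _ * X]mxE [X in _ * X]mxE (negbTE jk) andbF mulr0.
by rewrite [X in _ * X]mxE [X in _ * X]mxE !eqxx mulr1 mxE GM.
Qed.

Lemma perp_field_perp i x : U x -> in_leaf_perp (@ddz R) G x (perp_field i x).
Proof.
move=> Ux k; rewrite gdot_ddz// sum4E !adapted_metricE.
rewrite !mxE /= ?eq_lrshift ?eq_rlshift /= /pexpr_eval.
have [->|->] := ord2 i; have [->|->] := ord2 k; rewrite /metric /symmetric /=; ring.
Qed.

Lemma smooth_perp_field i : smooth_map_on U (perp_field i).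
Proof.
move=> j k.
have sF g : smooth_on (orbit_space U) g -> Ck k U (fun y => g (orb y)).
  by move=> sg; apply: Ck_orb (sg k) => // y Uy; exists y.
apply: (@Ck_on _ _ _ _ (fun y => (delta_mx 0 (t i) : 'rV[R]_(2 + 2)) 0 j
   - (i == 0)%:R * (a (orb y) * (delta_mx 0 (z 0) : 'rV[R]_(2 + 2)) 0 j
                    + f (orb y) * (delta_mx 0 (z 1) : 'rV[R]_(2 + 2)) 0 j))) => //.
  by move=> y _; rewrite !mxE.
apply: CkB => //; first exact: Ck_cst.
apply: CkM => //; first exact: Ck_cst.
by apply: CkD => //; apply: CkM => //; try exact: Ck_cst; exact: sF.
Qed.

(** The bracket of X with a horizontal lift Y_i is tangent to the leaf and orthogonal to it, hence
    zero since q does not vanish. Its z-components are - Y_i X^k. *)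
Lemma symmetry_components x i k : U x ->
  pd (t i) (Xz k) x = (i == 0)%:R * (a (orb x) * pd (z 0) (Xz k) x + f (orb x) * pd (z 1) (Xz k) x).
Proof.
move=> Ux.
set w := lie_bracket X (perp_field i) x.
have wt l : w 0 (t l) = 0.
  rewrite mxE big1// => m _.
  have -> : pd m (fun y => X y 0 (t l)) x = 0.
    rewrite (@pd_on _ _ m U _ (fun=> 0))// ?pd_cst// => y Uy; exact: tangent_components.
  have -> : pd m (fun y => perp_field i y 0 (t l)) x = 0.
    rewrite (@pd_on _ _ m U _ (fun=> (delta_mx 0 (t i) : 'rV[R]_(2 + 2)) 0 (t l)))// ?pd_cst// =>
      y Uy.
    by rewrite !mxE !eq_lrshift !andbF !mulr0 addr0 mulr0 subr0.
  by rewrite !mulr0 subrr.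
have wz l : w 0 (z l) = - (pd (t i) (Xz l) x
    - (i == 0)%:R * (a (orb x) * pd (z 0) (Xz l) x + f (orb x) * pd (z 1) (Xz l) x)).
  have pz m : pd (z m) (fun y => perp_field i y 0 (z l)) x = 0.
    pose g s := (delta_mx 0 (t i) : 'rV[R]_(2 + 2)) 0 (z l) - (i == 0)%:R *
      (a s * (delta_mx 0 (z 0) : 'rV[R]_(2 + 2)) 0 (z l)
       + f s * (delta_mx 0 (z 1) : 'rV[R]_(2 + 2)) 0 (z l)).
    have -> : (fun y => perp_field i y 0 (z l)) = (fun y => g (orb y)).
      by apply/funext => y; rewrite /g !mxE.
    exact: pd_fibre.
  have -> : w 0 (z l) = - \sum_m perp_field i x 0 m * pd m (Xz l) x.
    rewrite /w mxE -sumrN; apply: eq_bigr => m _.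
    suff -> : X x 0 m * pd m (fun y => perp_field i y 0 (z l)) x = 0 by rewrite sub0r.
    have [e1|e1|e1|e1] := ord4 m; rewrite e1.
    - by rewrite tangent_components// mul0r.
    - by rewrite tangent_components// mul0r.
    - by rewrite pz mulr0.
    - by rewrite pz mulr0.
  congr (- _); rewrite sum4E.
  have pt k' : perp_field i x 0 (t k') = (k' == i)%:R.
    by rewrite !mxE ?eq_lrshift /= (inj_eq (@lshift_inj _ _)) !mulr0 addr0 mulr0 subr0.
  have p2 : perp_field i x 0 (z 0) = - ((i == 0)%:R * a (orb x)).
    by rewrite !mxE ?eq_rlshift ?(inj_eq (@rshift_inj _ _)) /=; ring.
  have p3 : perp_field i x 0 (z 1) = - ((i == 0)%:R * f (orb x)).
    by rewrite !mxE ?eq_rlshift ?(inj_eq (@rshift_inj _ _)) /=; ring.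
  rewrite !pt p2 p3.
  move: (pd (z 0) _ _) (pd (z 1) _ _) (a (orb x)) (f (orb x)) => c1 c2 c3 c4.
  have [->|->] := ord2 i.
    by move: (pd (t 0) _ _) (pd (t 1) _ _) => c5 c6; rewrite /=; ring.
  by move: (pd (t 0) _ _) (pd (t 1) _ _) => c5 c6; rewrite /=; ring.
have perp := X_symmetry (smooth_perp_field i) (perp_field_perp i) Ux.
have w0 : w 0 (z 0) = 0.
  have := perp 1; rewrite gdot_ddz// sum4E !wt !mul0r !add0r !adapted_metricE /pexpr_eval /metric
    /symmetric /=.
  by rewrite mulr0 addr0 => /eqP; rewrite mulf_eq0 (negbTE (q0 Ux)) orbF => /eqP.
have w1 : w 0 (z 1) = 0.
  have := perp 0; rewrite gdot_ddz// sum4E !wt !mul0r !add0r !adapted_metricE /pexpr_eval /metric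
    /symmetric /=.
  by rewrite w0 mul0r add0r => /eqP; rewrite mulf_eq0 (negbTE (q0 Ux)) orbF => /eqP.
have wk : w 0 (z k) = 0 by have [->|->] := ord2 k.
by move: wk; rewrite wz => /eqP; rewrite oppr_eq0 subr_eq0 => /eqP.
Qed.

End SymmetryOfThePerp.

Section FibreField.
Variables (R : realType) (U : set 'rV[R]_(2 + 2)) (X : 'rV[R]_(2 + 2) -> 'rV[R]_(2 + 2))
  (f a : 'rV[R]_2 -> R).
Local Notation t i := (@lshift 2 2 i).
Local Notation z i := (@rshift 2 2 i).
Local Notation Xz k := (fun y => X y 0 (z k)).
Hypotheses (oU : open U)
  (sf : smooth_on (orbit_space U) f) (sa : smooth_on (orbit_space U) a)
  (f_t2 : forall x, U x -> pd 1 f (orb x) != 0)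
  (a_t2 : forall x, U x -> pd 1 a (orb x) = 0)
  (sX : smooth_map_on U X)
  (X_sym : forall x i k, U x -> pd (t i) (Xz k) x =
    (i == 0)%:R * (a (orb x) * pd (z 0) (Xz k) x + f (orb x) * pd (z 1) (Xz k) x)).

Let OU x : U x -> orbit_space U (orb x). Proof. by exists x. Qed.

(** Differentiate the equation for the t1-derivative of X^k along t2. As X^k and [a] do not depend
    on t2, only the derivative of f times the z2-derivative of X^k survives, and the former is
    nonzero. *)
Lemma fibre_derivatives x k : U x -> [/\ pd (t 1) (Xz k) x = 0, pd (z 1) (Xz k) x = 0 &
  pd (t 0) (Xz k) x = a (orb x) * pd (z 0) (Xz k) x].
Proof.
move=> Ux.
have D1 y : U y -> pd (t 1) (Xz k) y = 0 by move=> Uy; rewrite X_sym// mul0r.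
have D0 y : U y -> pd (t 0) (Xz k) y = a (orb y) * pd (z 0) (Xz k) y + f (orb y) * pd (z 1) (Xz
  k) y.
  by move=> Uy; rewrite X_sym// mul1r.
have dX i : pd (t 1) (pd i (Xz k)) x = 0.
  apply: etrans (pd_comm (t 1) i oU (sX (z k) 2%N) Ux) _.
  by apply: etrans (pd_on i oU Ux D1) _; exact: pd_cst.
have sorb g : smooth_on (orbit_space U) g -> smooth_on U (fun y => g (orb y)).
  by move=> sg m; apply: Ck_orb (sg m).
have PX i : partials U (pd i (Xz k)) (fun j => pd j (pd i (Xz k))).
  by apply: partials_pd => m; exact: Ck_pd (sX (z k) m.+1).
have [_ /(_ (t 1)) H] := partialsD (partialsM (partials_pd (sorb _ sa)) (PX (z 0)))
  (partialsM (partials_pd (sorb _ sf)) (PX (z 1))) Ux.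
have {}H := etrans (etrans (esym (dX (t 0))) (pd_on (t 1) oU Ux D0)) H.
have orb1 g : smooth_on (orbit_space U) g -> pd (t 1) (fun y => g (orb y)) x = pd 1 g (orb x).
  by move=> sg; apply: pd_orb_lshift; apply: Ck_diff (sg 1%N) (OU Ux).
have z1 : pd (z 1) (Xz k) x = 0.
  have {}H : pd 1 f (orb x) * pd (z 1) (Xz k) x = 0.
    apply: etrans (esym H); apply/esym.
    apply: etrans (congr2 +%R (congr2 +%R (congr1 ( *%R^~ _) (etrans (orb1 _ sa) (a_t2 Ux)))
      (congr1 ( *%R _) (dX (z 0)))) (congr2 +%R (congr1 ( *%R^~ _) (orb1 _ sf))
      (congr1 ( *%R _) (dX (z 1))))) _.
    by rewrite mul0r !mulr0 addr0 add0r addr0.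
  by move/eqP: H; rewrite mulf_eq0 (negbTE (f_t2 Ux)) => /eqP.
split=> //; first exact: D1.
by rewrite D0// z1 mulr0 addr0.
Qed.

Variables (G : 'rV[R]_(2 + 2) -> 'M[R]_(2 + 2)) (e : R) (E h q : 'rV[R]_2 -> R).
Let M (t : 'rV[R]_2) := adapted_metric (fun t => E t *: mx2 1 0 0 e)
  (null_fibre_metric h q) (shift_form a f) t.
Variable O : set 'rV[R]_2.
Hypotheses (GM : forall x, U x -> G x = M (orb x)) (e2 : e * e = 1) (oO : open O)
  (UO : forall x, U x -> O (orb x)) (sO : orbit_space U `<=` O)
  (sE : smooth_on O E) (sq : smooth_on O q) (sh : smooth_on O h)
  (sf' : smooth_on O f) (sa' : smooth_on O a)
  (E0 : forall t, O t -> E t != 0) (q0 : forall t, O t -> q t != 0)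
  (aO_t2 : forall t, O t -> pd 1 a t = 0)
  (X_t : forall x k, U x -> X x 0 (t k) = 0)
  (soliton : forall x, U x -> ricci G x + 2^-1 *: lie_metric X G x = 0).

(** The coordinate components of the soliton equation form a triangular system for the frame
    components: the fibre ones are isolated first, and their multiples by a and f are then removed
    from the others. *)
Lemma soliton_equations x : U x ->
  let ev := pexpr_eval (env e E q h f a (orb x)) in
  let A k := pd (z 0) (Xz k) x in
  [/\ [/\ ev (ricYY 0 0) = 0, ev (ricYY 0 1) = 0 & ev (ricYY 1 1) = 0],
      ev (ricYz 0) = 0 /\ ev (ricYz 1) = 0,
      ev riczz + 4 * (h (orb x) * A 0 + q (orb x) * A 1) = 0 &
      ev ricz12 + 2 * (q (orb x) * A 0) = 0].
Proof.
move=> Ux ev A.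
have sM i j : smooth_on [set orb x | x in U] (fun t => M t i j).
  by move=> k; apply: (@Ck_sub _ _ _ O) => //; exact: smooth_adapted_metric.
have S (i j : 'I_(2 + 2)) : ev (ricci_expr i j) + 2 * \sum_k
    (ev (metric (z k) j) * pd i (Xz k) x + ev (metric i (z k)) * pd j (Xz k) x) = 0.
  have R4 : 4 * ricci G x i j = ev (ricci_expr i j).
    exact: (ricci_adapted e2 oO sE sq sh sf' sa' E0 q0 aO_t2 oU UO GM).
  rewrite -R4 {R4}.
  have /matrixP/(_ i j) := soliton Ux; rewrite mxE [X in _ + X]mxE [in RHS]mxE.
  rewrite (@lie_metric_tangent _ U G M)// => H.
  have mE k l : G x k l = ev (metric k l) by rewrite GM//; exact: adapted_metricE.
  under eq_bigr => k _ do rewrite -!mE.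
  apply: (etrans _ (etrans (congr1 ( *%R 4) H) (mulr0 _))).
  by move: (ricci _ _ _ _) (\sum_ _ _) => u v; field.
have F k := fibre_derivatives k Ux.
have F1 k : pd (t 1) (Xz k) x = 0 by case: (F k).
have F3 k : pd (z 1) (Xz k) x = 0 by case: (F k).
have F0 k : pd (t 0) (Xz k) x = a (orb x) * A k by case: (F k).
have F2 k : pd (z 0) (Xz k) x = A k by [].
have S00 := S (t 0) (t 0); have S01 := S (t 0) (t 1); have S02 := S (t 0) (z 0).
have S11 := S (t 1) (t 1); have S12 := S (t 1) (z 0); have S22 := S (z 0) (z 0); have S23 := S (z
  0) (z 1).
clear S; rewrite sum2E !F0 in S00.
rewrite sum2E !F0 !F1 in S01.
rewrite sum2E !F0 !F2 in S02.
rewrite sum2E !F1 in S11.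
rewrite sum2E !F1 !F2 in S12.
rewrite sum2E !F2 in S22.
rewrite sum2E !F2 !F3 in S23.
move: (A 0) (A 1) S00 S01 S02 S11 S12 S22 S23 => A0 A1.
have ev00 : ev (ricci_expr 0 0) = ev (ricYY 0 0) + (a (orb x) * ev (ricYz 0) + a (orb x) * ev
  (ricYz 0))
  + a (orb x) * a (orb x) * ev riczz + (a (orb x) * f (orb x) * ev ricz12 + a (orb x) * f (orb x)
    * ev ricz12) by [].
have ev01 : ev (ricci_expr 0 1) = ev (ricYY 0 1) + a (orb x) * ev (ricYz 1) by [].
have ev02 : ev (ricci_expr 0 2) = ev (ricYz 0) + a (orb x) * ev riczz + f (orb x) * ev ricz12 by [].
rewrite -[ev (ricci_expr (t 0) (t 0))]/(ev (ricci_expr 0 0)) ev00.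
rewrite -[ev (ricci_expr (t 0) (t 1))]/(ev (ricci_expr 0 1)) ev01.
rewrite -[ev (ricci_expr (t 0) (z 0))]/(ev (ricci_expr 0 2)) ev02.
rewrite -[ev (ricci_expr (t 1) (t 1))]/(ev (ricYY 1 1)).
rewrite -[ev (ricci_expr (t 1) (z 0))]/(ev (ricYz 1)).
rewrite -[ev (ricci_expr (z 0) (z 0))]/(ev riczz).
rewrite -[ev (ricci_expr (z 0) (z 1))]/(ev ricz12).
have m02 : ev (metric (t 0) (z 0)) = h (orb x) * a (orb x) + q (orb x) * f (orb x) by [].
have m20 : ev (metric (z 0) (t 0)) = h (orb x) * a (orb x) + q (orb x) * f (orb x) by [].
have m03 : ev (metric (t 0) (z 1)) = q (orb x) * a (orb x) by [].
have m30 : ev (metric (z 1) (t 0)) = q (orb x) * a (orb x) by [].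
have m22 : ev (metric (z 0) (z 0)) = h (orb x) by [].
have m23 : ev (metric (z 0) (z 1)) = q (orb x) by [].
have m32 : ev (metric (z 1) (z 0)) = q (orb x) by [].
have m33 : ev (metric (z 1) (z 1)) = 0 by [].
have m12 k : ev (metric (t 1) (z k)) = 0 by have [->|->] := ord2 k.
have m21 k : ev (metric (z k) (t 1)) = 0 by have [->|->] := ord2 k.
rewrite ?m02 ?m20 ?m03 ?m30 ?m22 ?m23 ?m32 ?m33 ?m12 ?m21.
move: (ev (ricYY 0 0)) (ev (ricYY 0 1)) (ev (ricYY 1 1)) (ev (ricYz 0)) (ev (ricYz 1)) (ev riczz)
  (ev ricz12).
move: (a (orb x)) (f (orb x)) (h (orb x)) (q (orb x)).
clear => a f h q y00 y01 y11 yz0 yz1 zz z12 S00 S01 S02 S11 S12 S22 S23.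
have Z23 : z12 + 2 * (q * A0) = 0 by rewrite -[RHS]S23; ring.
have Z22 : zz + 4 * (h * A0 + q * A1) = 0 by rewrite -[RHS]S22; ring.
have Z12 : yz1 = 0 by rewrite -[RHS]S12; ring.
have Z02 : yz0 = 0.
  have : yz0 + a * (zz + 4 * (h * A0 + q * A1)) + f * (z12 + 2 * (q * A0)) = 0.
    by rewrite -[RHS]S02; ring.
  by rewrite Z22 Z23 !mulr0 !addr0.
split=> //; split.
- have : y00 + (a * yz0 + a * yz0) + a * a * (zz + 4 * (h * A0 + q * A1))
    + 2 * a * f * (z12 + 2 * (q * A0)) = 0 by rewrite -[RHS]S00; ring.
  by rewrite Z22 Z23 Z02 !mulr0 !addr0.
- by have := S01; rewrite Z12 !(mulr0, mul0r, addr0).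
- by rewrite -[RHS]S11; ring.
Qed.

End FibreField.

(** * The soliton equation as a system on the orbit space *)

Section OrbitEquationsFromRicci.
Variable R : realType.

(** The numbers k0 and k1 stand for the z1-derivatives of the components of X. The Laplacian of q
    comes from [ricz12], that of E from [ricYY 0 0] plus e times [ricYY 1 1]; with these, [ricYY]
    determines the whole Hessian of q. The factor passed to [mulfI] is each time the coefficient of
    the leading derivative in the curvature component. *)
Lemma orbit_equations (e E q E1 E2 E11 E12 E22 q1 q2 q11 q12 q22 h h1 h2 h11 h12 h22 f f1 f2 f11
  f12 f22
    a a1 a11 k0 k1 : R) :
  e = 1 \/ e = -1 -> E != 0 -> q != 0 ->
  let ev := pexpr_eval [:: e; E; E^-1; q; q^-1; E1; E2; E11; E12; E22; q1; q2; q11; q12; q22;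
    h; h1; h2; h11; h12; h22; f; f1; f2; f11; f12; f22; a; a1; a11] in
  [/\ [/\ ev (ricYY 0 0) = 0, ev (ricYY 0 1) = 0 & ev (ricYY 1 1) = 0],
      ev (ricYz 0) = 0 /\ ev (ricYz 1) = 0, ev riczz + 4 * (h * k0 + q * k1) = 0 &
      ev ricz12 + 2 * (q * k0) = 0] ->
  [/\ [/\ 4 * q11 = 2 * (k0 * q * E) + (2 * (E1 * q1 - e * E2 * q2) / E + (q1 ^+ 2 - e * q2 ^+ 2)
    / q),
          4 * q12 = 2 * (E2 * q1 + E1 * q2) / E + 2 * q1 * q2 / q &
          4 * q22 = e * (2 * (k0 * q * E) - (2 * (E1 * q1 - e * E2 * q2) / E + (q1 ^+ 2 - e * q2
            ^+ 2) / q))],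
      E11 + e * E22 = (E1 ^+ 2 + e * E2 ^+ 2) / E - k0 * E ^+ 2 + E * (q1 ^+ 2 + e * q2 ^+ 2) /
        (2 * q ^+ 2),
      2 * q * q1 * f2 + q ^+ 2 * f12 = q ^+ 2 * f2 * E1 / E /\
      2 * q * q2 * f2 + q ^+ 2 * f22 = q ^+ 2 * f2 * E2 / E &
      E^-1 * (- 2 * (h11 + e * h22) + 2 / q * (h1 * q1 + e * h2 * q2)
        - 2 * h / q ^+ 2 * (q1 ^+ 2 + e * q2 ^+ 2)) + 2 * e * (q * f2 / E) ^+ 2
      + 4 * (h * k0 + q * k1) = 0].
Proof.
move=> e1 E0 q0 ev; rewrite /ev /pexpr_eval /= => {ev}.
case=> -[Y00 Y01 Y11] [Z0 Z1] Z Z12.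
have L : q11 + e * q22 = k0 * q * E.
  apply/eqP; rewrite -subr_eq0 -(mulrI_eq0 _ (mulfI (_ : - 2 / E != 0))) ?mulf_neq0 ?oppr_eq0
    ?invr_eq0 ?pnatr_eq0//.
  by apply/eqP; rewrite -[RHS]Z12; field.
have tr : E11 + e * E22 = (E1 ^+ 2 + e * E2 ^+ 2) / E - k0 * E ^+ 2 + E * (q1 ^+ 2 + e * q2 ^+ 2)
  / (2 * q ^+ 2).
  apply/eqP; rewrite -subr_eq0 -(mulrI_eq0 _ (mulfI (_ : - 4 / E != 0))) ?mulf_neq0 ?oppr_eq0
    ?invr_eq0 ?pnatr_eq0//.
  have q11E : q11 = k0 * q * E - e * q22 by rewrite -L; ring.
  apply/eqP; rewrite -[RHS]addr0 -{1}Y00 -(mulr0 e) -Y11 q11E.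
  by case: e1 => ->; field; rewrite E0 q0.
have E11E : E11 = (E1 ^+ 2 + e * E2 ^+ 2) / E - k0 * E ^+ 2 + E * (q1 ^+ 2 + e * q2 ^+ 2) / (2 *
  q ^+ 2) - e * E22.
  by rewrite -tr; ring.
split; [split| |split|] => //.
- apply/eqP; rewrite -subr_eq0 -(mulrI_eq0 _ (mulfI (_ : - q^-1 != 0))) ?oppr_eq0 ?invr_eq0//.
  apply/eqP; rewrite -[RHS]Y00 E11E.
  by case: e1 => ->; field; rewrite E0 q0.
- apply/eqP; rewrite -subr_eq0 -(mulrI_eq0 _ (mulfI (_ : - q^-1 != 0))) ?oppr_eq0 ?invr_eq0//.
  by apply/eqP; rewrite -[RHS]Y01; field; rewrite E0 q0.
- apply/eqP; rewrite -subr_eq0 -(mulrI_eq0 _ (mulfI (_ : - q^-1 != 0))) ?oppr_eq0 ?invr_eq0//.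
  apply/eqP; rewrite -[RHS]Y11 E11E.
  by case: e1 => ->; field; rewrite E0 q0.
- apply/eqP; rewrite -subr_eq0 -(mulrI_eq0 _ (mulfI (_ : 2 / (q * E) != 0))) ?mulf_neq0 ?invr_eq0
  ?mulf_neq0 ?pnatr_eq0//.
  by apply/eqP; rewrite -[RHS]Z1; field; rewrite E0 q0.
- apply/eqP; rewrite -subr_eq0 -(mulrI_eq0 _ (mulfI (_ : - e * 2 / (q * E) != 0))).
    by apply/eqP; rewrite -[RHS]Z0; field; rewrite E0 q0.
  rewrite ?mulf_neq0 ?invr_eq0 ?mulf_neq0 ?pnatr_eq0 ?oppr_eq0//.
  by case: e1 => ->; rewrite ?oppr_eq0 oner_eq0.
- by rewrite -[RHS]Z; field; rewrite E0 q0.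
Qed.

End OrbitEquationsFromRicci.

Section SolitonOnBall.
Variables (R : realType) (p : 'rV[R]_(2 + 2)) (r : R) (X : 'rV[R]_(2 + 2) -> 'rV[R]_(2 + 2))
  (G : 'rV[R]_(2 + 2) -> 'M[R]_(2 + 2)) (e : R) (E h q f a : 'rV[R]_2 -> R).
Local Notation t i := (@lshift 2 2 i).
Local Notation z i := (@rshift 2 2 i).
Local Notation Xz k := (fun y => X y 0 (z k)).
Local Notation U := (ball p r).
Local Notation O := (ball (orb p) r).
Let M (t : 'rV[R]_2) := adapted_metric (fun t => E t *: mx2 1 0 0 e)
  (null_fibre_metric h q) (shift_form a f) t.
Hypotheses (r0 : 0 < r) (e1 : e = 1 \/ e = -1)
  (sE : smooth_on O E) (sq : smooth_on O q) (sh : smooth_on O h)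
  (sf : smooth_on O f) (sa : smooth_on O a)
  (E0 : forall t, O t -> E t != 0) (q0 : forall t, O t -> q t != 0)
  (a_t2 : forall t, O t -> pd 1 a t = 0) (f_t2 : forall t, O t -> pd 1 f t != 0)
  (sX : smooth_map_on U X)
  (X_t : forall x k, U x -> X x 0 (t k) = 0)
  (X_sym : forall x i k, U x -> pd (t i) (Xz k) x =
    (i == 0)%:R * (a (orb x) * pd (z 0) (Xz k) x + f (orb x) * pd (z 1) (Xz k) x))
  (GM : forall x, U x -> G x = M (orb x))
  (soliton : forall x, U x -> ricci G x + 2^-1 *: lie_metric X G x = 0).

Let oU : open U. Proof. exact: ball_open. Qed.
Let oO : open O. Proof. exact: ball_open. Qed.
Let sO : orbit_space U `<=` O. Proof. by move=> _ [x Ux <-]; exact: ball_orb. Qed.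
Let OU x : U x -> O (orb x). Proof. exact: ball_orb. Qed.
Let sub g : smooth_on O g -> smooth_on (orbit_space U) g.
Proof. by move=> sg k; exact: Ck_sub (sg k). Qed.
Let e2 : e * e = 1. Proof. by case: e1 => ->; rewrite ?mulrNN mulr1. Qed.

Lemma ball_derivatives x k : U x -> [/\ pd (t 1) (Xz k) x = 0, pd (z 1) (Xz k) x = 0 &
  pd (t 0) (Xz k) x = a (orb x) * pd (z 0) (Xz k) x].
Proof.
move=> Ux; apply: (@fibre_derivatives R U X f a oU (sub sf) (sub sa)) => //.
- by move=> y /OU/f_t2.
- by move=> y /OU/a_t2.
Qed.

Let equations x (Ux : U x) := soliton_equations oU (sub sf) (sub sa) (fun y Uy => f_t2 (OU Uy))
  (fun y Uy => a_t2 (OU Uy)) sX X_sym GM e2 oO OU sO sE sq sh sf sa E0 q0 a_t2 X_t soliton Ux.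

(** Both slopes are functions of the orbit, so their z-derivatives vanish. Exchanging derivatives,
    the t1-derivative of a slope is a multiple of its z1-derivative, and the t2-derivative is zero
    as X^k does not depend on t2. *)
Lemma slope_constant x k : U x -> pd (z 0) (Xz k) x = pd (z 0) (Xz k) p.
Proof.
move=> Ux.
pose ev t := pexpr_eval (env e E q h f a t).
pose g0 t := - (ev t ricz12 / (2 * q t)).
pose g1 t := - ((ev t riczz / 4 + h t * g0 t) / q t).
have slope0 y : U y -> pd (z 0) (Xz 0) y = g0 (orb y).
  move=> Uy; have [_ _ _] := equations Uy; have := q0 (OU Uy).
  rewrite /g0 /ev; move: (pd _ _ _) (pexpr_eval _ _) (q _) => A v w w0 H.
  have -> : v = - (2 * (w * A)) by rewrite -[LHS]addr0 -(subrr (2 * (w * A))) addrA H sub0r.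
  by field.
have slope1 y : U y -> pd (z 0) (Xz 1) y = g1 (orb y).
  move=> Uy; have [_ _ + _] := equations Uy; have := q0 (OU Uy).
  rewrite /g1 slope0// /ev; move: (pd _ _ _) (pexpr_eval _ _) (q _) (g0 _) (h _) => A v w g b w0 H.
  have -> : v = - (4 * (b * g + w * A)) by rewrite -[LHS]addr0 -(subrr (4 * (b * g + w * A)))
    addrA H sub0r.
  by field.
have slopez y i : U y -> pd (z i) (pd (z 0) (Xz k)) y = 0.
  move=> Uy; have [->|->] := ord2 k.
    by apply: etrans (pd_on (z i) oU Uy slope0) _; exact: pd_fibre.
  by apply: etrans (pd_on (z i) oU Uy slope1) _; exact: pd_fibre.
apply: (@cst_on_ball _ _ (pd (z 0) (Xz k)) p r x) => // [y Uy|y i Uy].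
  exact: Ck_diff (Ck_pd _ (sX (z k) 2%N)) Uy.
have swap i' : pd i' (pd (z 0) (Xz k)) y = pd (z 0) (pd i' (Xz k)) y.
  exact: pd_comm oU (sX (z k) 2%N) Uy.
have [->|->|->|->] := ord4 i; [| |exact: slopez|exact: slopez].
- rewrite swap.
  have D0 y' : U y' -> pd (t 0) (Xz k) y' = a (orb y') * pd (z 0) (Xz k) y'.
    by move=> Uy'; case: (ball_derivatives k Uy').
  apply: etrans (pd_on (z 0) oU Uy D0) _.
  have Pa : partials U (fun y => a (orb y)) (fun i => pd i (fun y => a (orb y))).
    by apply: partials_pd => m; apply: Ck_orb (sa m).
  have PX : partials U (pd (z 0) (Xz k)) (fun i => pd i (pd (z 0) (Xz k))).
    by apply: partials_pd => m; exact: Ck_pd (sX (z k) m.+1).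
  have [_ /(_ (z 0)) H] := partialsM Pa PX Uy.
  apply: etrans H _; apply: etrans (congr2 +%R (congr1 ( *%R^~ _) (pd_fibre a y 0)) (congr1 ( *%R
    _) (slopez y 0 Uy))) _.
  by rewrite mul0r mulr0 addr0.
- rewrite swap.
  have D0 y' : U y' -> pd (t 1) (Xz k) y' = 0 by move=> Uy'; case: (ball_derivatives k Uy').
  by apply: etrans (pd_on (z 0) oU Uy D0) _; exact: pd_cst.
Qed.

Local Notation k0 := (pd (z 0) (Xz 0) p).
Local Notation k1 := (pd (z 0) (Xz 1) p).

Lemma orbit_equations_on_ball s : O s -> let E1 := pd 0 E s in let E2 := pd 1 E s in
  let q1 := pd 0 q s in let q2 := pd 1 q s in
  [/\ [/\ 4 * pd 0 (pd 0 q) s = 2 * (k0 * q s * E s)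
          + (2 * (E1 * q1 - e * E2 * q2) / E s + (q1 ^+ 2 - e * q2 ^+ 2) / q s),
          4 * pd 0 (pd 1 q) s = 2 * (E2 * q1 + E1 * q2) / E s + 2 * q1 * q2 / q s &
          4 * pd 1 (pd 1 q) s = e * (2 * (k0 * q s * E s)
          - (2 * (E1 * q1 - e * E2 * q2) / E s + (q1 ^+ 2 - e * q2 ^+ 2) / q s))],
      pd 0 (pd 0 E) s + e * pd 1 (pd 1 E) s = (E1 ^+ 2 + e * E2 ^+ 2) / E s - k0 * E s ^+ 2
        + E s * (q1 ^+ 2 + e * q2 ^+ 2) / (2 * q s ^+ 2),
      2 * q s * q1 * pd 1 f s + q s ^+ 2 * pd 0 (pd 1 f) s = q s ^+ 2 * pd 1 f s * E1 / E s /\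
      2 * q s * q2 * pd 1 f s + q s ^+ 2 * pd 1 (pd 1 f) s = q s ^+ 2 * pd 1 f s * E2 / E s &
      (E s)^-1 * (- 2 * (pd 0 (pd 0 h) s + e * pd 1 (pd 1 h) s)
        + 2 / q s * (pd 0 h s * q1 + e * pd 1 h s * q2)
        - 2 * h s / q s ^+ 2 * (q1 ^+ 2 + e * q2 ^+ 2)) + 2 * e * (q s * pd 1 f s / E s) ^+ 2
      + 4 * (h s * k0 + q s * k1) = 0].
Proof.
move=> Os; have Ux := ball_row_mx Os.
set x := row_mx s _ in Ux; have ox : orb x = s by exact: orb_row_mx.
have := equations Ux; cbv zeta beta; rewrite !(slope_constant _ Ux) ox.
exact: orbit_equations e1 (E0 Os) (q0 Os).
Qed.

End SolitonOnBall.

(** * Lifting a change of orbit coordinates to the fibres *)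

Section FibredCoordinates.
Variables (R : realType) (V2 W2 : set 'rV[R]_2) (Phi2 Psi2 : 'rV[R]_2 -> 'rV[R]_2)
  (F S : 'rV[R]_2 -> R) (mu nu : R) (V : set 'rV[R]_(2 + 2)).
Local Notation t i := (@lshift 2 2 i).
Local Notation z i := (@rshift 2 2 i).
Hypotheses (cc : coordinate_change V2 W2 Phi2 Psi2) (sF : smooth_on V2 F) (sS : smooth_on V2 S)
  (mu0 : mu != 0) (nu0 : nu != 0) (oV : open V) (VV2 : forall x, V x -> V2 (orb x)).

(** On each leaf the map is affine in (z1, z2) with constant linear part, as an adapted change
    requires; F and S displace the origin from leaf to leaf. *)
Definition fibred_map (x : 'rV[R]_(2 + 2)) : 'rV[R]_(2 + 2) :=
  row_mx (Phi2 (orb x)) (pt ((x 0 (z 0) + F (orb x)) / mu) (nu * x 0 (z 1) + S (orb x))).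

Definition fibred_inverse (y : 'rV[R]_(2 + 2)) : 'rV[R]_(2 + 2) :=
  row_mx (Psi2 (orb y)) (pt (mu * y 0 (z 0) - F (Psi2 (orb y)))
    (nu^-1 * (y 0 (z 1) - S (Psi2 (orb y))))).

(** The image of V, written as a preimage under the inverse map so that its openness follows from
    continuity. *)
Definition fibred_image : set 'rV[R]_(2 + 2) := [set y | W2 (orb y) /\ V (fibred_inverse y)].

Let smooth_pull U O g : open U -> (forall x : 'rV[R]_(2 + 2), U x -> O (orb x)) -> smooth_on O g ->
  smooth_on U (fun x => g (orb x)).
Proof. by move=> oU UO sg k; exact: Ck_orb (sg k). Qed.

Lemma smooth_fibred_map : smooth_map_on V fibred_map.
Proof.
case: (cc) => -[oV2 oW2] [sPhi sPsi] _ _ j k.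
have lift g : smooth_on V2 g -> Ck k V (fun x => g (orb x)) by move=> sg; exact: smooth_pull sg k.
have [->|->|->|->] := ord4 j.
- apply: (@Ck_on _ _ _ _ (fun x => Phi2 (orb x) 0 0)) => // [x _|]; first by rewrite row_mxEl.
  exact: (lift (fun t => Phi2 t 0 0)).
- apply: (@Ck_on _ _ _ _ (fun x => Phi2 (orb x) 0 1)) => // [x _|]; first by rewrite row_mxEl.
  exact: (lift (fun t => Phi2 t 0 1)).
- apply: (@Ck_on _ _ _ _ (fun x => (x 0 (z 0) + F (orb x)) / mu)) => // [x _|]; first by rewrite
  row_mxEr pt0.
  apply: CkM => //; last exact: Ck_cst.
  by apply: CkD => //; [exact: Ck_coord|exact: lift].
- apply: (@Ck_on _ _ _ _ (fun x => nu * x 0 (z 1) + S (orb x))) => // [x _|]; first by rewrite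
  row_mxEr pt1.
  apply: CkD => //; last exact: lift.
  by apply: CkM => //; [exact: Ck_cst|exact: Ck_coord].
Qed.

Let W' := [set y | W2 (orb y)].
Let oW' : open W'. Proof. by apply: open_orb_preimage; case: cc => -[]. Qed.

Lemma smooth_fibred_inverse : smooth_map_on [set y | W2 (orb y)] fibred_inverse.
Proof.
case: (cc) => -[oV2 oW2] [sPhi sPsi] [_ WV] _ j k.
have lift g : smooth_on W2 g -> Ck k W' (fun x => g (orb x)) by move=> sg; exact: (@smooth_pull _
  W2 _ _ _ sg k).
have comp g : smooth_on V2 g -> smooth_on W2 (fun y => g (Psi2 y)).
  by move=> sg m; apply: (@Ck_comp _ _ _ _ _ V2 g Psi2) => // i; exact: sPsi.
have [->|->|->|->] := ord4 j.
- apply: (@Ck_on _ _ _ _ (fun x => Psi2 (orb x) 0 0)) => // [x _|]; first by rewrite row_mxEl.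
  exact: (lift (fun t => Psi2 t 0 0)).
- apply: (@Ck_on _ _ _ _ (fun x => Psi2 (orb x) 0 1)) => // [x _|]; first by rewrite row_mxEl.
  exact: (lift (fun t => Psi2 t 0 1)).
- apply: (@Ck_on _ _ _ _ (fun y => mu * y 0 (z 0) - F (Psi2 (orb y)))) => // [x _|]; first by
  rewrite row_mxEr pt0.
  apply: CkB => //; last by apply: (lift (fun y => F (Psi2 y))); exact: comp.
  by apply: CkM => //; [exact: Ck_cst|exact: Ck_coord].
- apply: (@Ck_on _ _ _ _ (fun y => nu^-1 * (y 0 (z 1) - S (Psi2 (orb y))))) => // [x _|]; first
  by rewrite row_mxEr pt1.
  apply: CkM => //; first exact: Ck_cst.
  by apply: CkB => //; [exact: Ck_coord|apply: (lift (fun y => S (Psi2 y))); exact: comp].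
Qed.

Lemma differentiable_fibred_inverse y : W2 (orb y) -> differentiable fibred_inverse y.
Proof.
by move=> Wy; apply: differentiable_rV => j; apply: Ck_diff (smooth_fibred_inverse j 1%N) _.
Qed.

Lemma fibred_mapK x : V x -> fibred_inverse (fibred_map x) = x.
Proof.
case: (cc) => _ _ _ [PK _] Vx.
apply/rowP => j; rewrite /fibred_inverse orb_row_mx (PK _ (VV2 Vx)).
have [->|->|->|->] := ord4 j.
- by rewrite row_mxEl orbE.
- by rewrite row_mxEl orbE.
- by rewrite !row_mxEr !pt0; field.
- by rewrite !row_mxEr !pt1; field.
Qed.

Lemma fibred_inverseK y : W2 (orb y) -> fibred_map (fibred_inverse y) = y.
Proof.
case: (cc) => _ _ _ [_ PK] Wy.
apply/rowP => j; rewrite /fibred_map orb_row_mx (PK _ Wy).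
have [->|->|->|->] := ord4 j.
- by rewrite row_mxEl orbE.
- by rewrite row_mxEl orbE.
- by rewrite !row_mxEr !pt0; field.
- by rewrite !row_mxEr !pt1; field.
Qed.

Lemma open_fibred_image : open fibred_image.
Proof.
rewrite openE => y [Wy Vy].
have c : {for y, continuous fibred_inverse} by
  exact/differentiable_continuous/differentiable_fibred_inverse.
apply: filterI; first by apply: (open_nbhs_nbhs (conj oW' _)).
by apply: c; exact: (open_nbhs_nbhs (conj oV Vy)).
Qed.

Lemma fibred_coordinate_change : coordinate_change V fibred_image fibred_map fibred_inverse.
Proof.
split.
- by split=> //; exact: open_fibred_image.
- split; first exact: smooth_fibred_map.
  by move=> j k; apply: Ck_sub (smooth_fibred_inverse j k) => y [].
- split=> [x Vx|y []//]; split; last by rewrite fibred_mapK.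
  rewrite orb_row_mx; case: (cc) => _ _ [VW _] _; exact/VW/VV2.
- by split=> [x|y [+ _]]; [exact: fibred_mapK|exact: fibred_inverseK].
Qed.

Lemma derive_fibred_inverse y v j : W2 (orb y) ->
  'D_v fibred_inverse y 0 j = \sum_i v 0 i * pd i (fun y => fibred_inverse y 0 j) y.
Proof.
move=> Wy; rewrite (derive_mx (diff_derivable (differentiable_fibred_inverse Wy))) mxE.
apply: derive_pdE; exact: Ck_diff (smooth_fibred_inverse j 1%N) _.
Qed.

Lemma derive_fibred_inverse_delta y i j : W2 (orb y) ->
  'D_(delta_mx 0 i) fibred_inverse y 0 j = pd i (fun y => fibred_inverse y 0 j) y.
Proof.
by move=> Wy; rewrite (derive_mx (diff_derivable (differentiable_fibred_inverse Wy))) mxE.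
Qed.

Local Notation P i j := (pd i (fun y => Psi2 y 0 j)).

Let diff_comp g y : smooth_on V2 g -> W2 (orb y) ->
  differentiable (fun s => g (Psi2 s)) (orb y) /\
  forall i, pd i (fun s => g (Psi2 s)) (orb y) =
    pd 0 g (Psi2 (orb y)) * P i 0 (orb y) + pd 1 g (Psi2 (orb y)) * P i 1 (orb y).
Proof.
case: (cc) => -[oV2 oW2] [sPhi sPsi] [_ WV] _ sg Wy.
have dPsi : differentiable Psi2 (orb y).
  by apply: differentiable_rV => j; apply: Ck_diff (sPsi j 1%N) _.
have dg : differentiable g (Psi2 (orb y)) by apply: Ck_diff (sg 1%N) (WV _ Wy).
split=> [|i]; first exact: (differentiable_comp dPsi dg).
by rewrite /pd (derive_comp_rV _ dPsi dg) sum2E.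
Qed.

Local Notation C j := (fun y => fibred_inverse y 0 j).

Let C_t y j : C (t j) y = Psi2 (orb y) 0 j. Proof. by rewrite /fibred_inverse row_mxEl. Qed.
Let C_0 y : C (z 0) y = mu * y 0 (z 0) - F (Psi2 (orb y)). Proof. by rewrite /fibred_inverse
  row_mxEr pt0. Qed.
Let C_1 y : C (z 1) y = nu^-1 * (y 0 (z 1) - S (Psi2 (orb y))). Proof. by rewrite /fibred_inverse
  row_mxEr pt1. Qed.

Let dC i y : W2 (orb y) -> [/\ forall j, pd i (C (t j)) y = pd i (fun y => Psi2 (orb y) 0 j) y,
  pd i (C (z 0)) y = mu * (i == z 0)%:R - pd i (fun y => F (Psi2 (orb y))) y &
  pd i (C (z 1)) y = nu^-1 * ((i == z 1)%:R - pd i (fun y => S (Psi2 (orb y))) y)].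
Proof.
move=> Wy.
have [dF _] := diff_comp sF Wy; have [dS _] := diff_comp sS Wy.
have dF' := differentiable_orb dF; have dS' := differentiable_orb dS.
have dc j : differentiable (fun y : 'rV[R]_(2 + 2) => y 0 j) y by exact: differentiable_coord.
split=> [j||].
- by apply: (pd_on i oW' Wy) => s _; exact: C_t.
- apply: etrans (pd_on i oW' Wy (fun s _ => C_0 s)) _.
  have dm : differentiable (fun y : 'rV[R]_(2 + 2) => mu * y 0 (z 0)) y.
    by apply: differentiableM => //; exact: differentiable_cst.
  apply: etrans (pdB i dm dF') _; congr (_ - _).
  apply: etrans (pdM i (differentiable_cst mu y) (dc (z 0))) _.
  by rewrite pd_cst mul0r add0r pd_coord.
- apply: etrans (pd_on i oW' Wy (fun s _ => C_1 s)) _.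
  apply: etrans (pdM i (differentiable_cst nu^-1 y) (differentiableB (dc (z 1)) dS')) _.
  rewrite pd_cst mul0r add0r; congr (_ * _).
  by apply: etrans (pdB i (dc (z 1)) dS') _; rewrite pd_coord.
Qed.

Lemma pd_fibred_inverse_fibre y i : W2 (orb y) ->
  [/\ forall j, pd (z i) (C (t j)) y = 0, pd (z i) (C (z 0)) y = mu * (i == 0)%:R &
  pd (z i) (C (z 1)) y = nu^-1 * (i == 1)%:R].
Proof.
move=> Wy; have [H1 H2 H3] := dC (z i) Wy.
split=> [j||].
- by rewrite H1; exact: (pd_fibre (fun s => Psi2 s 0 j)).
- by rewrite H2 (pd_fibre (fun s => F (Psi2 s))) subr0 (inj_eq (@rshift_inj _ _)).
- by rewrite H3 (pd_fibre (fun s => S (Psi2 s))) subr0 (inj_eq (@rshift_inj _ _)).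
Qed.

Lemma pd_fibred_inverse_base y i : W2 (orb y) ->
  let d g := pd 0 g (Psi2 (orb y)) * P i 0 (orb y) + pd 1 g (Psi2 (orb y)) * P i 1 (orb y) in
  [/\ forall j, pd (t i) (C (t j)) y = P i j (orb y), pd (t i) (C (z 0)) y = - d F &
  pd (t i) (C (z 1)) y = - (nu^-1 * d S)].
Proof.
move=> Wy d; have [H1 H2 H3] := dC (t i) Wy.
have [dF dFE] := diff_comp sF Wy; have [dS dSE] := diff_comp sS Wy.
have [_ [_ sPsi] _ _] := cc.
split=> [j||].
- rewrite H1; apply: (@pd_orb_lshift _ (fun s => Psi2 s 0 j)).
  exact: Ck_diff (sPsi j 1%N) Wy.
- by rewrite H2 eq_lrshift mulr0 sub0r (pd_orb_lshift i dF) dFE.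
- by rewrite H3 eq_lrshift sub0r (pd_orb_lshift i dS) dSE mulrN.
Qed.

End FibredCoordinates.

(** * Assembly of the local normal form *)

Lemma det_mx2 (R : realType) (a b c d : R) : \det (mx2 a b c d) = a * d - b * c.
Proof.
rewrite (expand_det_row _ 0) sum2E /cofactor !det_mx11 !mxE /= expr0 expr1; ring.
Qed.

Lemma is_orbit_metric_family (R : realType) (e : R) O psi : (forall t, O t -> 0 < t1 t) ->
  is_orbit_metric O (soliton_metric e psi) (soliton_orbit_metric e).
Proof.
move=> t0; exists (null_fibre_metric (family_fibre e psi) (@t1 R)), (shift_form (fun=> 0)
  (@family_shift R)).
move=> t Ot; split.
- by apply/matrixP => i j; rewrite !mxE; have [->|->] := ord2 i; have [->|->] := ord2 j.
- by apply/matrixP => i j; rewrite !mxE; have [->|->] := ord2 i; have [->|->] := ord2 j.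
- by rewrite det_mx2 mulr0 sub0r oppr_eq0 mulf_neq0// lt0r_neq0// t0.
- exact: soliton_metric_adapted t0 _ _ Ot.
Qed.

(** The terms with h are of degree 0 in q, hence unchanged when q is replaced by tau = s q / lam.
    The other two follow from q f2 / E = c / q together with mu c = s lam and nu = s lam mu. *)
Lemma psi_coefficient_algebra (R : realType) (e E h11 h22 q h c tau f2 q1 q2 h1 h2 b mu lam s nu
  : R) :
  mu != 0 -> lam != 0 -> E != 0 -> q != 0 -> s * s = 1 -> s * q = lam * tau ->
  mu * c = s * lam -> nu = s * lam * mu -> q ^+ 2 * f2 / E = c ->
  E^-1 * (- 2 * (h11 + e * h22) + 2 / q * (h1 * q1 + e * h2 * q2)
    - 2 * h / q ^+ 2 * (q1 ^+ 2 + e * q2 ^+ 2)) + 2 * e * (q * f2 / E) ^+ 2 + 4 * (q * b) = 0 ->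
  E^-1 * (- 2 * (h11 + e * h22) + 2 / tau * (h1 * (s / lam * q1) + e * h2 * (s / lam * q2))
    - 2 * h / tau ^+ 2 * ((s / lam * q1) ^+ 2 + e * (s / lam * q2) ^+ 2))
    + 2 * e / (mu ^+ 2 * tau ^+ 2) + 4 * (nu * mu * b) * tau / mu ^+ 2 = 0.
Proof.
move=> mu0 lam0 E0 q0 s2 sqE muc nuE fE H.
have s0 : s != 0 by apply/eqP => s0; move/eqP: s2; rewrite s0 mul0r eq_sym oner_eq0.
have tauE : tau = s / lam * q by rewrite mulrAC sqE mulrC mulKf.
have f2E : q * f2 / E = s * lam / mu / q by rewrite -muc (mulrC mu) mulfK// -fE; field; rewrite
  q0 E0.
rewrite -[RHS]H f2E nuE tauE.
have ss : s ^+ 2 = 1 by rewrite expr2.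
have -> : 2 * e / (mu ^+ 2 * (s / lam * q) ^+ 2) = 2 * e * (s * lam / mu / q) ^+ 2.
  have -> : (s * lam / mu / q) ^+ 2 = s ^+ 2 * (lam / mu / q) ^+ 2 by ring.
  have -> : (s / lam * q) ^+ 2 = s ^+ 2 * (q / lam) ^+ 2 by ring.
  by rewrite ss !mul1r; field; rewrite q0 mu0 lam0.
have -> : 4 * (s * lam * mu * mu * b) * (s / lam * q) / mu ^+ 2 = s ^+ 2 * (4 * (q * b)).
  by field; rewrite mu0 lam0.
have -> : (s / lam * q1) ^+ 2 + e * (s / lam * q2) ^+ 2 = (s / lam) ^+ 2 * (q1 ^+ 2 + e * q2 ^+
  2) by ring.
rewrite ss mul1r; congr (_ + _ + _).
by field; rewrite s0 q0 lam0 E0.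
Qed.

(** The functions u0, u1, th0, th1 are the coefficients of the pullbacks of dt1, dt2, theta^1,
    theta^2 to the new coordinates. The zeros of the environment fill jets that do not occur in
    [metric], except the last but two, which is the new f_1^1. *)
Lemma pullback_algebra (R : realType) (e mu nu tau g T h x1 x2 : R) (u0 u1 th0 th1 : 'I_(2 + 2)
  -> R) i j :
  let D := x1 ^+ 2 + e * x2 ^+ 2 in
  e = 1 \/ e = -1 -> mu != 0 -> nu != 0 -> tau != 0 -> D != 0 ->
  u0 (@lshift 2 2 0) = x1 / D -> u1 (@lshift 2 2 0) = e * x2 / D -> th0 (@lshift 2 2 0) = 0 ->
  th1 (@lshift 2 2 0) = T * (g * tau^-1 ^+ 2) / nu ->
  u0 (@lshift 2 2 1) = - x2 / D -> u1 (@lshift 2 2 1) = x1 / D -> th0 (@lshift 2 2 1) = 0 -> th1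
    (@lshift 2 2 1) = 0 ->
  u0 (@rshift 2 2 0) = 0 -> u1 (@rshift 2 2 0) = 0 -> th0 (@rshift 2 2 0) = mu * 1%:R -> th1
    (@rshift 2 2 0) = nu^-1 * 0%:R ->
  u0 (@rshift 2 2 1) = 0 -> u1 (@rshift 2 2 1) = 0 -> th0 (@rshift 2 2 1) = mu * 0%:R -> th1
    (@rshift 2 2 1) = nu^-1 * 1%:R ->
  D * g * (u0 i * u0 j + e * (u1 i * u1 j)) + h * th0 i * th0 j + nu * tau / mu * (th0 i * th1 j
    + th1 i * th0 j) =
  pexpr_eval [:: e; g; 0; tau; 0; 0; 0; 0; 0; 0; 0; 0; 0; 0; 0; mu ^+ 2 * h; 0; 0; 0; 0; 0;
      T * (g * tau^-1 ^+ 2); 0; 0; 0; 0; 0; 0] (metric i j).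
Proof.
move=> D e1 mu0 nu0 tau0 D0 b00 b01 b02 b03 b10 b11 b12 b13 f00 f01 f02 f03 f10 f11 f12 f13.
rewrite /D in D0 b00 b01 b10 b11 *.
have [->|->|->|->] := ord4 i; have [->|->|->|->] := ord4 j.
all: rewrite ?b00 ?b01 ?b02 ?b03 ?b10 ?b11 ?b12 ?b13 ?f00 ?f01 ?f02 ?f03 ?f10 ?f11 ?f12 ?f13.
all: rewrite /pexpr_eval /metric /symmetric /=.
all: have [ee|ee] := e1; rewrite !ee ?mul1r ?mulN1r in D0 *; field; by rewrite ?D0 ?mu0 ?nu0 ?tau0.
Qed.

Section LocalNormalForm.
Variables (R : realType) (p : 'rV[R]_(2 + 2)) (r : R) (X : 'rV[R]_(2 + 2) -> 'rV[R]_(2 + 2))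
  (G : 'rV[R]_(2 + 2) -> 'M[R]_(2 + 2)) (e : R) (E h q f a : 'rV[R]_2 -> R).
Local Notation t i := (@lshift 2 2 i).
Local Notation z i := (@rshift 2 2 i).
Local Notation Xz k := (fun y => X y 0 (z k)).
Local Notation U := (ball p r).
Local Notation O := (ball (orb p) r).
Let M (t : 'rV[R]_2) := adapted_metric (fun t => E t *: mx2 1 0 0 e)
  (null_fibre_metric h q) (shift_form a f) t.

Lemma gdot_adapted (v w : 'rV[R]_(2 + 2)) x s : G x = M s ->
  gdot G x v w = E s * (v 0 (t 0) * w 0 (t 0) + e * (v 0 (t 1) * w 0 (t 1)))
   + h s * (v 0 (z 0) + a s * v 0 (t 0)) * (w 0 (z 0) + a s * w 0 (t 0))
   + q s * ((v 0 (z 0) + a s * v 0 (t 0)) * (w 0 (z 1) + f s * w 0 (t 0))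
            + (v 0 (z 1) + f s * v 0 (t 0)) * (w 0 (z 0) + a s * w 0 (t 0))).
Proof.
move=> Gx; rewrite /gdot Gx mxE sum4E.
have vM j : (v *m M s) 0 j = v 0 (t 0) * M s (t 0) j + v 0 (t 1) * M s (t 1) j
   + (v 0 (z 0) * M s (z 0) j + v 0 (z 1) * M s (z 1) j) by rewrite mxE sum4E.
have wT j : w^T j 0 = w 0 j by rewrite mxE.
rewrite !vM !wT !adapted_metricE {vM wT Gx}.
move: (v 0 (t 0)) (v 0 (t 1)) (v 0 (z 0)) (v 0 (z 1)) => v0 v1 v2 v3.
move: (w 0 (t 0)) (w 0 (t 1)) (w 0 (z 0)) (w 0 (z 1)) => w0 w1 w2 w3.
rewrite /env; move: (pd _ _ _) => d1.
rewrite /pexpr_eval /metric /symmetric /=.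
ring.
Qed.

Lemma gdot_adapted_components (v w : 'rV[R]_(2 + 2)) x s v0 v1 v2 v3 w0 w1 w2 w3 : G x = M s ->
  v 0 (t 0) = v0 -> v 0 (t 1) = v1 -> v 0 (z 0) = v2 -> v 0 (z 1) = v3 ->
  w 0 (t 0) = w0 -> w 0 (t 1) = w1 -> w 0 (z 0) = w2 -> w 0 (z 1) = w3 ->
  gdot G x v w = E s * (v0 * w0 + e * (v1 * w1)) + h s * (v2 + a s * v0) * (w2 + a s * w0)
   + q s * ((v2 + a s * v0) * (w3 + f s * w0) + (v3 + f s * v0) * (w2 + a s * w0)).
Proof. by move=> Gx <- <- <- <- <- <- <- <-; rewrite (gdot_adapted _ _ Gx). Qed.

Hypotheses (r0 : 0 < r) (e1 : e = 1 \/ e = -1)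
  (sE : smooth_on O E) (sq : smooth_on O q) (sh : smooth_on O h)
  (sf : smooth_on O f) (sa : smooth_on O a)
  (E_gt0 : forall t, O t -> 0 < E t)
  (s : R) (s2 : s * s = 1) (sq_gt0 : forall t, O t -> 0 < s * q t)
  (a_t2 : forall t, O t -> pd 1 a t = 0) (f_t2 : forall t, O t -> pd 1 f t != 0)
  (q_t1 : pd 0 q (orb p) != 0) (N0 : 0 < pd 0 q (orb p) ^+ 2 + e * pd 1 q (orb p) ^+ 2)
  (sX : smooth_map_on U X)
  (X_t : forall x k, U x -> X x 0 (t k) = 0)
  (X_sym : forall x i k, U x -> pd (t i) (Xz k) x =
    (i == 0)%:R * (a (orb x) * pd (z 0) (Xz k) x + f (orb x) * pd (z 1) (Xz k) x))
  (GM : forall x, U x -> G x = M (orb x))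
  (soliton : forall x, U x -> ricci G x + 2^-1 *: lie_metric X G x = 0).

Let E0 t (Ot : O t) : E t != 0 := lt0r_neq0 (E_gt0 Ot).
Let q0 t : O t -> q t != 0.
Proof. by move=> /sq_gt0; rewrite lt0r mulf_eq0 negb_or => /andP[/andP[]]. Qed.
Let op : O (orb p). Proof. exact: ballxx. Qed.
Let oO : open O. Proof. exact: ball_open. Qed.
Let oU : open U. Proof. exact: ball_open. Qed.

Let equations := @orbit_equations_on_ball R p r X G e E h q f a e1 sE sq sh sf sa E0 q0 a_t2 f_t2
  sX X_t X_sym GM soliton.

Let k0 : pd (z 0) (Xz 0) p = 0.
Proof.
have := @laplacian_coefficient_eq0 R e O E q e1 oO sE sq E0 q0 (pd (z 0) (Xz 0) p).
set k := pd _ _ _ => H.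
suff /eqP : k * pd 0 q (orb p) = 0 by rewrite mulf_eq0 (negbTE q_t1) orbF => /eqP.
apply: H => //.
- by move=> x Ox; case: (equations Ox) => -[].
- by move=> x Ox; case: (equations Ox) => -[].
- by move=> x Ox; case: (equations Ox) => -[].
- by move=> x Ox; case: (equations Ox).
Qed.

Let c := q (orb p) ^+ 2 * pd 1 f (orb p) / E (orb p).

(** The mixed components of the soliton equation say exactly that the gradient of this quotient
    vanishes. *)
Let fE x : O x -> q x ^+ 2 * pd 1 f x / E x = c.
Proof.
have Pf1 := @partials_pd R 2 O (pd 1 f) (fun k => Ck_pd 1 (sf k.+1)).
have P := partialsM (partialsM (partialsX 2 (partials_pd sq)) Pf1) (partialsV E0 (partials_pd sE)).
move=> Ox.
apply: (@cst_on_ball _ _ (fun x => q x ^+ 2 * pd 1 f x / E x) (orb p) r x) => //.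
  by move=> y /P[].
move=> y i Oy; have [_ ->] := P y Oy.
have [_ _ [H0 H1] _] := equations Oy; have := E0 Oy.
have [->|->] := ord2 i.
  move: (pd 0 (pd 1 f) y) (pd 1 f y) (pd 0 q y) (pd 0 E y) (E y) (q y) H0 => x1 x2 x3 x4 x5 x6
    {}H0 n0.
  rewrite expr1 (_ : 2%:R * x6 * x3 * x2 + x6 ^+ 2 * x1 = x6 ^+ 2 * x2 * x4 / x5)//.
  by field.
move: (pd 1 (pd 1 f) y) (pd 1 f y) (pd 1 q y) (pd 1 E y) (E y) (q y) H1 => x1 x2 x3 x4 x5 x6 {}H0
  n0.
rewrite expr1 (_ : 2%:R * x6 * x3 * x2 + x6 ^+ 2 * x1 = x6 ^+ 2 * x2 * x4 / x5)//.
by field.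
Qed.

Let c0 : c != 0.
Proof. by rewrite !mulf_neq0 ?invr_eq0 ?E0 ?f_t2 ?expf_neq0 ?q0. Qed.


Let X0 x : U x -> X x 0 (z 0) = X p 0 (z 0).
Proof.
move=> Ux; apply: (@cst_on_ball _ _ (Xz 0) p r x) => // [y Uy|y i Uy].
  exact: Ck_diff (sX (z 0) 1%N) Uy.
have sl := slope_constant e1 sE sq sh sf sa E0 q0 a_t2 f_t2 sX X_t X_sym GM soliton 0 Uy.
have [d1 d3 d0] := ball_derivatives sf sa a_t2 f_t2 sX X_sym 0 Uy.
have [->|->|->|->] := ord4 i; [|exact: d1|by rewrite sl k0|exact: d3].
by rewrite d0 sl k0 mulr0.
Qed.

Local Notation b := (pd (z 0) (Xz 1) p).

(** Along t1 the derivative [b * a] of the z2-component of X is compensated by dF = a dt1, so the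
    difference with b (z1 + F) is constant. Since z1 + F is mu times the new z1, the component
    becomes affine in it. *)
Let X1 V2 d F : d <= r -> ball (orb p) d `<=` V2 -> open V2 -> smooth_on V2 F ->
  (forall t, V2 t -> pd 0 F t = a t /\ pd 1 F t = 0) ->
  forall x, ball p d x -> X x 0 (z 1) - b * (x 0 (z 0) + F (orb x)) =
    X p 0 (z 1) - b * (p 0 (z 0) + F (orb p)).
Proof.
move=> dr dV2 oV2 sF dF x Vx.
pose V := ball p d.
have VU y : V y -> U y by exact: le_ball.
have VV2 y : V y -> V2 (orb y) by move=> /ball_orb/dV2.
have oV : open V by exact: ball_open.
have sFo : smooth_on V (fun y => F (orb y)) by move=> k; apply: Ck_orb (sF k).
have sX1 : smooth_on V (Xz 1) by move=> k; apply: Ck_sub (sX (z 1) k).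
have PC := @partials_coord R (2 + 2) V (z 0).
have P := partialsD (partials_pd sX1) (partialsN (partialsM (@partials_cst R (2 + 2) V b)
  (partialsD PC (partials_pd sFo)))).
apply: (@cst_on_ball _ _ (fun x => X x 0 (z 1) - b * (x 0 (z 0) + F (orb x))) p d x) => //.
  by move=> y /P[].
move=> y i Vy; have Uy := VU y Vy; have [_ ->] := P y Vy.
have sl := slope_constant e1 sE sq sh sf sa E0 q0 a_t2 f_t2 sX X_t X_sym GM soliton 1 Uy.
have [d1 d3 d0] := ball_derivatives sf sa a_t2 f_t2 sX X_sym 1 Uy.
have df : differentiable F (orb y) by apply: Ck_diff (sF 1%N) (VV2 y Vy).
have [F0 F1] := dF _ (VV2 y Vy).
have o j := pd_orb_lshift j df.
have [->|->|->|->] := ord4 i.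
- by rewrite d0 sl o F0 eq_lrshift mul0r !add0r mulrC subrr.
- by rewrite d1 o F1 eq_lrshift mul0r !add0r mulr0 oppr0.
- by rewrite sl pd_fibre eqxx mul0r add0r addr0 mulr1 subrr.
- rewrite d3 pd_fibre (_ : (z 1 == z 0) = false)//.
  by rewrite mul0r !add0r mulr0 oppr0.
Qed.

Lemma local_normal_form : exists (V W : set 'rV[R]_(2 + 2))
    (Phi Psi : 'rV[R]_(2 + 2) -> 'rV[R]_(2 + 2)) (a1 a2 a3 : R) (psi : 'rV[R]_2 -> R),
  [/\ V p /\ V `<=` U,
      coordinate_change V W Phi Psi /\ adapted_change W Psi,
      (forall t, orbit_space W t -> 0 < t1 t) /\
        smooth_on (orbit_space W) psi /\ psi_equation (orbit_space W) e a2 psi,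
      forall y, W y -> pullback Psi G y = soliton_metric e psi (orb y) /\
        X (Psi y) = 'D_(soliton_field a1 a2 a3 y) Psi y &
      is_orbit_metric (orbit_space W) (soliton_metric e psi) (soliton_orbit_metric e) /\
      gauss_curvature (orbit_space W) (soliton_orbit_metric e)
        (fun t => - (t1 t `^ (- (3 / 2)) / 4))].
Proof.
have e2 : e * e = 1 by case: e1 => ->; rewrite ?mulrNN mulr1.
have q11 x : O x -> 4 * pd 0 (pd 0 q) x = (2 * (pd 0 E x * pd 0 q x - e * pd 1 E x * pd 1 q x) / E x
    + (pd 0 q x ^+ 2 - e * pd 1 q x ^+ 2) / q x).
  by move=> /equations[[H _ _] _ _ _]; apply: etrans H _; rewrite k0 !mul0r mulr0 add0r.
have q12 x : O x -> 4 * pd 0 (pd 1 q) x =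
     2 * (pd 1 E x * pd 0 q x + pd 0 E x * pd 1 q x) / E x + 2 * pd 0 q x * pd 1 q x / q x.
  by move=> /equations[[_ H _] _ _ _].
have q22 x : O x -> 4 * pd 1 (pd 1 q) x = - e * (2 * (pd 0 E x * pd 0 q x - e * pd 1 E x * pd 1 q
  x) / E x
    + (pd 0 q x ^+ 2 - e * pd 1 q x ^+ 2) / q x).
  by move=> /equations[[_ _ H] _ _ _]; apply: etrans H _; rewrite k0 !mul0r mulr0 sub0r mulrN mulNr.
have [lam [mu [nu [V2 [W2 [Phi2 [Psi2 [F [S [[lam0 mu0 muc nuE] cc [V2p V2O] [sF sS]
  data]]]]]]]]]] :=
  orbit_coordinates e1 r0 sE sq sf sa E_gt0 s2 sq_gt0 N0 c0 q11 q12 q22 fE a_t2.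
have lamn0 := lt0r_neq0 lam0.
have s0 : s != 0 by apply/eqP => s0; move/eqP: s2; rewrite s0 mul0r eq_sym oner_eq0.
have nu0 : nu != 0 by rewrite nuE !mulf_neq0.
have [[oV2 oW2] [sPhi2 sPsi2] [VW2 WV2] [PhiK PsiK]] := cc.
have [d [d0 dr dV2]] : exists d, [/\ 0 < d, d <= r & ball (orb p) d `<=` V2].
  have : nbhs (orb p) V2 by exact: open_nbhs_nbhs.
  rewrite nbhs_ballP => -[d /= d0 dV2].
  exists (Num.min d r); split; rewrite ?lt_min ?d0 ?ge_min ?lexx ?orbT//.
  by apply: subset_trans dV2; apply: le_ball; rewrite ge_min lexx.
pose V := ball p d.
have oV : open V by exact: ball_open.
have VU : V `<=` U by exact: le_ball.
have VV2 y : V y -> V2 (orb y) by move=> /ball_orb/dV2.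
pose W := fibred_image W2 Psi2 F S mu nu V.
pose Psi := fibred_inverse Psi2 F S mu nu.
have CC : coordinate_change V W (fibred_map Phi2 F S mu nu) Psi by exact:
  (fibred_coordinate_change cc sF sS mu0 nu0 oV VV2).
have WW2 y : W y -> W2 (orb y) by case.
have orbW : orbit_space W `<=` W2 by move=> _ [y /WW2 ? <-].
have tau_gt0 t : W2 t -> 0 < t1 t.
  by move=> Wt; have [[_]] := data _ (WV2 _ Wt); rewrite /= PsiK.
pose psi := soliton_psi e Psi2 h mu.
have sh2 : smooth_on V2 h by move=> k; exact: Ck_sub V2O (sh k).
have tau_gt0' t : V2 t -> 0 < (@t1 R \o Phi2) t by move=> Vt; have [[_]] := data _ Vt.
have spsi : smooth_on W2 psi by exact: (smooth_soliton_psi e mu cc tau_gt0' sh2).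
have psi_eq : psi_equation W2 e (nu * mu * b) psi.
  apply: (@psi_equation_soliton_psi R e V2 W2 Phi2 Psi2 E h mu (nu * mu * b)) => //.
  - by move=> t Vt; have [_ _ _ [_ [_ _ H _]] _] := data _ Vt.
  - by move=> t Vt; have [_ _ _ [_ [_ _ _ H]] _] := data _ Vt.
  - by move=> t Vt; have [_ _ _ [H _] _] := data _ Vt.
  - by move=> t /V2O/E0.
  move=> t Vt; have Ot := V2O _ Vt.
  have [_ _ _ ] := equations Ot; rewrite k0 mulr0 add0r.
  have [[sqE tau0] _ _ [_ [-> -> _ _]] _] := data _ Vt.
  move=> H; exact: (psi_coefficient_algebra mu0 lamn0 (E0 Ot) (q0 Ot) s2 sqE muc nuE (fE Ot) H).
(* The components of X scale by 1 / mu and nu. By [X1] the second one is b (z1 + F) plus a constant,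
   and z1 + F is mu times the new z1, whence a2 = nu mu b. *)
exists V, W, (fibred_map Phi2 F S mu nu), Psi, (X p 0 (z 0) / mu), (nu * mu * b),
  (nu * (X p 0 (z 1) - b * (p 0 (z 0) + F (orb p)))), psi.
split.
- by split=> //; exact: ballxx.
- split=> //; exists (mx2 mu 0 0 nu^-1).
    rewrite unitmxE unitfE det_mx2.
    by rewrite mulr0 subr0 mulf_neq0 ?invr_eq0.
  move=> y /WW2 Wy i; apply/rowP => j.
  apply: etrans (derive_fibred_inverse_delta mu nu cc sF sS (z i) j Wy) _; rewrite sum2E.
  have [F1 F2 F3] := pd_fibred_inverse_fibre mu nu cc sF sS i Wy.
  have [->|->|->|->] := ord4 j.
  + by rewrite F1 !mxE /= !mulr0 addr0.
  + by rewrite F1 !mxE /= !mulr0 addr0.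
  + by rewrite F2 !mxE /= mulr1 mulr0 addr0; have [->|->] := ord2 i; rewrite /= ?mulr1 ?mulr0.
  + by rewrite F3 !mxE /= mulr1 mulr0 add0r; have [->|->] := ord2 i; rewrite /= ?mulr1 ?mulr0.
- split; first by move=> t /orbW/tau_gt0.
  split; first by move=> k; exact: Ck_sub orbW (spsi k).
  by move=> t /orbW; exact: psi_eq.
- move=> y Wy; have WWy := WW2 _ Wy; have [_ Vy] := Wy.
  set x := Psi y; have Ux : U x by exact: VU.
  have ox : orb x = Psi2 (orb y) by exact: orb_row_mx.
  split; last first.
    pose v := soliton_field (X p 0 (z 0) / mu) (nu * mu * b)
      (nu * (X p 0 (z 1) - b * (p 0 (z 0) + F (orb p)))) y.
    have v0 k : v 0 (t k) = 0.
      by rewrite /v !mxE !eq_lrshift !andbF !mulr0 addr0.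
    have v2 : v 0 (z 0) = X p 0 (z 0) / mu by rewrite /v !mxE /= mulr1 mulr0 addr0.
    have v3 : v 0 (z 1) = nu * mu * b * y 0 (z 0)
        + nu * (X p 0 (z 1) - b * (p 0 (z 0) + F (orb p))).
      by rewrite /v !mxE /= mulr1 mulr0 add0r.
    rewrite -[soliton_field _ _ _ y]/v; move: v v0 v2 v3 => v v0 v2 v3.
    apply/rowP => j; apply/esym.
    have D := derive_fibred_inverse mu nu cc sF sS v j WWy.
    apply: etrans (etrans D (sum4E _)) _; cbv beta; rewrite (v0 0) (v0 1) v2 v3.
    have S4 (c1 c2 c3 c4 c5 c6 : R) : (0 * c1 + 0 * c2) + (c3 * c4 + c5 * c6) = c3 * c4 + c5 * c6.
      by rewrite !mul0r !add0r.
    apply: etrans (S4 _ _ _ _ _ _) _.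
    have [A1 A2 A3] := pd_fibred_inverse_fibre mu nu cc sF sS 0 WWy.
    have [B1 B2 B3] := pd_fibred_inverse_fibre mu nu cc sF sS 1 WWy.
    have [->|->|->|->] := ord4 j.
    - by rewrite A1 B1 !mulr0 addr0 X_t.
    - by rewrite A1 B1 !mulr0 addr0 X_t.
    - by rewrite A2 B2 X0//= !mulr0 addr0 mulr1 divfK.
    - rewrite A3 B3 /= mulr0 mulr0 add0r mulr1.
      have := X1 dr dV2 oV2 sF (fun t Vt => let: And5 _ h _ _ _ := data t Vt in h) Vy.
      have -> : x 0 (z 0) = mu * y 0 (z 0) - F (Psi2 (orb y)) by rewrite row_mxEr pt0.
      rewrite ox subrK => /(canRL (subrK _)) ->.
      by rewrite -!mulrA -mulrDr mulrAC mulfV// mul1r addrC; congr (_ + _); rewrite mulrCA.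
  have Vt : V2 (Psi2 (orb y)) by exact: WV2.
  have dat := data _ Vt; cbv zeta in dat; rewrite (PsiK _ WWy) in dat.
  have tauE : (@t1 R \o Phi2) (Psi2 (orb y)) = t1 (orb y) by rewrite /= (PsiK _ WWy).
  rewrite tauE in dat.
  have pb i j : pullback Psi G y i j = gdot G x ('D_(delta_mx 0 i) Psi y) ('D_(delta_mx 0 j) Psi y).
    by rewrite mxE.
  have comp i j : 'D_(delta_mx 0 i) Psi y 0 j = pd i (fun y => Psi y 0 j) y.
    exact: (derive_fibred_inverse_delta mu nu cc sF sS i j WWy).
  have Gx : G x = M (Psi2 (orb y)) by exact: (etrans (GM Ux) (congr1 M ox)).
  pose u0 i := pd i (fun y => Psi y 0 (t 0)) y; pose u1 i := pd i (fun y => Psi y 0 (t 1)) y.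
  pose th0 i := pd i (fun y => Psi y 0 (z 0)) y + a (Psi2 (orb y)) * u0 i.
  pose th1 i := pd i (fun y => Psi y 0 (z 1)) y + f (Psi2 (orb y)) * u0 i.
  have pbE i j : pullback Psi G y i j = E (Psi2 (orb y)) * (u0 i * u0 j + e * (u1 i * u1 j))
     + h (Psi2 (orb y)) * th0 i * th0 j + q (Psi2 (orb y)) * (th0 i * th1 j + th1 i * th0 j).
    exact: (etrans (pb i j) (gdot_adapted_components Gx (comp i (t 0)) (comp i (t 1)) (comp i (z
      0)) (comp i (z 1))
      (comp j (t 0)) (comp j (t 1)) (comp j (z 0)) (comp j (z 1)))).
  have m i j : soliton_metric e psi (orb y) i j = pexpr_eval (env e (@family_conformal R) (@t1 R)
      (family_fibre e psi) (@family_shift R) (fun=> 0) (orb y)) (metric i j).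
    by rewrite (@soliton_metric_adapted R e W2 tau_gt0 psi _ WWy) adapted_metricE.
  have fibre i : [/\ u0 (z i) = 0, u1 (z i) = 0, th0 (z i) = mu * (i == 0)%:R & th1 (z i) = nu^-1
    * (i == 1)%:R].
    have [B1 B2 B3] := pd_fibred_inverse_fibre mu nu cc sF sS i WWy.
    have U0 : u0 (z i) = 0 by exact: B1.
    split=> //; first exact: B1.
      by rewrite /th0 U0 mulr0 addr0; exact: B2.
    by rewrite /th1 U0 mulr0 addr0; exact: B3.
  have [[sqE tau0] [F0 F1] [S0 S1] [DE _] [P00 P01 P10 P11]] := dat.
  have D0 := E0 (V2O _ Vt).
  (* Since E is the product of D and tau^(-1/2), its nonvanishing makes D invertible in the inverse
     Jacobian. *)
  rewrite -DE mulf_eq0 negb_or in D0; have {D0}/andP[D0 g0] := D0.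
  have base i : [/\ u0 (t i) = pd i (fun y => Psi2 y 0 0) (orb y), u1 (t i) = pd i (fun y => Psi2
    y 0 1) (orb y),
      th0 (t i) = 0 & nu * th1 (t i) = t2 (orb y) * (family_conformal (orb y) * (t1 (orb y))^-1
        ^+ 2) * (i == 0)%:R].
    have [B1 B2 B3] := pd_fibred_inverse_base mu nu cc sF sS i WWy.
    have U0 : u0 (t i) = pd i (fun y => Psi2 y 0 0) (orb y) by exact: B1.
    split=> //; first exact: B1.
      rewrite /th0 (B2 : pd (t i) (fun y => Psi y 0 (z 0)) y = _) U0 F0 F1.
      by rewrite mul0r addr0 addrC subrr.
    rewrite /th1 (B3 : pd (t i) (fun y => Psi y 0 (z 1)) y = _) U0 S0 S1.
    rewrite -[t1 (orb y) `^ _]/(family_conformal (orb y)).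
    have [->|->] := ord2 i; rewrite ?P00 ?P01 ?P10 ?P11 /=; move: D0;
      move: (pd 0 _ _) (pd 1 _ _) (t2 _) (family_conformal _) (t1 _)^-1 (f _) => x1 x2 T g tt f' D0.
      by field; rewrite D0 nu0.
    by field; rewrite D0 nu0.
  have hE : family_fibre e psi (orb y) = mu ^+ 2 * h (Psi2 (orb y)).
    rewrite /family_fibre /psi /soliton_psi -[t1 (orb y) `^ _]/(family_conformal (orb y)).
    by rewrite divfK ?subrK// lt0r_neq0.
  have qE : q (Psi2 (orb y)) = nu * t1 (orb y) / mu.
    by rewrite nuE mulrAC mulfK// -mulrA -sqE mulrA s2 mul1r.
  have [b00 b01 b02 b03] := base 0; have [b10 b11 b12 b13] := base 1.
  have [f00 f01 f02 f03] := fibre 0; have [f10 f11 f12 f13] := fibre 1.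
  have {}b03 : th1 (t 0) = t2 (orb y) * (family_conformal (orb y) * (t1 (orb y))^-1 ^+ 2) / nu.
    by apply: (mulfI nu0); rewrite b03 mulr1 [RHS]mulrCA mulfV// mulr1.
  have {}b13 : th1 (t 1) = 0 by apply: (mulfI nu0); rewrite b13 !mulr0.
  have tau0' : t1 (orb y) != 0 by exact: lt0r_neq0.
  rewrite P00 in b00; rewrite P01 in b01; rewrite P10 in b10; rewrite P11 in b11.
  apply/matrixP => i j; apply: etrans (pbE i j) _; apply: (etrans _ (esym (m i j))).
  rewrite -DE qE -[t1 (orb y) `^ _]/(family_conformal (orb y)).
  have -> : pexpr_eval (env e (@family_conformal R) (@t1 R) (family_fibre e psi) (@family_shift
    R) (fun=> 0) (orb y))
    (metric i j) = pexpr_eval [:: e; family_conformal (orb y); 0; t1 (orb y); 0; 0; 0; 0; 0; 0;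
      0; 0; 0; 0; 0;
      mu ^+ 2 * h (Psi2 (orb y)); 0; 0; 0; 0; 0;
      t2 (orb y) * (family_conformal (orb y) * (t1 (orb y))^-1 ^+ 2); 0; 0; 0; 0; 0; 0] (metric i
        j).
    by have [->|->|->|->] := ord4 i; have [->|->|->|->] := ord4 j; rewrite /pexpr_eval /metric
      /symmetric /= ?hE.
  exact: (@pullback_algebra R e mu nu (t1 (orb y)) (family_conformal (orb y)) (t2 (orb y)) (h
    (Psi2 (orb y)))
    _ _ u0 u1 th0 th1 i j e1 mu0 nu0 tau0' D0 b00 b01 b02 b03 b10 b11 b12 b13 f00 f01 f02 f03 f10
      f11 f12 f13).
- split; last by move=> t /orbW; exact: gauss_family.
  by apply: is_orbit_metric_family => t /orbW/tau_gt0.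
Qed.

End LocalNormalForm.

Theorem theorem4 (R : realType) (U : set 'rV[R]_(2 + 2))
    (G : 'rV[R]_(2 + 2) -> 'M[R]_(2 + 2))
    (X : 'rV[R]_(2 + 2) -> 'rV[R]_(2 + 2)) (Lambda eps0 : R)
    (P h11 h12 f11 f12 : 'rV[R]_2 -> R)
    (oU : open U)
    (eps0_pm1 : eps0 = 1 \/ eps0 = -1)
    (* Ricci soliton with an Abelian Killing algebra spanned by d/dz1, d/dz2 *)
    (soliton : ricci_soliton U G X Lambda)
    (killing_alg : abelian_killing_algebra (@ddz R) U G)
    (nonnull : nonnull_leaves (@ddz R) U G)
    (orth_intransitive : forall x, U x ->
       curvature_field (conformal_metric eps0 P) (shift_form f11 f12) x != 0)
    (* (i) *)
    (null_curvature : forall x, U x ->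
       let C := curvature_field (conformal_metric eps0 P)
                  (shift_form f11 f12) x in
       gdot G x C C = 0)
    (* (ii) *)
    (null_killing : has_null_killing (@ddz R) U G)
    (* (iii) *)
    (X_tangent : forall x, U x -> in_leaf (@ddz R) x (X x))
    (X_symmetry : perp_symmetry (@ddz R) U G X)
    (* normal form (N) *)
    (smooth_N : [/\ smooth_on (orbit_space U) P,
                    smooth_on (orbit_space U) h11,
                    smooth_on (orbit_space U) h12,
                    smooth_on (orbit_space U) f11 &
                    smooth_on (orbit_space U) f12])
    (G_N : forall x, U x ->
       G x = normal_form eps0 P h11 h12 f11 f12 (orb x))
    (h12_neq0 : forall t, orbit_space U t -> h12 t != 0)
    (f1_neq0 : forall t, orbit_space U t ->
       pd 1 f11 t ^+ 2 + pd 1 f12 t ^+ 2 != 0)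
    (* the case considered *)
    (f11_t2 : forall t, orbit_space U t -> pd 1 f11 t = 0)
    (h12_t1 : forall t, orbit_space U t -> pd 0 h12 t != 0)
    (Lambda0 : Lambda = 0)
    (* Added hypothesis, void for eps0 = 1. For eps0 = -1 the gradient of h12
       must have positive norm in the orbit metric; the conclusion forces this,
       since it makes h12 ^+ 2 a constant multiple of the square of the new t1 *)
    (h12_grad : eps0 = -1 -> forall t, orbit_space U t ->
       pd 1 h12 t ^+ 2 < pd 0 h12 t ^+ 2) :
  (forall p, U p ->
     exists (V W : set 'rV[R]_(2 + 2))
            (Phi Psi : 'rV[R]_(2 + 2) -> 'rV[R]_(2 + 2))
            (a1 a2 a3 : R) (psi : 'rV[R]_2 -> R),
       [/\ V p /\ V `<=` U,
           coordinate_change V W Phi Psi /\ adapted_change W Psi,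
           (forall t, orbit_space W t -> 0 < t1 t) /\
             smooth_on (orbit_space W) psi /\
             psi_equation (orbit_space W) eps0 a2 psi,
           forall y, W y ->
             pullback Psi G y = soliton_metric eps0 psi (orb y) /\
             X (Psi y) = 'D_(soliton_field a1 a2 a3 y) Psi y &
           is_orbit_metric (orbit_space W) (soliton_metric eps0 psi)
             (soliton_orbit_metric eps0) /\
           gauss_curvature (orbit_space W) (soliton_orbit_metric eps0)
             (fun t => - (t1 t `^ (- (3 / 2)) / 4))]) /\
  (* a1, a2, a3 are arbitrary: every member of the family is a soliton *)
  (forall (O : set 'rV[R]_2) (a1 a2 a3 : R) (psi : 'rV[R]_2 -> R),
     open O -> (forall t, O t -> 0 < t1 t) ->
     smooth_on O psi -> psi_equation O eps0 a2 psi ->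
     ricci_soliton [set x | O (orb x)] (soliton_metric eps0 psi \o @orb R)
       (soliton_field a1 a2 a3) 0).

Proof.
subst Lambda.
have e2 : eps0 * eps0 = 1 by case: eps0_pm1 => ->; rewrite ?mulrNN mulr1.
split; last first.
  move=> O a1 a2 a3 psi oO t0 spsi psi_eq.
  exact: (family_ricci_soliton e2 oO t0 spsi psi_eq).
move=> p Up.
have [_ sX sol] := soliton.
case: smooth_N => sP sh sq sa sf.
have [r1 [r10 r1U]] : exists r, 0 < r /\ ball p r `<=` U.
  have : nbhs p U by exact: open_nbhs_nbhs.
  by rewrite nbhs_ballP => -[r /= r0 rU]; exists r.
have sub r : r <= r1 -> ball (orb p) r `<=` orbit_space U.
  move=> rr t Bt; exists (row_mx t (rsubmx p)); last exact: orb_row_mx.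
  by apply: r1U; exact: (le_ball rr (ball_row_mx Bt)).
(* On a small ball [h12] keeps the sign s it has at the centre, so [s * h12] is its absolute value
   and can be raised to real powers. *)
have [s [s2 [r [r0 rr s_gt0]]]] : exists s : R, s * s = 1 /\ exists r, [/\ 0 < r, r <= r1 &
    forall t, ball (orb p) r t -> 0 < s * h12 t].
  have q0 : h12 (orb p) != 0 by apply: h12_neq0; exists p.
  exists (Num.sg (h12 (orb p))); split; first by rewrite -expr2 sqr_sg q0.
  have cq : {for orb p, continuous h12}.
    by apply: Ck_cont (sq 0%N) _; exists p.
  have cs : {for orb p, continuous (fun t => Num.sg (h12 (orb p)) * h12 t)}.
    by apply: continuousM => //; exact: cst_continuous.
  have : nbhs (orb p) [set t | 0 < Num.sg (h12 (orb p)) * h12 t].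
    by have := @cvgr_gt R _ _ _ _ _ cs 0; apply; rewrite -normrEsg normr_gt0.
  rewrite nbhs_ballP => -[r /= r0 rB]; exists (Num.min r r1); split.
  - by rewrite lt_min r0.
  - by rewrite ge_min lexx orbT.
  - by move=> t Bt; apply: rB; apply: le_ball Bt; rewrite ge_min lexx.
have rU : ball p r `<=` U by move=> x /(le_ball rr)/r1U.
have rO := sub r rr.
have oO : open (ball (orb p) r) by exact: ball_open.
have res g : smooth_on (orbit_space U) g -> smooth_on (ball (orb p) r) g by move=> sg k; exact:
  Ck_sub rO (sg k).
have sE : smooth_on (ball (orb p) r) (fun t => expR (- 2 * P t)).
  by move=> k; apply: Ck_expR => //; apply: CkM => //; [exact: Ck_cst|exact: res].
have f_t2 t : orbit_space U t -> pd 1 f12 t != 0.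
  by move=> Ut; have := f1_neq0 t Ut; rewrite f11_t2// expr0n add0r sqrf_eq0.
have Op : orbit_space U (orb p) by exists p.
(* For eps0 = 1 the nonzero t1-derivative suffices; for eps0 = -1 this is the gradient hypothesis at
   p. *)
have N0 : 0 < pd 0 h12 (orb p) ^+ 2 + eps0 * pd 1 h12 (orb p) ^+ 2.
  case: eps0_pm1 => ee.
    by rewrite ee mul1r ltr_pwDl ?sqr_ge0// lt0r sqr_ge0 sqrf_eq0 h12_t1.
  by rewrite ee mulN1r subr_gt0; exact: h12_grad.
have sym x i k : U x -> _ := fun Ux => @symmetry_components R U G X eps0 (fun t => expR (- 2 * P t))
  h11 h12 f12 f11 oU G_N sf sa
  (fun x Ux => h12_neq0 _ (ex_intro2 _ _ x Ux erefl)) X_tangent X_symmetry x i k Ux.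
have [V [W [Phi [Psi [a1 [a2 [a3 [psi [[Vp VU] cc eqs met orbit]]]]]]]]] :=
  @local_normal_form R p r X G eps0 (fun t => expR (- 2 * P t)) h11 h12 f12 f11 r0 eps0_pm1 sE
    (res _ sq) (res _ sh)
    (res _ sf) (res _ sa) (fun t _ => expR_gt0 _) s s2 s_gt0 (fun t Bt => f11_t2 t (rO t Bt))
    (fun t Bt => f_t2 t (rO t Bt)) (h12_t1 _ Op) N0 (fun j k => Ck_sub rU (sX j k))
    (fun x k Bx => tangent_components X_tangent k (rU x Bx))
    (fun x i k Bx => sym x i k (rU x Bx)) (fun x Bx => G_N x (rU x Bx))
    (fun x Bx => etrans (sol x (rU x Bx)) (scale0r _)).
exists V, W, Phi, Psi, a1, a2, a3, psi; split=> //.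
by split=> // x /VU/rU.
Qed.
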